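(* Let $1\leq p<\infty$, let $\Omega\subseteq\mathbb{R}$ be an open interval which is forward invariant under $F\in C^1(\Omega)$ (real valued), and let $h\in C(\Omega)$ (complex valued) be such that $F'$ and $\mathrm{Re}\,h$ are bounded on $\Omega$ and the following hold: a) There is $\gamma\in\mathbb{R}$ such that $h(x)=\gamma$ for all $x\in\{F=0\}$. b) With $\alpha:=\inf\Omega$ and $\omega:=\sup\Omega$, the function $y\mapsto\frac{\mathrm{Im}\,h(y)}{F(y)}$ on $\Omega$ (taken to be $0$ at points of $\{F=0\}$, where $\mathrm{Im}\,h=0$ by a)) belongs to $L^1((\alpha,\beta))$ for all $\beta\in\Omega$, or belongs to $L^1((\beta,\omega))$ for all $\beta\in\Omega$. Then for every $\rho$ which is $p$-admissible for $F$ and $h$ the following are equivalent: (i) The $C_0$-semigroup $T_{F,h}$ is chaotic on $L^p_\rho(\Omega)$. (ii) $\lambda(\{F=0\})=0$ and for every connected component $C$ of $\Omega\setminus\{F=0\}$ $$\int_C\exp\Big(-p\int_x^w\frac{\mathrm{Re}\,h(y)}{F(y)}\,dy\Big)\rho(w)\,d\lambda(w)<\infty$$ for some $x\in C$ (equivalently, for all $x\in C$; that is, (i) is equivalent to (ii) both when (ii) is read with ''for some $x\in C$'' and when it is read with ''for all $x\in C$'').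
   Context: $\lambda$ denotes Lebesgue measure on $\mathbb{R}$, and $\{F=0\}:=\{x\in\Omega: F(x)=0\}$. Semiflow. For $F\in C^1(\Omega)$ real valued and $x_0\in\Omega$, let $\varphi(\cdot,x_0)$ be the unique maximal solution of $\dot x=F(x)$, $x(0)=x_0$ in $\Omega$, with maximal open interval of definition $J(x_0)\ni 0$. $\Omega$ is called forward invariant under $F$ if $[0,\infty)\subset J(x_0)$ for every $x_0\in\Omega$. For $h\in C(\Omega)$ complex valued and $t\geq 0$ put $h_t(x)=\exp\big(\int_0^t h(\varphi(s,x))\,ds\big)$, $x\in\Omega$. Weights. For a measurable function $\rho:\Omega\to(0,\infty)$, $L^p_\rho(\Omega)$ is the Banach space of (classes of) complex-valued functions that are $p$-integrable with respect to the measure $\rho\,d\lambda$. Such a $\rho$ is called $p$-admissible for $F$ and $h$ if there are constants $M\geq 1$, $\kappa\in\mathbb{R}$ such that for all $t\geq 0$, $x\in\Omega$: $$|h_t(x)|^p\rho(x)\leq M e^{\kappa t}\rho(\varphi(t,x))\exp\Big(\int_0^tF'(\varphi(s,x))\,ds\Big).$$ In this case the operators $(T(t)f)(x)=h_t(x)f(\varphi(t,x))$, $t\geq 0$, form a $C_0$-semigroup on $L^p_\rho(\Omega)$, denoted $T_{F,h}$. Chaos. A $C_0$-semigroup $T$ on a separable Banach space $X$ is chaotic if it is hypercyclic, i.e. there is $x\in X$ such that $\{T(t)x: t\geq 0\}$ is dense in $X$, and if the set of periodic points $\{x\in X:\exists\,t>0,\ T(t)x=x\}$ is dense in $X$. 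*)

(* Defs.v *)
(* MathComp-Analysis, over an arbitrary [R : realType]. *)
From HB Require Import structures.
From mathcomp Require Import all_boot all_order all_algebra.
From mathcomp Require Import complex.
From mathcomp Require Import all_classical all_reals all_analysis.

Set Implicit Arguments.
Unset Strict Implicit.
Unset Printing Implicit Defensive.

Import Order.TTheory GRing.Theory Num.Theory.
Import numFieldNormedType.Exports.

Local Open Scope classical_set_scope.
Local Open Scope ring_scope.
Local Open Scope complex_scope.

Section Semiflow.
Context {R : realType}.
Implicit Types (Omega I : set R) (F u : R -> R) (h : R -> R[i]) (phi : R -> R -> R).

Definition zeros Omega F : set R := [set x | Omega x /\ F x = 0].

Definition is_C1_on Omega F : Prop :=
  forall x, Omega x -> derivable F x 1 /\ {for x, continuous (derive1 F)}.

Definition ode_solution Omega F (x0 : R) I u : Prop :=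
  [/\ open I, is_interval I, I 0, u 0 = x0 &
      forall t, I t -> Omega (u t) /\ is_derive t 1 u (F (u t))].

Definition maximal_solution Omega F (x0 : R) I u : Prop :=
  ode_solution Omega F x0 I u /\
  forall I' v, ode_solution Omega F x0 I' v ->
    I' `<=` I /\ forall t, I' t -> v t = u t.

(* [J x] is the interval of existence of the maximal solution [phi ^~ x]. By
   Picard-Lindeloef such [J] and [phi] exist when [F] is C^1 on the open set
   [Omega], and they are unique there; [phi t x] is unconstrained for [t]
   outside [J x] and for [x] outside [Omega]. *)
Definition is_flow Omega F (J : R -> set R) phi : Prop :=
  forall x, Omega x -> maximal_solution Omega F x (J x) (phi ^~ x).

Definition forward_invariant Omega (J : R -> set R) : Prop :=
  forall x, Omega x -> `[0, +oo[ `<=` J x.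

(* The curve integrals below have continuous integrands, so they are taken
   against the Borel version [lebesgue_measure] of Lebesgue measure. *)

Definition cabs (z : R[i]) : R := complex.Re `|z|.

Definition cexp (z : R[i]) : R[i] :=
  (expR (complex.Re z) * cos (complex.Im z)) +i*
  (expR (complex.Re z) * sin (complex.Im z)).

Definition cint (D : set R) h : R[i] :=
  (\int[lebesgue_measure]_(s in D) complex.Re (h s)) +i*
  (\int[lebesgue_measure]_(s in D) complex.Im (h s)).

Definition cocycle phi h (t x : R) : R[i] :=
  cexp (cint `[0, t] (fun s => h (phi s x))).

Definition semigroup_op phi h (t : R) (f : R -> R[i]) : R -> R[i] :=
  fun x => cocycle phi h t x * f (phi t x).

(* Integral from [a] to [b], with the usual sign when [b < a]. *)
Definition oriented_int (a b : R) (g : R -> R) : R :=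
  if a <= b then \int[lebesgue_measure]_(y in `[a, b]) g y
  else - \int[lebesgue_measure]_(y in `[b, a]) g y.

End Semiflow.

(* [R] with the sigma-algebra of Lebesgue measurable sets, on which
   [completed_lebesgue_measure] is defined; the library's own structure on [R]
   is the Borel one. *)
Notation lebesgue_type R := (caratheodory_type (wlength (@idfun R))^*%mu).

Notation leb R := (@completed_lebesgue_measure R).

Section WeightedLp.
Context {R : realType}.
Variables (Omega : set R) (p : R) (rho : R -> R).
Implicit Types (f g : R -> R[i]) (T : R -> (R -> R[i]) -> (R -> R[i])).

Definition lebesgue_measurable_fun (f : R -> R) : Prop :=
  measurable_fun (Omega : set (lebesgue_type R)) (f : lebesgue_type R -> R).

Definition p_admissible (F : R -> R) (h : R -> R[i]) (phi : R -> R -> R)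
    : Prop :=
  exists M kappa : R, 1 <= M /\
    forall t x : R, 0 <= t -> Omega x ->
      cabs (cocycle phi h t x) `^ p * rho x <=
      M * expR (kappa * t) * rho (phi t x) *
        expR (\int[lebesgue_measure]_(s in `[0, t]) derive1 F (phi s x)).

Definition Lp_norm f : \bar R :=
  ((\int[leb R]_(x in Omega) (cabs (f x) `^ p * rho x)%:E) `^ p^-1)%E.

(* The elements of the weighted space are handled through representatives:
   functions [R -> R[i]], of which only the values on [Omega] matter. *)
Definition in_Lp f : Prop :=
  [/\ lebesgue_measurable_fun (fun x => complex.Re (f x)),
      lebesgue_measurable_fun (fun x => complex.Im (f x)) &
      (Lp_norm f < +oo)%E].

Definition dense_in_Lp (A : set (R -> R[i])) : Prop :=
  forall g, in_Lp g -> forall e : R, 0 < e ->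
    exists2 f, A f & (Lp_norm (f - g)%R < e%:E)%E.

Definition hypercyclic T : Prop :=
  exists2 f, in_Lp f & dense_in_Lp [set T t f | t in `[0, +oo[].

Definition periodic_points T : set (R -> R[i]) :=
  [set f | in_Lp f /\ exists2 t : R, 0 < t & ae_eq (leb R) Omega (T t f) f].

Definition chaotic T : Prop :=
  hypercyclic T /\ dense_in_Lp (periodic_points T).

Definition component_integral (F : R -> R) (h : R -> R[i]) (C : set R) (x : R)
    : \bar R :=
  (\int[leb R]_(w in C)
     (expR (- p * oriented_int x w (fun y => complex.Re (h y) / F y))
        * rho w)%:E)%E.

End WeightedLp.

(* Main.v *)
(* On a component C of {F <> 0} with base point x0, the flow time
   tau x = int_x0^x 1/F turns the semiflow into a translation of the line, and
   with E x = exp (int_x0^x h/F) one has E (T(t) f) = (E f) o phi_t.  So on C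
   the semigroup is a translation semigroup on the L^p space of the weight
   sigma = |E|^-p rho, whose total mass on C is the integral in (ii).

   (ii) => (i): when sigma has finite mass on every component, step functions of
   (component, tau) are dense and remain small when translated far away; a sum
   of widely separated translates of a countable dense family of them is
   hypercyclic, and periodic repetitions of them are dense.

   (i) => (ii): on {F = 0} the semigroup multiplies by the positive numbers
   exp (gamma t), so no orbit approximates both 1 and -1 there, and {F = 0} must
   be null.  If f is periodic of period T and does not vanish a.e. on C, then
   |E f| is T-periodic in the time tau, hence at least some delta > 0 on all
   T-translates of a set of times of positive measure, while admissibility makes
   the density sigma |F| of sigma with respect to d tau comparable over times
   less than 2 T apart.  Summing over the windows of length T bounds the mass of
   sigma by a multiple of the norm of f. *)
Require Import Defs.
From HB Require Import structures.
From mathcomp Require Import all_boot all_order all_algebra.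
From mathcomp Require Import complex.
From mathcomp Require Import all_classical all_reals all_analysis.
From mathcomp Require Import measurable_realfun.
From mathcomp Require Import ring lra.

Set Implicit Arguments.
Unset Strict Implicit.
Unset Printing Implicit Defensive.

Import Order.TTheory GRing.Theory Num.Theory.
Import numFieldNormedType.Exports.

Local Open Scope classical_set_scope.
Local Open Scope ring_scope.
Local Open Scope complex_scope.

(** * Integrals and complex moduli *)

Section nonneg_integral.
Local Open Scope ereal_scope.
Context d (T : measurableType d) (R : realType) (mu : {measure set T -> \bar R}).

(** The flow is only forward complete: [tau] maps a component onto an open interval closed under
    adding positive times, possibly not the whole line. Coordinates are therefore functions [k i r]
    of every real [r], of which only the values on the range are seen; they can be translated both
    ways, and backward translation acts as a right inverse of the semigroup. Admissibility compares
    the density [v] of sigma with respect to [d tau] in one direction only,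
    [v x <= K * v (phi t x)]. Hence the window of times just before [q + k T] is compared with good
    times just after it, through the point at [q + k T], at the cost [K ^+ 2]; a window that sticks
    out of the range is truncated or empty, which only lowers its mass. Estimates are made on
    integrals of p-th powers, with a crude factor 2^p per addition; the thresholds of the universal
    function are chosen to beat the powers of this factor. Curve integrals are Borel, the [L^p]
    spaces Lebesgue: periodicity and largeness of [E f] are first expressed by Borel sets, which the
    time change can transport. *)

Lemma ge0_le_integral_any (A B : set T) (f g : T -> \bar R) :
  (forall x, A x -> 0 <= f x) -> (forall x, B x -> 0 <= g x) ->
  (forall x, A x -> B x -> f x <= g x) ->
  (forall x, A x -> ~ B x -> f x = 0) ->
  \int[mu]_(x in A) f x <= \int[mu]_(x in B) g x.
Proof.
move=> f0 g0 fg fB; rewrite !ge0_integralE//.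
(* Both sides are suprema over the simple functions below the integrand extended by 0, so a
   pointwise comparison suffices and no measurability enters. *)
apply/ge_ereal_sup => /= _ [h /= hf <-]; apply: ereal_sup_ubound => /=.
exists h => // x; apply: (le_trans (hf x)).
rewrite /patch; case: ifPn => [/set_mem Ax|_]; last first.
  by case: ifPn => // /set_mem /g0.
case: ifPn => [/set_mem Bx|/negP Bx]; first exact: fg.
by rewrite fB// => Bx'; apply: Bx; rewrite inE.
Qed.

Lemma ge0_subset_integral_any (A B : set T) (f : T -> \bar R) :
  A `<=` B -> (forall x, B x -> 0 <= f x) ->
  \int[mu]_(x in A) f x <= \int[mu]_(x in B) f x.
Proof.
move=> AB f0; apply: ge0_le_integral_any => // x Ax; first exact/f0/AB.
by move=> /(_ (AB _ Ax)).
Qed.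

Lemma ge0_integral_null (N : set T) (f : T -> \bar R) :
  measurable N -> mu N = 0 -> (forall x, N x -> 0 <= f x) ->
  \int[mu]_(x in N) f x = 0.
Proof.
move=> mN N0 f0; apply/eqP; rewrite eq_le integral_ge0// andbT.
(* The constant [+oo] dominates [f], and its integral over a null set is [+oo * 0 = 0]. *)
have -> : 0 = \int[mu]_(x in N) (cst +oo) x.
  by rewrite integral_cst// N0 mule0.
by apply: ge0_le_integral_any => // x Nx; rewrite leey.
Qed.

(** Monotone convergence along [F], with finiteness allowing the subtraction. It yields small tails
    in time, truncation to bounded sets, and inner approximation of open sets by finitely many
    boxes. *)
Lemma integral_exhaustion (D : set T) (F : (set T)^nat) (f : T -> \bar R) :
  measurable_fun D f -> (forall x, D x -> 0 <= f x) ->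
  \int[mu]_(x in D) f x < +oo ->
  nondecreasing_seq F -> (forall i, measurable (F i)) -> \bigcup_i F i = D ->
  forall e : R, (0 < e)%R ->
  exists m, \int[mu]_(x in D `\` F m) f x < e%:E.
Proof.
move=> mf f0 Doo ndF mF FD e e0.
have mD : measurable D by rewrite -FD; exact: bigcupT_measurable.
have FiD i : F i `<=` D by rewrite -FD; exact: bigcup_sup.
have fF i : measurable_fun (F i) f by exact: measurable_funS (FiD i) mf.
have := @ge0_nondecreasing_set_cvg_integral _ _ _ F f mu ndF mF fF.
move=> /(_ (fun i x Fx => f0 _ (FiD i _ Fx))); rewrite FD.
have Dfin : \int[mu]_(x in D) f x \is a fin_num.
  by rewrite ge0_fin_numE// integral_ge0.
rewrite -[X in _ --> X](fineK Dfin).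
move=> /fine_cvgP[_] /cvgrPdist_lt /(_ _ e0) [m _ /(_ m (leqnn _)) /= He].
exists m; have Fm0 x : F m x -> 0 <= f x by move=> Fx; exact: f0 (FiD m _ Fx).
have Fmfin : \int[mu]_(x in F m) f x \is a fin_num.
  rewrite ge0_fin_numE ?integral_ge0//; apply: le_lt_trans Doo.
  exact: ge0_subset_integral_any.
have -> : \int[mu]_(x in D `\` F m) f x =
    \int[mu]_(x in D) f x - \int[mu]_(x in F m) f x.
  rewrite -[in X in _ = X - _](setDUK (FiD m)) ge0_integral_setU//.
  - by rewrite addeC addeK.
  - exact: measurableD.
  - by rewrite (setDUK (FiD m)).
  - by move=> x; rewrite (setDUK (FiD m)); exact: f0.
  - by apply/disj_setPS => x [? []].
rewrite -(fineK Dfin) -(fineK Fmfin) -EFinB lte_fin.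
by apply: le_lt_trans He; exact: ler_norm.
Qed.

End nonneg_integral.

(** * Borel and completed Lebesgue measure *)

Section completed_lebesgue.
Context {R : realType}.
Notation L := (lebesgue_type R).

Lemma borel_leb (A : set R) : measurable A -> measurable (A : set L).
Proof. exact: sub_caratheodory. Qed.

Lemma leb_borel (A : set R) : leb R (A : set L) = lebesgue_measure A.
Proof. by []. Qed.

Lemma leb_null_sub (A B : set R) : measurable (B : set L) -> leb R B = 0%E ->
  A `<=` B -> measurable (A : set L) /\ leb R A = 0%E.
Proof.
move=> mB B0 AB.
have mA : measurable (A : set L).
  by apply: completed_lebesgue_measure_is_complete; exists B.
split => //; apply/eqP; rewrite eq_le measure_ge0 andbT -B0.
by apply: le_measure => //; rewrite inE.
Qed.

Lemma measurable_fun_borel_leb d (Y : measurableType d) (D : set R) (f : R -> Y) :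
  measurable D -> measurable_fun D f -> measurable_fun (D : set L) (f : L -> Y).
Proof. by move=> mD mf _ B mB; apply: borel_leb; exact: mf. Qed.

(** The identity from the Lebesgue to the Borel sigma-algebra is measurable and pushes [leb R]
    forward to [lebesgue_measure]; this is its pushforward formula. *)
Lemma leb_integral_borel (D : set R) (f : R -> \bar R) : measurable D ->
  measurable_fun D f -> (forall x, D x -> (0 <= f x)%E) ->
  (\int[leb R]_(x in D) f x = \int[lebesgue_measure]_(x in D) f x)%E.
Proof.
move=> mD mf f0.
have mid : measurable_fun (setT : set L) (fun x : L => x : measurableTypeR R).
  by move=> _ B mB; rewrite setTI; exact: borel_leb.
have := @ge0_integral_pushforward _ _ L (measurableTypeR R) R
  (fun x => x) mid (leb R) D f mD mf.
rewrite /preimage /=.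
move=> <-; last by move=> y /set_mem; exact: f0.
by apply: eq_measure_integral => A mA _.
Qed.

End completed_lebesgue.
Section complex_modulus.
Context {R : realType}.
Implicit Types (z w : R[i]) (p : R).

Lemma cabsE z : cabs z = Num.sqrt (complex.Re z ^+ 2 + complex.Im z ^+ 2).
Proof. by case: z. Qed.

Lemma normc_cabs z : `|z| = (cabs z)%:C.
Proof. by case: z. Qed.

Lemma cabs_ge0 z : 0 <= cabs z.
Proof. by rewrite cabsE sqrtr_ge0. Qed.

Lemma cabsM z w : cabs (z * w) = cabs z * cabs w.
Proof.
have : `|z * w| = `|z| * `|w| by rewrite normrM.
by rewrite !normc_cabs -rmorphM => -[].
Qed.

Lemma cabsD z w : cabs (z + w) <= cabs z + cabs w.
Proof. by rewrite -lecR rmorphD /= -!normc_cabs ler_normD. Qed.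

Lemma cabsN z : cabs (- z) = cabs z.
Proof. by rewrite /cabs normrN. Qed.

Lemma cabs0 : cabs (0 : R[i]) = 0.
Proof. by rewrite /cabs normr0. Qed.

Lemma cabs1 : cabs (1 : R[i]) = 1.
Proof. by rewrite /cabs normr1. Qed.

Lemma cabs_real (x : R) : cabs x%:C = `|x|.
Proof. by rewrite cabsE /= expr0n /= addr0 sqrtr_sqr. Qed.

Lemma cabs_eq0 z : (cabs z == 0) = (z == 0).
Proof. by rewrite -(normr_eq0 z) normc_cabs eq_complex /= eqxx andbT. Qed.

Lemma cabs_gt0 z : (0 < cabs z) = (z != 0).
Proof. by rewrite lt_neqAle cabs_ge0 andbT eq_sym cabs_eq0. Qed.

Lemma le_Re_cabs z : `|complex.Re z| <= cabs z.
Proof. by rewrite cabsE -sqrtr_sqr ler_wsqrtr// lerDl sqr_ge0. Qed.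

Lemma le_Im_cabs z : `|complex.Im z| <= cabs z.
Proof. by rewrite cabsE -sqrtr_sqr ler_wsqrtr// lerDr sqr_ge0. Qed.

Lemma cabs_cexp z : cabs (cexp z) = expR (complex.Re z).
Proof.
rewrite cabsE /= !exprMn -mulrDr cos2Dsin2 mulr1 sqrtr_sqr.
by rewrite ger0_norm// expR_ge0.
Qed.

Lemma cexpD z w : cexp (z + w) = cexp z * cexp w.
Proof.
case: z => a b; case: w => c d; rewrite /cexp /=.
apply/eqP; rewrite eq_complex /=; apply/andP; split; apply/eqP.
  by rewrite expRD cosD; ring.
by rewrite expRD sinD; ring.
Qed.

Lemma cexp_neq0 z : cexp z != 0.
Proof. by rewrite -cabs_gt0 cabs_cexp expR_gt0. Qed.

(** The sum is at most twice the larger modulus. This quasi-triangle inequality for p-th powers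
    takes the place of Minkowski's. *)
Lemma powR_cabsD p z w : 0 <= p ->
  cabs (z + w) `^ p <= 2 `^ p * (cabs z `^ p + cabs w `^ p).
Proof.
move=> p0; wlog zw : z w / cabs z <= cabs w.
  move=> H; have [|/ltW] := leP (cabs z) (cabs w); first exact: H.
  by rewrite addrC (addrC (_ `^ p)); exact: H.
apply: (@le_trans _ _ ((2 * cabs w) `^ p)).
  rewrite ge0_ler_powR// ?nnegrE ?cabs_ge0 ?mulr_ge0 ?cabs_ge0//.
  by apply: (le_trans (cabsD _ _)); rewrite mulr_natl mulr2n lerD2r.
rewrite powRM ?cabs_ge0// ler_wpM2l ?powR_ge0//.
by rewrite lerDr powR_ge0.
Qed.

(** Splitting off the first summand each time, term [i] pays the factor of [powR_cabsD] exactly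
    [i + 1] times. The constants do not depend on [n], so the bound passes to series. *)
Lemma powR_cabs_sum p n (z : nat -> R[i]) : 0 < p ->
  cabs (\sum_(i < n) z i) `^ p <=
  \sum_(i < n) (2 `^ p) ^+ i.+1 * cabs (z i) `^ p.
Proof.
move=> p0; elim: n z => [|n IH] z.
  by rewrite !big_ord0 cabs0 powR0// gt_eqF.
rewrite !big_ord_recl; apply: (le_trans (powR_cabsD _ _ (ltW p0))).
rewrite mulrDr expr1 lerD2l.
apply: (le_trans (ler_wpM2l (powR_ge0 _ _) (IH (fun i => z i.+1)))).
rewrite mulr_sumr ler_sum// => i _.
by rewrite mulrA -exprS.
Qed.

End complex_modulus.

Section measurable_modulus.
Context d (T : measurableType d) (R : realType).
Implicit Types (f g : T -> R[i]) (D : set T).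

Definition cmeasurable D f : Prop :=
  measurable_fun D (fun x => complex.Re (f x)) /\
  measurable_fun D (fun x => complex.Im (f x)).

Lemma cmeasurableD D f g : cmeasurable D f -> cmeasurable D g ->
  cmeasurable D (fun x => f x + g x).
Proof.
move=> [mf1 mf2] [mg1 mg2]; split.
- have -> : (fun x => complex.Re (f x + g x)) =
    (fun x => complex.Re (f x) + complex.Re (g x)).
    by apply/funext => x; rewrite raddfD.
  exact: measurable_funD.
- have -> : (fun x => complex.Im (f x + g x)) =
    (fun x => complex.Im (f x) + complex.Im (g x)).
    by apply/funext => x; rewrite raddfD.
  exact: measurable_funD.
Qed.

Lemma cmeasurableM D f g : cmeasurable D f -> cmeasurable D g ->
  cmeasurable D (fun x => f x * g x).
Proof.
move=> [mf1 mf2] [mg1 mg2]; split.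
- have -> : (fun x => complex.Re (f x * g x)) = (fun x =>
    complex.Re (f x) * complex.Re (g x) - complex.Im (f x) * complex.Im (g x)).
    by apply/funext => x; case: (f x) => ? ?; case: (g x).
  by apply: measurable_funB; exact: measurable_funM.
- have -> : (fun x => complex.Im (f x * g x)) = (fun x =>
    complex.Re (f x) * complex.Im (g x) + complex.Im (f x) * complex.Re (g x)).
    by apply/funext => x; case: (f x) => ? ?; case: (g x).
  by apply: measurable_funD; exact: measurable_funM.
Qed.

Lemma cmeasurable_cst D (c : R[i]) : cmeasurable D (fun=> c).
Proof. by split; exact: measurable_cst. Qed.

Lemma cmeasurableN D f : cmeasurable D f -> cmeasurable D (fun x => - f x).
Proof.
move=> mf; have := cmeasurableM (cmeasurable_cst D (- 1)) mf.
by under eq_fun do rewrite mulN1r.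
Qed.

Lemma cmeasurableB D f g : cmeasurable D f -> cmeasurable D g ->
  cmeasurable D (fun x => f x - g x).
Proof. by move=> mf mg; apply: cmeasurableD => //; exact: cmeasurableN. Qed.

Lemma cmeasurable_real D (f : T -> R) : measurable_fun D f ->
  cmeasurable D (fun x => (f x)%:C).
Proof. by move=> mf; split => //; exact: measurable_cst. Qed.

Lemma measurable_cabs D f : cmeasurable D f ->
  measurable_fun D (fun x => cabs (f x)).
Proof.
move=> [mf1 mf2].
under eq_fun do rewrite cabsE.
apply: (measurableT_comp (f := @Num.sqrt R)).
  by apply: continuous_measurable_fun; exact: sqrt_continuous.
by apply: measurable_funD; exact: measurable_funX.
Qed.

Lemma measurable_powR_cabs D f (p : R) : cmeasurable D f ->
  measurable_fun D (fun x => cabs (f x) `^ p).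
Proof.
by move=> mf; apply: (measurableT_comp (measurable_powR p)); exact: measurable_cabs.
Qed.

Lemma cmeasurableV D f : cmeasurable D f -> cmeasurable D (fun x => (f x)^-1).
Proof.
move=> mf; have [mf1 mf2] := mf.
have mq : measurable_fun D (fun x => (cabs (f x) ^+ 2)^-1).
  (* Written as a power, the inverse square is measurable also across the zeros of [f], where both
     expressions are 0. *)
  have -> : (fun x => (cabs (f x) ^+ 2)^-1) = (fun x => cabs (f x) `^ (- 2)).
    by apply/funext => x; rewrite powRN powR_mulrn ?cabs_ge0.
  exact: measurable_powR_cabs.
have cabs2 z : cabs (z : R[i]) ^+ 2 = complex.Re z ^+ 2 + complex.Im z ^+ 2.
  by rewrite cabsE sqr_sqrtr// addr_ge0// sqr_ge0.
split.
- have -> : (fun x => complex.Re (f x)^-1) =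
    (fun x => complex.Re (f x) * (cabs (f x) ^+ 2)^-1).
    by apply/funext => x; rewrite cabs2; case: (f x).
  exact: measurable_funM.
- have -> : (fun x => complex.Im (f x)^-1) =
    (fun x => - (complex.Im (f x) * (cabs (f x) ^+ 2)^-1)).
    by apply/funext => x; rewrite cabs2; case: (f x).
  by apply: measurable_funN; exact: measurable_funM.
Qed.

End measurable_modulus.

(** * The flow on the components *)

Section fundamental_theorem.
Context {R : realType}.
Notation mu := (@lebesgue_measure R).
Implicit Types (f g : R -> R) (C : set R) (a b x : R).

Lemma itv_subset_interval C a b : is_interval C -> C a -> C b ->
  `[a, b] `<=` C.
Proof.
by move=> iC Ca Cb x /=; rewrite in_itv/= => axb; exact: (iC a b).
Qed.

Lemma open_interval_enlarge C a b : open C -> C a -> C b ->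
  exists a' b', [/\ C a', C b', a' < a & b < b'].
Proof.
move=> oC Ca Cb.
have [e /= e0 He] := (@nbhs_ballP _ _ _ _).1 (oC a Ca).
have [e' /= e'0 He'] := (@nbhs_ballP _ _ _ _).1 (oC b Cb).
exists (a - e / 2), (b + e' / 2); split.
- by apply: He; rewrite /ball /= opprB addrC subrK gtr0_norm ?divr_gt0//; lra.
- apply: He'; rewrite /ball /= opprD addrA subrr add0r normrN.
  by rewrite gtr0_norm ?divr_gt0//; lra.
- by rewrite ltrBlDr ltrDl divr_gt0.
- by rewrite ltrDl divr_gt0.
Qed.

Lemma integrable_itv_continuous g a b :
  (forall x, a <= x <= b -> {for x, continuous g}) ->
  mu.-integrable `[a, b] (EFin \o g).
Proof.
move=> cg; apply: continuous_compact_integrable; first exact: segment_compact.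
apply: continuous_in_subspaceT => x /set_mem /=; rewrite in_itv /=.
exact: cg.
Qed.

Lemma integral_FTC2 f g (a b : R) : a <= b ->
  (forall x, a <= x <= b -> is_derive x 1 f (g x)) ->
  (forall x, a <= x <= b -> {for x, continuous g}) ->
  (\int[mu]_(x in `[a, b]) (g x)%:E = (f b - f a)%:E)%E.
Proof.
rewrite le_eqVlt => /predU1P[<- _ _|ab dfg cg].
  by rewrite set_itv1 integral_set1 subrr.
rewrite (@continuous_FTC2 _ g f)//.
- apply: continuous_in_subspaceT => x /set_mem /=; rewrite in_itv /=.
  exact: cg.
- have cf x : a <= x <= b -> {for x, continuous f}.
    move=> xab; apply: differentiable_continuous; apply/derivable1_diffP.
    by have [] := dfg _ xab.
  split.
  + move=> x; rewrite in_itv/= => /andP[ax xb].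
    by apply: (@ex_derive _ _ _ _ _ _ _ (dfg x _)); rewrite !ltW.
  + by apply: cvg_at_right_filter; apply: cf; rewrite lexx ltW.
  + by apply: cvg_at_left_filter; apply: cf; rewrite lexx ltW.
- move=> x; rewrite in_itv/= => /andP[ax xb].
  rewrite derive1E; apply: (@derive_val _ _ _ _ _ _ _ (dfg x _)).
  by rewrite !ltW.
Qed.

Lemma Rintegral_FTC2 f g (a b : R) : a <= b ->
  (forall x, a <= x <= b -> is_derive x 1 f (g x)) ->
  (forall x, a <= x <= b -> {for x, continuous g}) ->
  \int[mu]_(x in `[a, b]) g x = f b - f a.
Proof.
by move=> ab dfg cg; rewrite /Rintegral (integral_FTC2 ab dfg cg).
Qed.

(** On an interval [[a, b]] with [x0] and [x] in its interior, the oriented integral is [G y - G x0]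
    with [G] the integral from [a], whichever of [x0] and [y] is larger; [G] falls under the
    fundamental theorem. *)
Lemma oriented_int_is_derive C x0 x g : open C -> is_interval C ->
  C x0 -> (forall y, C y -> {for y, continuous g}) -> C x ->
  is_derive x 1 (fun y => oriented_int x0 y g) (g x).
Proof.
move=> oC iC Cx0 cg Cx.
have [a [b [Ca Cb ax0 bx]]] : exists a b, [/\ C a, C b,
    a < Num.min x0 x & Num.max x0 x < b].
  apply: open_interval_enlarge => //; first by rewrite /Num.min; case: ifP.
  by rewrite /Num.max; case: ifP.
move: ax0 bx; rewrite lt_min gt_max => /andP[ax0 ax] /andP[x0b xb].
have ig c d : C c -> C d -> mu.-integrable `[c, d] (EFin \o g).
  by move=> Cc Cd; apply: integrable_itv_continuous => y ycd;
    apply: cg; exact: (iC c d).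
pose G y := \int[mu]_(t in `[a, y]) g t.
have GE y : C y -> a < y -> oriented_int x0 y g = G y - G x0.
  move=> Cy ay; rewrite /oriented_int /G; case: ifPn => [x0y|].
    rewrite (@Rintegral_itvB _ g (BLeft a) (BRight y)) ?bnd_simp ?(ltW ax0)//.
      rewrite Rintegral_itv_obnd_cbnd//.
      apply: integrableS (ig x0 y Cx0 Cy) => //.
      by move=> z /=; rewrite !in_itv/= => /andP[yz zy]; rewrite (ltW yz).
    exact: ig.
  rewrite -ltNge => yx0.
  rewrite -opprB (@Rintegral_itvB _ g (BLeft a) (BRight x0))
    ?bnd_simp ?(ltW ay) ?(ltW yx0)//.
    rewrite Rintegral_itv_obnd_cbnd//.
    by apply: integrableS (ig y x0 Cy Cx0) => //; exact: subset_itv_oc_cc.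
  exact: ig.
have [dG G'] := continuous_FTC1_closed xb (ig a b Ca Cb) ax (cg _ Cx).
apply: (@near_eq_is_derive _ _ _ (fun y => G y - G x0)).
  near=> y; rewrite GE//.
    by near: y; exact: oC.
  by near: y; exact: lt_nbhsr.
rewrite -[g x]subr0; apply: is_deriveB.
by apply: DeriveDef; [exact: dG|rewrite -derive1E; exact: G'].
Unshelve. all: by end_near. Qed.

Lemma Rintegral_itv_cst (c t : R) : 0 <= t -> \int[mu]_(s in `[0, t]) c = c * t.
Proof.
move=> t0; rewrite Rintegral_cst//= lebesgue_measure_itv/= lte_fin; congr (_ * _).
have [_|t0'] := ltP 0 t; first by rewrite oppr0 addr0.
by apply: le_anti; rewrite t0 t0'.
Qed.

End fundamental_theorem.

(** * The flow and the components of the regular set *)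

Section flow.
Context {R : realType}.
Variables (Omega : set R) (F : R -> R) (J : R -> set R) (phi : R -> R -> R).
Hypotheses (Omega_open : open Omega) (F_C1 : is_C1_on Omega F)
  (phi_flow : is_flow Omega F J phi) (Omega_fwd : forward_invariant Omega J).
Notation mu := (@lebesgue_measure R).
Implicit Types (x y z t s : R) (C : set R) (g : R -> R).
Let U := Omega `\` zeros Omega F.

Lemma field_continuous x : Omega x -> {for x, continuous F}.
Proof.
move=> Ox; apply: differentiable_continuous; apply/derivable1_diffP.
exact: (F_C1 Ox).1.
Qed.

Lemma regularE x : U x <-> Omega x /\ F x != 0.
Proof.
split=> [[Ox Zx]|[Ox /eqP Fx]]; split => //; last by case.
by apply/eqP => Fx; apply: Zx.
Qed.

Lemma regular_open : open U.
Proof.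
rewrite openE => x /regularE[Ox Fx].
have Fn : \forall y \near x, F y != 0.
  exact: (cvgr_neq0 _ (field_continuous Ox) Fx).
have On : \forall y \near x, Omega y by exact: Omega_open.
near=> y; apply/regularE; split; near: y; [exact: On|exact: Fn].
Unshelve. all: by end_near. Qed.

Lemma flow_initial x : Omega x -> phi 0 x = x.
Proof. by move=> /phi_flow[[]]. Qed.

Lemma flow_dom (t x : R) : Omega x -> 0 <= t -> J x t.
Proof. by move=> Ox t0; apply: (Omega_fwd Ox); rewrite /= in_itv/= t0. Qed.

Lemma flow_in (t x : R) : Omega x -> 0 <= t -> Omega (phi t x).
Proof.
by move=> Ox t0; have [[_ _ _ _ /(_ _ (flow_dom Ox t0))[]]] := phi_flow Ox.
Qed.

Lemma flow_is_derive (t x : R) : Omega x -> 0 <= t ->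
  is_derive t 1 (phi ^~ x) (F (phi t x)).
Proof.
by move=> Ox t0; have [[_ _ _ _ /(_ _ (flow_dom Ox t0))[]]] := phi_flow Ox.
Qed.

Lemma flow_continuous (t x : R) : Omega x -> 0 <= t ->
  {for t, continuous (phi ^~ x)}.
Proof.
move=> Ox t0; apply: differentiable_continuous; apply/derivable1_diffP.
exact: (@ex_derive _ _ _ _ _ _ _ (flow_is_derive Ox t0)).
Qed.

(** The constant solution on the whole line competes with the maximal one. *)
Lemma flow_zero (t x : R) : zeros Omega F x -> J x t /\ phi t x = x.
Proof.
move=> [Ox Fx]; have [_ /(_ setT (fun=> x))[]] := phi_flow Ox.
  split=> //; [exact: openT|].
  by move=> s _; rewrite Fx; split => //; exact: is_derive_cst.
by move=> JT phix; split; [exact: JT|rewrite -phix].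
Qed.

(* A solution through a zero of [F] is constant, so it never starts outside. *)
Lemma flow_regular (t x : R) : U x -> 0 <= t -> U (phi t x).
Proof.
move=> Ux t0; have [Ox Fx] := (regularE x).1 Ux.
have Opt := flow_in Ox t0.
split => // Zt.
have [[oJ iJ J0 phi0 solJ] _] := phi_flow Ox.
(* The orbit of [x], restarted at time [t], solves the equation through the zero [phi t x], so it
   agrees with the constant orbit; reading it at time [- t] gives [x = phi t x]. *)
have [_ /(_ (fun s => J x (s + t)) (fun s => phi (s + t) x))] := phi_flow Opt.
case.
  split => //.
  - have := @open_comp _ _ (fun s => s + t) (J x).
    apply => // s _; apply: (@continuousD _ _ _ (fun s => s) (fun=> t)).
      exact: cvg_id.
    exact: cvg_cst.
  - move=> a b Ja Jb s /andP[as_ sb]; apply: (iJ _ _ Ja Jb).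
    by rewrite !lerD2r as_ sb.
  - by rewrite add0r; exact: flow_dom.
  - by rewrite add0r.
  - move=> s Js; have [Os ds] := solJ _ Js; split => //.
    have -> : F (phi (s + t) x) = 1 *: F (phi (s + t) x) by rewrite scale1r.
    rewrite /GRing.scale /= mulrC.
    apply: (@is_derive1_comp _ (phi ^~ x) (fun s => s + t)) => //.
    rewrite -[X in is_derive _ _ _ X]addr0.
    exact: (@is_deriveD _ _ _ id (cst t)).
move=> _ /(_ (- t)); rewrite addNr => /(_ J0).
rewrite flow_initial// (flow_zero _ Zt).2 => xE.
by move: Fx; rewrite xE; case: Zt => _ ->; rewrite eqxx.
Qed.

Lemma component_open z : open (connected_component U z).
Proof.
rewrite openE => x Cx; have Ux := connected_component_sub Cx.
have [e /= e0 xeU] := (@nbhs_ballP _ _ _ _).1 (regular_open Ux).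
apply/nbhs_ballP; exists e => //= y xey.
apply: (connected_component_trans Cx).
exists (ball x e) => //; split => //; first exact: ballxx.
by apply/connected_intervalP; rewrite ball_itv; exact: interval_is_interval.
Qed.

Lemma component_interval z : is_interval (connected_component U z).
Proof. exact/connected_intervalP/component_connected. Qed.

(** The arc of orbit from [x] to [phi t x] is connected and avoids the zeros. *)
Lemma component_flow z x t : connected_component U z x -> 0 <= t ->
  connected_component U z (phi t x).
Proof.
move=> Cx t0; have Ux := connected_component_sub Cx.
have [Ox _] := Ux.
apply: (connected_component_trans Cx).
exists (phi ^~ x @` `[0, t]); last first.
  by exists t => //=; rewrite in_itv/= t0 lexx.
split.
- by exists 0; [rewrite /= in_itv/= lexx|exact: flow_initial].
- move=> y [s /=]; rewrite in_itv/= => /andP[s0 _] <-.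
  exact: flow_regular.
- apply: connected_continuous_connected.
    by apply/connected_intervalP; exact: interval_is_interval.
  apply: continuous_in_subspaceT => s /set_mem/=; rewrite in_itv/= => /andP[s0 _].
  exact: flow_continuous.
Qed.

Lemma flow_comp_continuous g x s : Omega x -> 0 <= s ->
  {for phi s x, continuous g} -> {for s, continuous (fun s => g (phi s x))}.
Proof.
move=> Ox s0 cg.
exact: (@continuous_comp _ _ _ (phi ^~ x) g _ (flow_continuous Ox s0) cg).
Qed.

(** The substitution [y = phi s x], obtained by differentiating [oriented_int x0 (phi s x) g] in
    [s]. *)
Lemma oriented_int_flow z x0 x t g :
  connected_component U z x0 -> connected_component U z x -> 0 <= t ->
  (forall y, connected_component U z y -> {for y, continuous g}) ->
  oriented_int x0 (phi t x) g =
  oriented_int x0 x g + \int[mu]_(s in `[0, t]) (g (phi s x) * F (phi s x)).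
Proof.
move=> Cx0 Cx t0 cg; have [Ox _] := connected_component_sub Cx.
rewrite [X in _ + X](_ : _ =
    oriented_int x0 (phi t x) g - oriented_int x0 (phi 0 x) g); last first.
  apply: (@Rintegral_FTC2 _ (fun s => oriented_int x0 (phi s x) g)) => //.
  - move=> s /andP[s0 _].
    apply: (@is_derive1_comp _ (fun y => oriented_int x0 y g) (phi ^~ x)).
      apply: oriented_int_is_derive Cx0 cg (component_flow Cx s0).
      + exact: component_open.
      + exact: component_interval.
    exact: flow_is_derive.
  - move=> s /andP[s0 _].
    apply: (@continuousM _ _ (fun s => g (phi s x)) (fun s => F (phi s x))).
      by apply: flow_comp_continuous => //; apply: cg; exact: component_flow.
    by apply: flow_comp_continuous => //; exact/field_continuous/flow_in.
by rewrite flow_initial// addrC subrK.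
Qed.

End flow.

Section continuity_complex.
Context {R : realType}.

Lemma continuous_complex (h : R -> R[i]) (x : R) :
  {for x, continuous (h : R -> R[i]^o)} ->
  {for x, continuous (fun y => complex.Re (h y))} /\
  {for x, continuous (fun y => complex.Im (h y))}.
Proof.
move=> ch; split; apply/cvgrPdist_lt => e e0.
- have /cvgrPdist_lt/(_ e%:C) := ch; rewrite ltcR => /(_ e0).
  apply: filterS => y; rewrite [X in X < _]normc_cabs ltcR.
  by apply: le_lt_trans; rewrite -raddfB /=; exact: le_Re_cabs.
- have /cvgrPdist_lt/(_ e%:C) := ch; rewrite ltcR => /(_ e0).
  apply: filterS => y; rewrite [X in X < _]normc_cabs ltcR.
  by apply: le_lt_trans; rewrite -raddfB /=; exact: le_Im_cabs.
Qed.

End continuity_complex.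

(** * Time and growth coordinates on a component *)

Section component_coordinates.
Context {R : realType}.
Implicit Types (F : R -> R) (h : R -> R[i]) (x y : R).

Definition flow_time F x0 x : R := oriented_int x0 x (fun y => (F y)^-1).

Definition log_growth F h x0 x : R :=
  oriented_int x0 x (fun y => complex.Re (h y) / F y).

(** The imaginary exponent cancels the rotation caused by [Im h], so that multiplication by [growth]
    turns the semigroup into translation exactly and not only in modulus. *)
Definition growth F h x0 x : R[i] :=
  cexp (log_growth F h x0 x +i*
        oriented_int x0 x (fun y => complex.Im (h y) / F y)).

Lemma cabs_growth F h x0 x : cabs (growth F h x0 x) = expR (log_growth F h x0 x).
Proof. by rewrite cabs_cexp. Qed.

Lemma growth_neq0 F h x0 x : growth F h x0 x != 0.
Proof. exact: cexp_neq0. Qed.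

End component_coordinates.

Section component_dynamics.
Context {R : realType}.
Variables (Omega : set R) (F : R -> R) (J : R -> set R) (phi : R -> R -> R).
Variable (h : R -> R[i]).
Hypotheses (Omega_open : open Omega) (F_C1 : is_C1_on Omega F)
  (phi_flow : is_flow Omega F J phi) (Omega_fwd : forward_invariant Omega J)
  (h_cont : forall x, Omega x -> {for x, continuous (h : R -> R[i]^o)}).
Notation mu := (@lebesgue_measure R).
Implicit Types (x y t s : R).
Let U := Omega `\` zeros Omega F.
Variables (z x0 : R).
Let C := connected_component U z.
Hypothesis Cx0 : C x0.

Let CO x : C x -> Omega x /\ F x != 0.
Proof. by move=> /connected_component_sub/regularE. Qed.

Lemma inv_field_continuous x : C x -> {for x, continuous (fun y => (F y)^-1)}.
Proof.
move=> /CO[Ox Fx]; apply: cvgV => //; exact: field_continuous F_C1 _ Ox.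
Qed.

Lemma re_quotient_continuous x : C x ->
  {for x, continuous (fun y => complex.Re (h y) / F y)}.
Proof.
move=> Cx; have [Ox _] := CO Cx; apply: cvgM; last exact: inv_field_continuous.
exact: (continuous_complex (h_cont Ox)).1.
Qed.

Lemma im_quotient_continuous x : C x ->
  {for x, continuous (fun y => complex.Im (h y) / F y)}.
Proof.
move=> Cx; have [Ox _] := CO Cx; apply: cvgM; last exact: inv_field_continuous.
exact: (continuous_complex (h_cont Ox)).2.
Qed.

Lemma flow_time_is_derive x : C x ->
  is_derive x 1 (flow_time F x0) (F x)^-1.
Proof.
apply: (@oriented_int_is_derive _ C x0 x (fun y => (F y)^-1)) => //.
- exact: component_open.
- exact: component_interval.
- exact: inv_field_continuous.
Qed.

Let oriented_int_continuous (g : R -> R) x : C x ->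
  (forall y, C y -> {for y, continuous g}) ->
  {for x, continuous (fun y => oriented_int x0 y g)}.
Proof.
move=> Cx cg; apply: differentiable_continuous; apply/derivable1_diffP.
apply: (@ex_derive _ _ _ _ _ _ _ (oriented_int_is_derive _ _ Cx0 cg Cx)).
- exact: component_open.
- exact: component_interval.
Qed.

Let measurable_continuous (g : R -> R) : (forall y, C y -> {for y, continuous g}) ->
  measurable_fun C g.
Proof.
move=> cg; apply: open_continuous_measurable_fun; first exact: component_open.
by move=> y /set_mem; exact: cg.
Qed.

Lemma flow_time_continuous x : C x -> {for x, continuous (flow_time F x0)}.
Proof.
by move=> Cx; apply: oriented_int_continuous => //; exact: inv_field_continuous.
Qed.

Lemma measurable_flow_time : measurable_fun C (flow_time F x0).
Proof. exact: measurable_continuous flow_time_continuous. Qed.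

Lemma measurable_log_growth : measurable_fun C (log_growth F h x0).
Proof.
apply: measurable_continuous => y Cy; apply: oriented_int_continuous => //.
exact: re_quotient_continuous.
Qed.

Lemma measurable_growth :
  measurable_fun C (fun x => complex.Re (growth F h x0 x)) /\
  measurable_fun C (fun x => complex.Im (growth F h x0 x)).
Proof.
have cim y : C y -> {for y, continuous (fun y =>
    oriented_int x0 y (fun y => complex.Im (h y) / F y))}.
  move=> Cy; apply: oriented_int_continuous => //.
  exact: im_quotient_continuous.
have mexp : measurable_fun C (fun x => expR (log_growth F h x0 x)).
  by apply: measurableT_comp => //; exact: measurable_log_growth.
split; apply: measurable_funM => //; apply: measurable_continuous => y Cy.
- apply: (continuous_comp (cim _ Cy)); exact: continuous_cos.
- apply: (continuous_comp (cim _ Cy)); exact: continuous_sin.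
Qed.

Lemma flow_time_flow x t : C x -> 0 <= t ->
  flow_time F x0 (phi t x) = flow_time F x0 x + t.
Proof.
move=> Cx t0.
rewrite /flow_time (oriented_int_flow Omega_open F_C1 phi_flow Omega_fwd Cx0 Cx t0)//; last first.
  exact: inv_field_continuous.
congr (_ + _).
transitivity (\int[mu]_(s in `[0, t]) (1 : R)).
  apply: eq_Rintegral => s /set_mem/=; rewrite in_itv/= => /andP[s0 _].
  have [_ Fs] : Omega (phi s x) /\ F (phi s x) != 0.
    by apply: CO; exact: (component_flow phi_flow Omega_fwd).
  by rewrite mulVf.
by rewrite Rintegral_itv_cst// mul1r.
Qed.

Lemma growth_flow x t : C x -> 0 <= t ->
  growth F h x0 (phi t x) = growth F h x0 x * cocycle phi h t x.
Proof.
move=> Cx t0; rewrite /growth /cocycle -cexpD; congr cexp.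
rewrite /log_growth !(oriented_int_flow Omega_open F_C1 phi_flow Omega_fwd Cx0 Cx t0)//; last 2 first.
  exact: im_quotient_continuous.
  exact: re_quotient_continuous.
rewrite /cint; apply/eqP; rewrite eq_complex /=.
have Fphi s : 0 <= s -> F (phi s x) != 0.
  by move=> s0; apply: (CO _).2; exact: (component_flow phi_flow Omega_fwd).
apply/andP; split; apply/eqP; congr (_ + _); apply: eq_Rintegral => s;
  move/set_mem => /=; rewrite in_itv/= => /andP[s0 _]; rewrite divfK//;
  exact: Fphi.
Qed.

(** By the intermediate value theorem. [sg] is the direction of the flow; multiplying by it treats
    increasing and decreasing [flow_time] together. *)
Lemma field_sign : exists2 sg : R, sg = 1 \/ sg = -1 &
  forall x, C x -> 0 < sg * F x.
Proof.
pose sg : R := if 0 < F x0 then 1 else -1.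
exists sg; first by rewrite /sg; case: ifP => _; [left|right].
have [_ Fx0] := CO Cx0.
have sg0 : 0 < sg * F x0.
  rewrite /sg; case: (ltP 0 (F x0)) => [F0|Fle]; first by rewrite mul1r.
  by rewrite mulN1r oppr_gt0 lt_neqAle Fx0.
move=> x Cx; rewrite ltNge; apply/negP => sgx.
have [_ Fx] := CO Cx.
have key a b : a <= b -> C a -> C b ->
    Num.min (sg * F a) (sg * F b) <= 0 <= Num.max (sg * F a) (sg * F b) -> False.
  move=> ab Ca Cb ab0.
  have iC := @component_interval R Omega F z.
  have cF : {within `[a, b], continuous (fun y => sg * F y)}.
    apply: continuous_in_subspaceT => y /set_mem yab.
    apply: cvgM; first exact: cvg_cst.
    apply: (field_continuous F_C1); apply: (CO _).1.
    exact: itv_subset_interval yab.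
  have [c cab] := IVT ab cF ab0.
  have [_ Fc] : Omega c /\ F c != 0.
    by apply: CO; exact: itv_subset_interval cab.
  move/eqP; rewrite mulf_eq0 (negbTE Fc) orbF /sg.
  by case: ifP; rewrite ?oppr_eq0 oner_eq0.
have [xx0|x0x] := leP x x0.
  by apply: (key _ _ xx0) => //; rewrite ge_min le_max sgx (ltW sg0) orbT.
by apply: (key _ _ (ltW x0x)) => //; rewrite ge_min le_max sgx (ltW sg0) orbT.
Qed.

Lemma flow_time_mono sg x y : (forall x, C x -> 0 < sg * F x) ->
  C x -> C y -> x < y -> sg * flow_time F x0 x < sg * flow_time F x0 y.
Proof.
move=> sgF Cx Cy xy; rewrite -subr_gt0 -mulrBr.
have Cxy c : c \in `[x, y] -> C c.
  by move=> cxy; apply: (itv_subset_interval (@component_interval R Omega F z) Cx Cy).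
have [c cxy ->] : exists2 c, c \in `]x, y[ &
    flow_time F x0 y - flow_time F x0 x = (F c)^-1 * (y - x).
  apply: (@MVT _ _ (fun c => (F c)^-1)) => //.
    by move=> c cxy; apply/flow_time_is_derive/Cxy; exact: subset_itv_oo_cc cxy.
  apply: continuous_in_subspaceT => c /set_mem cxy.
  by apply: flow_time_continuous; exact: Cxy.
have Cc : C c by apply: Cxy; exact: subset_itv_oo_cc cxy.
rewrite mulrA mulr_gt0 ?subr_gt0//.
have := sgF _ Cc; have [_ Fc] := CO Cc.
(* [sg / F c] has the sign of [sg * F c]: the two differ by the square of [(F c)^-1]. *)
rewrite -(pmulr_lgt0 (sg * F c) (_ : 0 < (F c)^-1 ^+ 2)); last first.
  by rewrite lt_neqAle sqr_ge0 andbT eq_sym sqrf_eq0 invr_eq0.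
by rewrite -mulrA expr2 (mulrA (F c)) divff// mul1r.
Qed.

End component_dynamics.

(** * Translation of step functions *)

(* [(i, q1, q2)] stands for the times in [`]q1, q2[] on the component [i]. *)
Notation basic_itv := (nat * rat * rat)%type.

(* [(a, b, l)] encodes [a + i b] times the indicator of the union of the boxes in
   [l], and a code the sum of its items; rational data make the codes countable. *)
Notation step_code := (seq (rat * rat * seq (nat * rat * rat)))%type.

Section tame_functions.
Context {R : realType}.
Implicit Types (k : nat -> R -> R[i]) (r t : R).

(* [k i r]: [i] indexes a component of [{F <> 0}] and [r] is the time coordinate
   on it. *)
Definition tame k (n : nat) (A B : R) : Prop :=
  [/\ 0 <= A /\ 0 <= B,
      forall i r, cabs (k i r) <= B,
      forall i r, (n <= i)%N \/ A <= `|r| -> k i r = 0 &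
      forall i, cmeasurable setT (k i)].

Definition in_basic (b : basic_itv) i r : bool :=
  (b.1.1 == i) && (ratr b.1.2 < r < ratr b.2).

Definition step_fun (c : step_code) i r : R[i] :=
  \sum_(a <- c) (ratr a.1.1 +i* ratr a.1.2) *
    (if has (fun b => in_basic b i r) a.2 then 1 else 0).

Lemma in_basics_bounded (l : seq basic_itv) : exists (n : nat) (A : R), 0 <= A /\
  forall i r, has (fun b => in_basic b i r) l -> (i < n)%N /\ `|r| < A.
Proof.
elim: l => [|[[j q1] q2] l [n [A [A0 IH]]]]; first by exists 0%N, 0.
exists (maxn j.+1 n), (Num.max A (`|ratr q1| + `|ratr q2|)).
split; first by rewrite le_max A0.
move=> i r /= /orP[|/IH[iN rA]]; last by rewrite leq_max iN orbT lt_max rA.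
rewrite /in_basic /= => /andP[/eqP <- /andP[qr rq]].
rewrite leq_max leqnn; split => //; rewrite lt_max; apply/orP; right.
have [r0|r0] := leP 0 r.
  rewrite ger0_norm// (lt_le_trans rq)// (le_trans (ler_norm _))//.
  by rewrite lerDr.
rewrite ltr0_norm// (@lt_le_trans _ _ (- ratr q1)) ?ltrN2//.
by rewrite (le_trans (ler_norm _))// normrN lerDl.
Qed.

Lemma measurable_in_basics (l : seq basic_itv) i :
  measurable [set r : R | has (fun b => in_basic b i r) l].
Proof.
elim: l => [|b l IH].
  have -> : [set r : R | has (fun b => in_basic b i r) [::]] = set0.
    by apply/seteqP; split.
  exact: measurable0.
have -> : [set r : R | has (fun b => in_basic b i r) (b :: l)] =
    [set r | in_basic b i r] `|` [set r | has (fun b => in_basic b i r) l].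
  by apply/seteqP; split => r /=; [move/orP|move=> H; apply/orP].
apply: measurableU => //; rewrite /in_basic; case: (b.1.1 == i) => /=.
  have -> : [set r : R | ratr b.1.2 < r < ratr b.2] =
      `]ratr b.1.2, ratr b.2[%classic.
    by apply/seteqP; split => r /=; rewrite in_itv.
  exact: measurable_itv.
have -> : [set _ : R | false] = set0 by apply/seteqP; split.
exact: measurable0.
Qed.

Lemma step_fun_tame c : exists n A B, tame (step_fun c) n A B.
Proof.
elim: c => [|[[u v] l] c [n [A [B [[A0 B0] kB k0 mk]]]]].
  exists 0%N, 0, 0; split => //.
  - by move=> i r; rewrite /step_fun big_nil cabs0.
  - by move=> i r _; rewrite /step_fun big_nil.
  - move=> i; rewrite /step_fun.
    by under eq_fun do rewrite big_nil; exact: cmeasurable_cst.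
have [n' [A' [A'0 lA]]] := in_basics_bounded l.
exists (maxn n n'), (Num.max A A'), (cabs (ratr u +i* ratr v) + B).
have E i r : step_fun ((u, v, l) :: c) i r = (ratr u +i* ratr v) *
    (if has (fun b => in_basic b i r) l then 1 else 0) + step_fun c i r.
  by rewrite /step_fun big_cons.
split.
- by rewrite le_max A0 addr_ge0// cabs_ge0.
- move=> i r; rewrite E; apply: (le_trans (cabsD _ _)); apply: lerD => //.
  by case: ifP => _; rewrite ?mulr1// mulr0 cabs0 cabs_ge0.
- move=> i r ir; rewrite E k0 ?addr0; last first.
    case: ir => [|]; rewrite ?geq_max ?ge_max => /andP[]; first by left.
    by right.
  case: ifPn; rewrite ?mulr0// => /lA[iN rA].
  case: ir; rewrite ?geq_max ?ge_max => /andP[_].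
    by rewrite leqNgt iN.
  by rewrite leNgt rA.
- move=> i; rewrite (_ : step_fun _ i = fun r => (ratr u +i* ratr v) *
      (if has (fun b => in_basic b i r) l then 1 else 0) + step_fun c i r).
    2: by apply/funext => r; exact: E.
  apply: cmeasurableD; last exact: mk.
  apply: cmeasurableM; first exact: cmeasurable_cst.
  rewrite (_ : (fun r => _) = (fun r =>
    (\1_[set r : R | has (fun b => in_basic b i r) l] r : R)%:C)); last first.
    apply/funext => r; rewrite indicE; case: ifPn => [lr|/negP lr].
      by rewrite mem_set.
    by rewrite memNset.
  by apply: cmeasurable_real; apply: measurable_indic; exact: measurable_in_basics.
Qed.

End tame_functions.

(** * Energy of functions in the time coordinates *)

Section energy.
Context d (T : measurableType d) {R : realType}.
Variables (mu : {measure set T -> \bar R}) (D : set T) (sigma : T -> R).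
Variables (iota : T -> nat) (tau : T -> R) (p : R).
Hypotheses (mD : measurable D) (msigma : measurable_fun D sigma)
  (sigma_ge0 : forall x, D x -> 0 <= sigma x)
  (miota : forall n, measurable (D `&` [set x | iota x = n]))
  (mtau : measurable_fun D tau) (p_gt0 : 0 < p)
  (sigma_fin : forall n,
     (\int[mu]_(x in D `&` [set x | iota x = n]) (sigma x)%:E < +oo)%E).
Implicit Types (k : nat -> R -> R[i]) (r t : R).

(** The p-th power of the weighted norm of the function with coordinates [k]; without the root it
    remains an integral and can be summed over series. *)
Definition energy k : \bar R :=
  (\int[mu]_(x in D) (cabs (k (iota x) (tau x)) `^ p * sigma x)%:E)%E.

Let D_ n := D `&` [set x | (iota x < n)%N].

Let far n (A : R) := D_ n `&` [set x | A <= `|tau x|].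

Lemma measurable_below n : measurable (D_ n).
Proof.
rewrite (_ : D_ n = \bigcup_(i in `I_n) (D `&` [set x | iota x = i])).
  exact: bigcup_measurable.
apply/seteqP; split => [x [Dx /= xn]|x [i /= iN [Dx xi]]].
  by exists (iota x).
by split => //=; rewrite xi.
Qed.

Lemma measurable_index_fun (g : nat -> T -> R) :
  (forall n, measurable_fun (D `&` [set x | iota x = n]) (g n)) ->
  measurable_fun D (fun x => g (iota x) x).
Proof.
move=> mg _ B mB.
rewrite (_ : D `&` _ = \bigcup_n ((D `&` [set x | iota x = n]) `&` g n @^-1` B)).
  by apply: bigcupT_measurable => n; exact: mg.
apply/seteqP; split => [x [Dx gx]|x [n _ [[Dx /= xn] gx]]].
  by exists (iota x).
by split => //; rewrite /preimage /= xn.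
Qed.

Lemma cmeasurable_coord k : (forall i, cmeasurable setT (k i)) ->
  cmeasurable D (fun x => k (iota x) (tau x)).
Proof.
move=> mk; split.
- apply: (measurable_index_fun (g := fun n x => complex.Re (k n (tau x)))) => n.
  apply: (measurable_funS mD (@subIsetl _ _ _)).
  by apply: (measurableT_comp (f := fun r => complex.Re (k n r))) => //; case: (mk n).
- apply: (measurable_index_fun (g := fun n x => complex.Im (k n (tau x)))) => n.
  apply: (measurable_funS mD (@subIsetl _ _ _)).
  by apply: (measurableT_comp (f := fun r => complex.Im (k n r))) => //; case: (mk n).
Qed.

Lemma measurable_energy k : (forall i, cmeasurable setT (k i)) ->
  measurable_fun D (fun x => (cabs (k (iota x) (tau x)) `^ p * sigma x)%:E).
Proof.
move=> mk; apply/measurable_EFinP; apply: measurable_funM => //.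
by apply: measurable_powR_cabs; exact: cmeasurable_coord.
Qed.

Lemma energy_integrand_ge0 k x : D x ->
  (0 <= (cabs (k (iota x) (tau x)) `^ p * sigma x)%:E)%E.
Proof. by move=> Dx; rewrite lee_fin mulr_ge0// ?powR_ge0// sigma_ge0. Qed.

Lemma mass_below n : (\int[mu]_(x in D_ n) (sigma x)%:E < +oo)%E.
Proof.
elim: n => [|n IH].
  rewrite (_ : D_ 0%N = set0) ?integral_set0//.
  by apply/seteqP; split => x [].
rewrite (_ : D_ n.+1 = D_ n `|` (D `&` [set x | iota x = n])); last first.
  apply/seteqP; split=> [x [Dx /=]|x].
    by rewrite ltnS leq_eqVlt => /orP[/eqP|]; [right|left].
  by case=> [] [Dx /= xn]; split => //=; [exact: ltnW|rewrite xn].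
have DU : D_ n `|` (D `&` [set x | iota x = n]) `<=` D.
  by move=> x [] [].
rewrite ge0_integral_setU//.
- exact: lte_add_pinfty.
- exact: measurable_below.
- by apply/measurable_EFinP; exact: measurable_funS DU _.
- by move=> x /DU Dx; rewrite lee_fin sigma_ge0.
- by apply/disj_setPS => x [[Dx /= xn] [_ /= xn']]; move: xn; rewrite xn' ltnn.
Qed.

Lemma tail_small n (e : R) : 0 < e -> exists2 A : R, 0 <= A &
  (\int[mu]_(x in far n A) (sigma x)%:E < e%:E)%E.
Proof.
move=> e0; pose V m := D_ n `&` [set x | `|tau x| < m%:R].
have DnD : D_ n `<=` D by move=> x [].
have msn : measurable_fun (D_ n) (EFin \o sigma).
  by apply/measurable_EFinP; exact: measurable_funS DnD _.
have [||||m Hm] := @integral_exhaustion _ _ _ mu (D_ n) V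
    (EFin \o sigma) msn _ (mass_below n) _ _ _ e e0.
- by move=> x [Dx _]; rewrite lee_fin sigma_ge0.
- apply/nondecreasing_seqP => m; rewrite subsetEset => x [Dx /= xm].
  by split => //=; rewrite (lt_le_trans xm)// ler_nat.
- move=> m; rewrite /V.
  have -> : D_ n `&` [set x | `|tau x| < m%:R] =
      D_ n `&` (D `&` (fun x => `|tau x|) @^-1` `]-oo, m%:R[%classic).
    apply/seteqP; split => x.
      by move=> [[Dx xn] /= xm]; split => //; split => //=; rewrite in_itv.
    by move=> [Dx [_ /=]]; rewrite in_itv.
  apply: measurableI; first exact: measurable_below.
  have mnt : measurable_fun D (fun x => `|tau x|) by exact: measurableT_comp.
  by apply: mnt => //; exact: measurable_itv.
- apply/seteqP; split => [x [m _ []]//|x Dx].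
  exists (Num.truncn `|tau x|).+1 => //; split => //=.
  exact: truncnS_gt.
exists m%:R => //; apply: le_lt_trans Hm.
rewrite le_eqVlt; apply/orP; left; apply/eqP; congr (integral _ _ _).
apply/seteqP; split => x [Dx /= xm]; split => //.
  by move=> [_ /=]; rewrite ltNge xm.
by rewrite /= leNgt; apply/negP => xm'; apply: xm.
Qed.

(** The support condition confines the integral to the first [n] components and to times of modulus
    at least [A]. With [A = 0] it serves to show that a bounded function on finitely many components
    has finite energy. *)
Lemma energy_le_tail k n (A B : R) : 0 <= B -> (forall i r, cabs (k i r) <= B) ->
  (forall i r, (n <= i)%N \/ `|r| < A -> k i r = 0) ->
  (energy k <= (B `^ p)%:E *
     \int[mu]_(x in far n A) (sigma x)%:E)%E.
Proof.
move=> B0 kB k0.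
pose W := far n A.
have WD : W `<=` D by move=> x [[]].
have mW : measurable W.
  have -> : W = D_ n `&` (D `&` (fun x => `|tau x|%R) @^-1` `[A, +oo[%classic).
    apply/seteqP; split => x.
      by move=> [[Dx xn] /= xm]; split => //; split => //=; rewrite in_itv/= xm.
    by move=> [Dx [_ /=]]; rewrite in_itv/= andbT.
  apply: measurableI; first exact: measurable_below.
  have mnt : measurable_fun D (fun x => `|tau x|%R) by exact: measurableT_comp.
  by apply: mnt => //; exact: measurable_itv.
rewrite -ge0_integralZl_EFin ?powR_ge0//; last 2 first.
  by move=> x Wx; rewrite lee_fin sigma_ge0//; exact: WD.
  by apply/measurable_EFinP; exact: measurable_funS WD _.
apply: ge0_le_integral_any => x.
- exact: energy_integrand_ge0.
- by move=> Wx; rewrite -EFinM lee_fin mulr_ge0 ?powR_ge0// sigma_ge0//; exact: WD.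
- move=> Dx Wx; rewrite -EFinM lee_fin ler_wpM2r ?sigma_ge0//.
  by apply: (ge0_ler_powR (ltW p_gt0)); rewrite ?nnegrE ?cabs_ge0.
- move=> Dx Wx; rewrite k0 ?cabs0 ?powR0 ?mul0r ?gt_eqF//.
  have [nx|xn] := leqP n (iota x); [by left|right].
  by rewrite ltNge; apply/negP => Ax; apply: Wx.
Qed.

Lemma energy_tail_small n (B e : R) : 0 <= B -> 0 < e -> exists2 A : R, 0 <= A &
  forall k, (forall i r, cabs (k i r) <= B) ->
  (forall i r, (n <= i)%N \/ `|r| < A -> k i r = 0) -> (energy k <= e%:E)%E.
Proof.
move=> B0 e0.
(* Adding 1 keeps the divisor positive even if [B = 0]. *)
have Bp : 0 < B `^ p + 1 by rewrite ltr_wpDl// powR_ge0.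
have [A A0 HA] := @tail_small n (e / (B `^ p + 1)) (divr_gt0 e0 Bp).
exists A => // k kB k0; apply: (le_trans (energy_le_tail B0 kB k0)).
apply: (@le_trans _ _ ((B `^ p)%:E * (e / (B `^ p + 1))%:E)%E).
  by apply: lee_wpmul2l; [rewrite lee_fin powR_ge0|exact: ltW].
rewrite -EFinM lee_fin mulrCA ler_piMr ?(ltW e0)//.
by rewrite ler_pdivrMr// mul1r lerDl.
Qed.

(** For [|t| >= A + A'] the translate lives at times of modulus at least [A'], where the finite mass
    leaves little energy, whichever the direction of the shift. *)
Lemma tame_shift_small k n (A B e : R) : tame k n A B -> 0 < e ->
  exists2 L : R, 0 <= L &
    forall t, L <= `|t| -> (energy (fun i r => k i (r + t)%R) <= e%:E)%E.
Proof.
move=> [[A0 B0] kB k0 mk] e0.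
have [A' A'0 HA'] := @energy_tail_small n B e B0 e0.
exists (A + A'); first by rewrite addr_ge0.
move=> t tL; apply: HA' => // i r [ni|rA]; first by apply: k0; left.
apply: k0; right; rewrite -(lerD2r A') (le_trans tL)//.
rewrite (_ : t = (r + t) - r); last by rewrite addrAC subrr add0r.
by rewrite [in leRHS]addrCA subrr addr0 (le_trans (ler_normB _ _))// lerD2l ltW.
Qed.

End energy.

(** * Periodic repetitions and series of translates *)

Section translation_dynamics.
Context d (T : measurableType d) {R : realType}.
Variables (mu : {measure set T -> \bar R}) (D : set T) (sigma : T -> R).
Variables (iota : T -> nat) (tau : T -> R) (p : R).
Hypotheses (mD : measurable D) (msigma : measurable_fun D sigma)
  (sigma_ge0 : forall x, D x -> 0 <= sigma x)
  (miota : forall n, measurable (D `&` [set x | iota x = n]))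
  (mtau : measurable_fun D tau) (p_gt0 : 0 < p)
  (sigma_fin : forall n,
     (\int[mu]_(x in D `&` [set x | iota x = n]) (sigma x)%:E < +oo)%E).
Implicit Types (k : nat -> R -> R[i]) (r t : R).
Local Notation energy := (energy mu D sigma iota tau p).

(** The representative of [r] modulo [P] in [[- P / 2, P / 2)]. *)
Let wrap (P r : R) : R := r - P * (Num.floor (r / P + 2^-1))%:~R.

(** Repeat the part of [k] in one period. If [P] exceeds [2 A'], the repetition agrees with [k] for
    [|r| < A']; the difference elsewhere is bounded by [2 B], and its energy is a tail. *)
Lemma tame_periodic k n (A B e : R) : tame k n A B -> 0 < e ->
  exists P k', [/\ 0 < P, forall i, cmeasurable setT (k' i),
    forall i r, k' i (r + P) = k' i r, (energy k' < +oo)%E &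
    (energy (fun i r => k' i r - k i r)%R <= e%:E)%E].
Proof.
move=> [[A0 B0] kB k0 mk] e0.
have B20 : 0 <= B + B by rewrite addr_ge0.
have [A' A'0 HA'] := energy_tail_small mD msigma sigma_ge0 miota mtau p_gt0
  sigma_fin n B20 e0.
have [P P0 PA] : exists2 P : R, 0 < P & A' + A' < P.
  by exists (A' + A' + 1); [rewrite ltr_wpDl// addr_ge0|rewrite ltrDl].
exists P, (fun i r => k i (wrap P r)); split => //.
- move=> i; have mw : measurable_fun setT (wrap P).
    apply: measurable_funB => //; apply: measurable_funM => //.
    apply: nondecreasing_measurable => // x y xy.
    by rewrite ler_int le_floor// lerD2r ler_pM2r ?invr_gt0.
  have [mk1 mk2] := mk i; split.
    exact: (measurableT_comp mk1 mw).
  exact: (measurableT_comp mk2 mw).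
- move=> i r; congr (k i _); rewrite /wrap mulrDl divff ?gt_eqF//.
  rewrite (addrAC (r / P)) floorDrz ?rpred1// floor1 intrD mulrDr mulr1.
  by rewrite opprD addrACA subrr addr0.
- have kB' i r : cabs (k i (wrap P r)) <= B by [].
  have k0' i r : (n <= i)%N \/ `|r| < 0 -> k i (wrap P r) = 0.
    by move=> [ni|]; [apply: k0; left|rewrite ltNge normr_ge0].
  apply: (le_lt_trans (energy_le_tail mu mD msigma sigma_ge0 miota mtau p_gt0 B0 kB' k0')).
  rewrite lte_mul_pinfty// ?lee_fin ?powR_ge0//.
  apply: le_lt_trans (mass_below mD msigma sigma_ge0 miota sigma_fin n).
  by apply: ge0_subset_integral_any => x [] // Dx _; rewrite lee_fin sigma_ge0.
- apply: HA' => i r.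
    by rewrite (le_trans (cabsD _ _))// cabsN lerD.
  move=> [ni|rA]; first by rewrite !k0 ?subrr//; left.
  suff -> : wrap P r = r by rewrite subrr.
  rewrite /wrap (@floor_def _ _ 0) ?mulr0 ?subr0// add0r.
  have /andP[r1 r2] : - A' < r < A' by rewrite -ltr_norml.
  have rP : - (2^-1) < r / P < 2^-1.
    by rewrite ltr_pdivrMr// ltr_pdivlMr//; apply/andP; split; lra.
  by case/andP: rP => ? ?; apply/andP; split; lra.
Qed.

(** At each point the sum is finite, so [powR_cabs_sum] applies there with constants independent of
    [N]; after termwise integration the budgets [e / 2 ^ (l + 1)] add up to [e]. *)
Lemma energy_series k (b : nat -> nat -> R -> R[i]) (e : R) : 0 <= e ->
  (forall l i, cmeasurable setT (b l i)) ->
  (forall i r, exists N, k i r = \sum_(l < N) b l i r) ->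
  (forall l, ((2 `^ p) ^+ l.+1)%:E * energy (b l) <= (e / (2 ^ l.+1)%:R)%:E)%E ->
  (energy k <= e%:E)%E.
Proof.
move=> e0 mb kE bE.
pose f l x := (((2 `^ p) ^+ l.+1)%:E *
  (cabs (b l (iota x) (tau x)) `^ p * sigma x)%:E)%E.
have f0 l x : D x -> (0 <= f l x)%E.
  move=> Dx; rewrite /f -EFinM lee_fin !mulr_ge0 ?exprn_ge0 ?powR_ge0//.
  exact: sigma_ge0.
have mf l : measurable_fun D (f l).
  apply: measurable_funeM; apply: (measurable_energy p mD msigma miota mtau) => i.
  exact: mb.
apply: (@le_trans _ _ (\int[mu]_(x in D) \sum_(l <oo) f l x)%E).
  apply: ge0_le_integral_any => // x Dx.
  - exact: (energy_integrand_ge0 iota tau p sigma_ge0 k Dx).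
  - by apply: nneseries_ge0 => l _ _; exact: f0.
  - move=> _; have [N ->] := kE (iota x) (tau x).
    apply: (@le_trans _ _ (\sum_(0 <= l < N) f l x)%E); last first.
      by apply: nneseries_lim_ge => l _ _; exact: f0.
    rewrite big_mkord (eq_bigr (fun l : 'I_N => ((2 `^ p) ^+ l.+1 *
        cabs (b l (iota x) (tau x)) `^ p * sigma x)%:E)); last first.
      by move=> l _; rewrite /f -EFinM mulrA.
    rewrite sumEFin lee_fin.
    rewrite -mulr_suml ler_wpM2r ?sigma_ge0//.
    exact: (powR_cabs_sum N (fun l => b l (iota x) (tau x)) p_gt0).
rewrite integral_nneseries//.
apply: (@le_trans _ _ (\sum_(l <oo) (e / (2 ^ l.+1)%:R)%:E)%E); last first.
  exact: epsilon_trick0.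
apply: lee_nneseries => l _; first by move=> _; apply: integral_ge0 => x; exact: f0.
rewrite /f ge0_integralZl_EFin ?exprn_ge0 ?powR_ge0//.
- by move=> x Dx; exact: (energy_integrand_ge0 iota tau p sigma_ge0).
- by apply: (measurable_energy p mD msigma miota mtau) => i; exact: mb.
Qed.

End translation_dynamics.

(** * A universal function for translations *)

Section universal_function.
Context d (T : measurableType d) {R : realType}.
Variables (mu : {measure set T -> \bar R}) (D : set T) (sigma : T -> R).
Variables (iota : T -> nat) (tau : T -> R) (p : R).
Hypotheses (mD : measurable D) (msigma : measurable_fun D sigma)
  (sigma_ge0 : forall x, D x -> 0 <= sigma x)
  (miota : forall n, measurable (D `&` [set x | iota x = n]))
  (mtau : measurable_fun D tau) (p_gt0 : 0 < p)
  (sigma_fin : forall n,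
     (\int[mu]_(x in D `&` [set x | iota x = n]) (sigma x)%:E < +oo)%E).
Implicit Types (k : nat -> R -> R[i]) (r : R).
Local Notation energy := (energy mu D sigma iota tau p).

Lemma injective_unbounded (f : nat -> nat) : injective f ->
  forall M, exists m, (M <= f m)%N.
Proof.
move=> finj M; apply: contrapT => H.
have fM m : (f m < M)%N by rewrite ltnNge; apply/negP => ?; apply: H; exists m.
have /leq_card : injective (fun i : 'I_M.+1 => Ordinal (fM i)).
  by move=> i j [] /finj; exact: val_inj.
by rewrite !card_ord ltnn.
Qed.

Lemma cmeasurable_shift k t : (forall i, cmeasurable setT (k i)) ->
  forall i, cmeasurable setT (fun r => k i (r + t)).
Proof.
move=> mk i; have [m1 m2] := mk i.
have mt : measurable_fun setT (fun r : R => r + t) by exact: measurable_funD.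
split; first exact: (measurableT_comp m1 mt).
exact: (measurableT_comp m2 mt).
Qed.

Lemma cmeasurable_sum N (g : nat -> R -> R[i]) :
  (forall j, cmeasurable setT (g j)) ->
  cmeasurable setT (fun r => \sum_(j < N) g j r).
Proof.
move=> mg; elim: N => [|N IH].
  by under eq_fun do rewrite big_ord0; exact: cmeasurable_cst.
by under eq_fun do rewrite big_ord_recr /=; exact: cmeasurableD.
Qed.

(* [k] sums translates of all codes, each repeated infinitely often, so that some
   repetition [j] makes the other summands as small as desired after moving
   summand [j] back to the origin. *)
Lemma universal_function : exists k, [/\ forall i, cmeasurable setT (k i),
  (energy k < +oo)%E &
  forall (c : step_code) (e : R), 0 < e -> exists2 t : R, 0 <= t &
    (energy (fun i r => k i (r + t)%R - step_fun c i r)%R <= e%:E)%E].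
Proof.
(* Decoding a pair and dropping its second entry lists each code for infinitely many [j]; numbers
   that decode to nothing give the zero function. *)
pose q j : step_code :=
  if (unpickle j : option (step_code * nat)) is Some cm then cm.1 else [::].
have /choice[nab nabP] : forall j, exists nab : nat * R * R,
    tame (step_fun (q j)) nab.1.1 nab.1.2 nab.2.
  by move=> j; have [n [A [B H]]] := @step_fun_tame R (q j); exists (n, A, B).
pose A j := (nab j).1.2.
have A0 j : 0 <= A j by have [[]] := nabP j.
pose c0 : R := 2 `^ p.
have c01 : 1 <= c0.
  by have := @ler_powR R 2 (ler1n R 2) 0 p (ltW p_gt0); rewrite powRr0.
have c0_gt0 : 0 < c0 by exact: lt_le_trans c01.
(* [c0] absorbs the factors of the quasi-triangle inequality. In [4 = 2 * 2], one factor pays for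
   the summation over [l], the other makes the sum small in [m]. *)
pose eps m : R := (c0 * 4)^-1 ^+ m.+1.
have eps0 m : 0 < eps m by rewrite exprn_gt0// invr_gt0 mulr_gt0.
have /choice[L LP] : forall lm : nat * nat, exists L : R, 0 <= L /\
    forall t, L <= `|t| ->
    (energy (fun i r => step_fun (q lm.1) i (r + t)%R) <= (eps lm.2)%:E)%E.
  move=> [l m]; have [L L0 LH] := tame_shift_small mD msigma sigma_ge0 miota
    mtau p_gt0 sigma_fin (nabP l) (eps0 m).
  by exists L.
(* The gap in front of summand [j]: the 1 drives the times [t j] to infinity, [A j] keeps the
   support of summand [j] beyond [j], and [L (i, j)] guarantees that summand [i], displaced by this
   gap, has energy at most [eps j]. *)
pose w j := 1 + A j + \sum_(i < j.+1) L (nat_of_ord i, j).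
have L0 lm : 0 <= L lm by have [] := LP lm.
have wL i j : (i <= j)%N -> L (i, j) <= w j.
  move=> ij; have ij1 : (i < j.+1)%N by [].
  rewrite /w (bigD1 (Ordinal ij1))//= addrCA lerDl addr_ge0// ?addr_ge0//.
  by apply: sumr_ge0.
have wA j : 1 + A j <= w j by rewrite lerDl sumr_ge0.
have w1 j : 1 <= w j by rewrite (le_trans _ (wA j))// lerDl.
have w0 j : 0 <= w j by exact: le_trans (w1 j).
pose t j := \sum_(i < j.+1) w i.
have tw j : w j <= t j by rewrite /t big_ord_recr /= lerDr sumr_ge0.
have tjump i j : (i < j)%N -> w j <= t j - t i.
  move=> ij; rewrite /t [X in _ <= X - _]big_ord_recr /= addrAC lerDr subr_ge0.
  rewrite -(big_mkord xpredT w) -(big_mkord xpredT w).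
  rewrite [leRHS](@big_cat_nat _ _ _ i.+1)//= lerDl.
  exact: sumr_ge0.
have tjA j : j%:R + A j <= t j.
  rewrite /t big_ord_recr /=; apply: lerD; last first.
    by rewrite (le_trans _ (wA j))// lerDr.
  rewrite -[j in j%:R]card_ord -sumr_const ler_sum//.
have vanish j i r : r <= j%:R -> step_fun (q j) i (r - t j) = 0.
  move=> rj; have [_ _ + _] := nabP j; apply; right.
  rewrite distrC (le_trans _ (ler_norm _))// lerBrDr.
  by rewrite (le_trans _ (tjA j))// addrC lerD2r.
(* Summand [j] vanishes for [r <= j], so the cut-off loses nothing and this is the full series. *)
pose k i r := \sum_(j < (Num.truncn `|r|).+1) step_fun (q j) i (r - t j).
have sum_stable i r N M : r <= N%:R -> (N <= M)%N ->
    \sum_(j < M) step_fun (q j) i (r - t j) =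
    \sum_(j < N) step_fun (q j) i (r - t j).
  move=> rN NM.
  rewrite -(big_mkord xpredT (fun j => step_fun (q j) i (r - t j))).
  rewrite -(big_mkord xpredT (fun j => step_fun (q j) i (r - t j))).
  rewrite (@big_cat_nat _ _ _ N)//= [X in _ + X](_ : _ = 0) ?addr0//.
  rewrite big_nat_cond big1// => j /andP[/andP[Nj _] _]; apply: vanish.
  by rewrite (le_trans rN)// ler_nat.
have kE i r N : r <= N%:R ->
    k i r = \sum_(j < N) step_fun (q j) i (r - t j).
  move=> rN; rewrite /k; set M := (_).+1.
  have rM : r <= M%:R by rewrite (le_trans (ler_norm _))// ltW// truncnS_gt.
  rewrite -(sum_stable i r M (maxn M N) rM (leq_maxl _ _)).
  by rewrite -(sum_stable i r N (maxn M N) rN (leq_maxr _ _)).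
have mstep j i : cmeasurable setT (step_fun (q j) i : R -> R[i]).
  by have [_ _ _ H] := nabP j; exact: H.
have mk i : cmeasurable setT (k i).
  have mS N : cmeasurable setT
      (fun r => \sum_(j < N) step_fun (q j) i (r - t j)).
    apply: (cmeasurable_sum N (g := fun j r => step_fun (q j) i (r - t j))) => j.
    exact: (cmeasurable_shift (- t j) (mstep j)).
  have near_k r : \forall N \near \oo,
      k i r = \sum_(j < N) step_fun (q j) i (r - t j).
    exists (Num.truncn `|r|).+1 => // N /= rN; apply: kE.
    rewrite (le_trans (ler_norm _))// (le_trans (ltW (truncnS_gt _)))//.
    by rewrite ler_nat.
  split.
  - apply: (measurable_fun_cvg (h := fun N r =>
      complex.Re (\sum_(j < N) step_fun (q j) i (r - t j)))).
      by move=> N; case: (mS N).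
    by move=> r _; apply: cvg_near_cst; near do apply/congr1/esym.
  - apply: (measurable_fun_cvg (h := fun N r =>
      complex.Im (\sum_(j < N) step_fun (q j) i (r - t j)))).
      by move=> N; case: (mS N).
    by move=> r _; apply: cvg_near_cst; near do apply/congr1/esym.
have bound l m (x : R) : (l <= m)%N -> L (l, m) <= `|x| ->
    ((c0 ^+ l.+1)%:E * energy (fun i r => step_fun (q l) i (r + x)%R) <=
     ((2^-1 ^+ m.+1) / (2 ^ l.+1)%:R)%:E)%E.
  move=> lm Lx; have [_ /(_ x Lx) /= H] := LP (l, m).
  apply: (@le_trans _ _ ((c0 ^+ l.+1)%:E * (eps m)%:E)%E).
    by apply: lee_wpmul2l => //; rewrite lee_fin exprn_ge0// ltW.
  rewrite -EFinM lee_fin.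
  apply: (@le_trans _ _ (c0 ^+ m.+1 * eps m)).
    by rewrite ler_wpM2r ?(ltW (eps0 _))// ler_weXn2l.
  rewrite /eps -exprMn invfM mulrA divff ?gt_eqF// mul1r.
  rewrite (_ : 4^-1 = 2^-1 * 2^-1 :> R); last by rewrite -invfM -natrM.
  rewrite exprMn ler_wpM2l ?exprn_ge0// ?invr_ge0//.
  rewrite natrX -exprVn; apply: ler_wiXn2l => //; rewrite ?invr_ge0//.
  by rewrite invf_le1// ler1n.
exists k; split => //.
- apply: (@le_lt_trans _ _ (1%:E)%E); last by rewrite ltry.
  apply: (energy_series mD msigma sigma_ge0 miota mtau p_gt0
    (b := fun l i r => step_fun (q l) i (r - t l))) => //.
  + by move=> l i; exact: (cmeasurable_shift (- t l) (mstep l)).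
  + move=> i r; exists (Num.truncn `|r|).+1; apply: kE.
    by rewrite (le_trans (ler_norm _))// ltW// truncnS_gt.
  + move=> l; apply: (le_trans (bound l l (- t l) (leqnn l) _)).
      by rewrite normrN (le_trans (wL l l _))// (le_trans (tw l))// ler_norm.
    rewrite lee_fin ler_wpM2r ?invr_ge0// exprn_ile1// ?invr_ge0//.
    by rewrite invf_le1// ler1n.
- move=> c e e0.
  have [M Me] : exists M, (2^-1 : R) ^+ M.+1 <= e.
    have half1 : `|2^-1 : R| < 1.
      by rewrite gtr0_norm ?invr_gt0// invf_lt1// ltr1n.
    have /cvgrPdist_lt/(_ e e0)[] := cvg_geometric 1 half1.
    move=> M _ /(_ M.+1 (leqW (leqnn _))) /=.
    rewrite sub0r normrN /geometric /= mul1r => H; exists M.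
    by rewrite (le_trans (ler_norm _))// ltW.
  (* Among the infinitely many repetitions of [c], one has a number [j >= M], which makes
     [2 ^- (j + 1)] at most [e]. *)
  have [m Mm] : exists m : nat, (M <= pickle (c, m))%N.
    apply: (@injective_unbounded (fun m => pickle (c, m))) => m m'.
    by move=> /(pcan_inj (@pickleK _)) [].
  pose j := pickle (c, m).
  have qj : q j = c by rewrite /q /j pickleK.
  exists (t j); first by rewrite (le_trans _ (tw j)).
  apply: (@le_trans _ _ (2^-1 ^+ j.+1)%:E); last first.
    rewrite lee_fin (le_trans _ Me)// ler_wiXn2l ?invr_ge0//.
    by rewrite invf_le1// ler1n.
  apply: (energy_series mD msigma sigma_ge0 miota mtau p_gt0
    (b := fun l i r => if l == j then 0 else step_fun (q l) i (r + (t j - t l)))).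
  + by rewrite exprn_ge0// invr_ge0.
  + move=> l i; case: (l == j); first exact: cmeasurable_cst.
    exact: (cmeasurable_shift _ (mstep l)).
  + move=> i r; exists (maxn j.+1 (Num.truncn `|r + t j|).+1).
    set N := maxn _ _.
    have jN : (j < N)%N by rewrite leq_max leqnn.
    rewrite (kE i _ N); last first.
      rewrite (le_trans (ler_norm _))// (le_trans (ltW (truncnS_gt _)))//.
      by rewrite ler_nat leq_maxr.
    rewrite (bigD1 (Ordinal jN))//= addrK qj addrAC subrr add0r.
    rewrite [RHS](bigD1 (Ordinal jN))//= eqxx add0r.
    apply: eq_bigr => l lj; rewrite -addrA ifF//.
    by apply: contraNF lj => /eqP lj; apply/eqP/val_inj.
  + move=> l; have [->|lj] := eqVneq l j.
      rewrite [energy _](_ : _ = 0%E) ?mule0.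
        by rewrite lee_fin divr_ge0// exprn_ge0// invr_ge0.
      by apply: integral0_eq => x _; rewrite cabs0 powR0 ?gt_eqF// mul0r.
    (* Earlier summands have been moved past the origin by at least [w j >= L (l, j)]; later ones
       are still at distance [w l >= L (l, l)], and [eps l <= eps j] for them. *)
    have [lltj|jltl|ljeq] := ltngtP l j; last by rewrite ljeq eqxx in lj.
      apply: bound; first exact: ltnW.
      by rewrite (le_trans (wL l j (ltnW lltj)))// (le_trans (tjump _ _ lltj))// ler_norm.
    apply: (le_trans (bound l l (t j - t l) (leqnn l) _)).
      rewrite distrC (le_trans (wL l l _))// (le_trans (tjump _ _ jltl))//.
      exact: ler_norm.
    rewrite lee_fin ler_wpM2r ?invr_ge0// ler_wiXn2l ?invr_ge0//.
      by rewrite invf_le1// ler1n.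
    by rewrite ltnS ltnW.
Unshelve. all: by end_near. Qed.

End universal_function.

(** * Density of step functions *)

Lemma cvg_powR0 {R : realType} (v : nat -> R) (p : R) : 0 < p ->
  (forall n, 0 <= v n) -> v n @[n --> \oo] --> 0 ->
  v n `^ p @[n --> \oo] --> 0.
Proof.
move=> p0 v0 v_cvg; apply/cvgrPdist_lt => e e0.
have d0 : 0 < e `^ p^-1 by rewrite powR_gt0.
have /cvgrPdist_lt/(_ _ d0) := v_cvg; apply: filterS => n.
rewrite !sub0r !normrN !ger0_norm ?powR_ge0// => vn.
have := gt0_ltr_powR p0 (v0 n) (ltW d0) vn.
by rewrite -powRrM mulVf ?gt_eqF// powRr1// ltW.
Qed.

(** * Reduction of density in weighted [L^p] to indicators *)

Section weighted_density.
Context d (T : measurableType d) {R : realType}.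
Variables (mu : {measure set T -> \bar R}) (D : set T) (sigma : T -> R) (p : R).
Hypotheses (mD : measurable D) (msigma : measurable_fun D sigma)
  (sigma_ge0 : forall x, D x -> 0 <= sigma x) (p_gt0 : 0 < p).
Implicit Types (f g : T -> R[i]) (u : T -> R) (c : R[i]).

Definition wnorm f : \bar R :=
  (\int[mu]_(x in D) (cabs (f x) `^ p * sigma x)%:E)%E.

Lemma wnorm_integrand_ge0 f x : D x -> (0 <= (cabs (f x) `^ p * sigma x)%:E)%E.
Proof. by move=> Dx; rewrite lee_fin mulr_ge0 ?powR_ge0// sigma_ge0. Qed.

Lemma le_wnorm f g : (forall x, D x -> cabs (f x) <= cabs (g x)) ->
  (wnorm f <= wnorm g)%E.
Proof.
move=> fg; apply: ge0_le_integral_any => // x Dx.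
- exact: wnorm_integrand_ge0.
- exact: wnorm_integrand_ge0.
- rewrite lee_fin ler_wpM2r ?sigma_ge0//.
  by apply: (ge0_ler_powR (ltW p_gt0)); rewrite ?nnegrE ?cabs_ge0// fg.
Qed.

Lemma eq_wnorm f g : (forall x, D x -> f x = g x) -> wnorm f = wnorm g.
Proof. by move=> fg; apply: eq_integral => x /set_mem Dx; rewrite fg. Qed.

Lemma measurable_wnorm f : cmeasurable D f ->
  measurable_fun D (fun x => (cabs (f x) `^ p * sigma x)%:E).
Proof.
move=> mf; apply/measurable_EFinP; apply: measurable_funM => //.
exact: measurable_powR_cabs.
Qed.

Lemma wnormD f g : cmeasurable D f -> cmeasurable D g ->
  (wnorm (fun x => f x + g x)%R <= (2 `^ p)%:E * (wnorm f + wnorm g))%E.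
Proof.
move=> mf mg; rewrite /wnorm -ge0_integralD//; first last.
- exact: measurable_wnorm.
- by move=> x; exact: wnorm_integrand_ge0.
- exact: measurable_wnorm.
- by move=> x; exact: wnorm_integrand_ge0.
rewrite -ge0_integralZl_EFin ?powR_ge0//; last 2 first.
- move=> x Dx.
  exact: (@adde_ge0 R _ _ (wnorm_integrand_ge0 f Dx) (wnorm_integrand_ge0 g Dx)).
- by apply: emeasurable_funD; exact: measurable_wnorm.
apply: ge0_le_integral_any => // x Dx.
- exact: (wnorm_integrand_ge0 (fun x => f x + g x)).
- rewrite mule_ge0// ?lee_fin ?powR_ge0//.
  exact: (@adde_ge0 R _ _ (wnorm_integrand_ge0 f Dx) (wnorm_integrand_ge0 g Dx)).
- rewrite -EFinD -EFinM lee_fin -mulrDl mulrA ler_wpM2r ?sigma_ge0//.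
  exact: powR_cabsD (ltW p_gt0).
Qed.

Lemma wnormD_small (e : R) : 0 < e -> exists2 e' : R, 0 < e' &
  forall f g, cmeasurable D f -> cmeasurable D g ->
  (wnorm f < e'%:E)%E -> (wnorm g < e'%:E)%E ->
  (wnorm (fun x => f x + g x)%R < e%:E)%E.
Proof.
move=> e0; have p20 : 0 < 2 `^ p :> R by rewrite powR_gt0.
exists (e / 2 / 2 `^ p); first by rewrite !divr_gt0.
move=> f g mf mg fe ge; apply: (le_lt_trans (wnormD mf mg)).
have -> : e%:E = ((2 `^ p)%:E * ((e / 2 / 2 `^ p)%:E + (e / 2 / 2 `^ p)%:E))%E.
  rewrite -EFinD -EFinM; congr EFin.
  by rewrite -mulrDl -splitr mulrCA divff ?mulr1// gt_eqF.
have p2 : (0 < (2 `^ p)%:E :> \bar R)%E by rewrite lte_fin.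
have mono := lte_pmul2l (isT : (2 `^ p)%:E \is a fin_num) p2.
by rewrite mono; exact: (lteD fe ge).
Qed.

Variable G : (T -> R[i]) -> Prop.
Hypotheses
  (G_measurable : forall g, G g -> cmeasurable D g)
  (G_add : forall g1 g2, G g1 -> G g2 -> G (fun x => g1 x + g2 x))
  (G_indic : forall (A : set T) c (e : R), measurable A -> A `<=` D ->
     (\int[mu]_(x in A) (sigma x)%:E < +oo)%E -> 0 < e ->
     exists2 g, G g & (wnorm (fun x => c * (\1_A x : R)%:C - g x)%R < e%:E)%E).

Let approx f := cmeasurable D f /\
  forall e : R, 0 < e -> exists2 g, G g & (wnorm (fun x => f x - g x)%R < e%:E)%E.

Let approx_eq f g : (forall x, D x -> f x = g x) -> approx f -> approx g.
Proof.
move=> fg [[mf1 mf2] af]; split.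
  split; [apply: eq_measurable_fun mf1|apply: eq_measurable_fun mf2] => x /set_mem Dx;
    by rewrite fg.
move=> e /af[k Gk ke]; exists k; first exact: Gk.
have <- : wnorm (fun x => f x - k x) = wnorm (fun x => g x - k x).
  by apply: eq_wnorm => x Dx; rewrite fg.
exact: ke.
Qed.

Let approx_add f g : approx f -> approx g -> approx (fun x => f x + g x).
Proof.
move=> [mf af] [mg ag]; split; first exact: cmeasurableD.
move=> e /wnormD_small[e' e'0 He'].
have [k Gk fk] := af _ e'0; have [l Gl gl] := ag _ e'0.
exists (fun x => k x + l x); first exact: G_add.
have mk := G_measurable Gk; have ml := G_measurable Gl.
have := He' _ _ (cmeasurableB mf mk) (cmeasurableB mg ml) fk gl.
by under eq_wnorm do rewrite addrACA -opprD.
Qed.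

Let approx_lim f : cmeasurable D f ->
  (forall e : R, 0 < e -> exists2 g, approx g &
    (wnorm (fun x => f x - g x)%R < e%:E)%E) -> approx f.
Proof.
move=> mf H; split => // e /wnormD_small[e' e'0 He'].
have [k [mk ak] fk] := H _ e'0; have [l Gl kl] := ak _ e'0.
exists l => //; have ml := G_measurable Gl.
have := He' _ _ (cmeasurableB mf mk) (cmeasurableB mk ml) fk kl.
by under eq_wnorm do rewrite addrA subrK.
Qed.

Let approx_indic (A : set T) c : measurable A -> A `<=` D ->
  (\int[mu]_(x in A) (sigma x)%:E < +oo)%E ->
  approx (fun x => c * (\1_A x : R)%:C).
Proof.
move=> mA AD Aoo; split; last by move=> e; exact: G_indic.
apply: cmeasurableM; first exact: cmeasurable_cst.
by apply: cmeasurable_real; exact: measurable_indic.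
Qed.

Let approx_sum (I : Type) (s : seq I) (f : I -> T -> R[i]) :
  (forall i, approx (f i)) -> approx (fun x => \sum_(i <- s) f i x).
Proof.
move=> af; elim: s => [|i s IH].
  apply: (@approx_eq (fun x => 0 * (\1_(@set0 T) x : R)%:C)).
    by move=> x _; rewrite mul0r big_nil.
  by apply: approx_indic => //; rewrite integral_set0.
apply: (@approx_eq (fun x => f i x + \sum_(i <- s) f i x)).
  by move=> x _; rewrite big_cons.
exact: (approx_add (af i) IH).
Qed.

Import HBNNSimple.

Let approx_nnsfun (k : {nnsfun T >-> R}) u c :
  (forall x, D x -> k x <= u x) ->
  (\int[mu]_(x in D) (u x `^ p * sigma x)%:E < +oo)%E ->
  approx (fun x => c * (k x)%:C).
Proof.
move=> ku uoo.
pose A y := D `&` k @^-1` [set y].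
have mA y : measurable (A y) by exact: measurableI.
(* The level set of 0 may have infinite mass, but it contributes nothing, so the empty set replaces
   it. *)
pose S x := \sum_(y <- finmap.enum_fset (fset_set (range k)))
    (c * y%:C) * (\1_(if 0 < y then A y else set0) x : R)%:C.
suff aS : approx S.
  apply: approx_eq aS => x Dx; rewrite /S [in RHS]fimfunE fsbig_finite//= rmorph_sum mulr_sumr.
  apply: eq_bigr => y _; rewrite rmorphM mulrA.
  have [y0|] := ltP 0 y.
    congr (_ * _%:C); rewrite !indicE /A in_setI; congr (_%:R).
    by rewrite (mem_set Dx).
  have [ky|ky] := boolP (x \in k @^-1` [set y]).
    move: ky; rewrite inE /= => <- k0.
    by rewrite (le_anti (_ : k x <= 0 <= k x)) ?mulr0 ?mul0r// k0/=.
  by move=> _; rewrite !indicE (negbTE ky) in_set0 mulr0.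
apply: approx_sum => y; case: ltP => y0; last first.
  by apply: approx_indic => //; rewrite integral_set0.
have AD : A y `<=` D by move=> x [].
apply: approx_indic => //.
have yp : 0 < y `^ p by rewrite powR_gt0.
(* Chebyshev: on [A y] the integrand of [uoo] is at least the p-th power of [y] times [sigma], so a
   level [y > 0] has finite mass. *)
have : ((y `^ p)%:E * \int[mu]_(x in A y) (sigma x)%:E < +oo)%E.
  have s0 x : A y x -> (0 <= (sigma x)%:E)%E.
    by move=> /AD Dx; rewrite lee_fin sigma_ge0.
  have ms : measurable_fun (A y) (EFin \o sigma).
    by apply/measurable_EFinP; exact: measurable_funS AD _.
  rewrite -(ge0_integralZl_EFin mu (mA y) s0 ms (powR_ge0 _ _)).
  apply: le_lt_trans uoo; apply: ge0_le_integral_any => // x.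
  - by move=> /AD Dx; rewrite -EFinM lee_fin mulr_ge0 ?powR_ge0// sigma_ge0.
  - by move=> Dx; rewrite lee_fin mulr_ge0 ?powR_ge0// sigma_ge0.
  - move=> [Dx /= kx] _; rewrite -EFinM lee_fin ler_wpM2r ?sigma_ge0//.
    apply: (ge0_ler_powR (ltW p_gt0)); rewrite ?nnegrE ?(ltW y0)//.
      by rewrite (le_trans _ (ku _ Dx)).
    by rewrite -kx ku.
  - by move=> /AD Dx /(_ Dx).
rewrite ltNge leye_eq => /negP H; rewrite ltNge leye_eq; apply/negP => /eqP Hy.
by apply: H; rewrite Hy gt0_muley// lte_fin.
Qed.

Let approx_nonneg u c : measurable_fun D u -> (forall x, D x -> 0 <= u x) ->
  (\int[mu]_(x in D) (u x `^ p * sigma x)%:E < +oo)%E ->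
  approx (fun x => c * (u x)%:C).
Proof.
move=> mfu u0 uoo.
have mEu : measurable_fun D (EFin \o u) by exact/measurable_EFinP.
have u0E x : D x -> (0 <= (EFin \o u) x)%E by move=> Dx; rewrite lee_fin u0.
pose k := nnsfun_approx mD mEu.
have ku n x : D x -> k n x <= u x.
  by move=> Dx; have := le_approx n u0E Dx; rewrite -nnsfun_approxE lee_fin.
apply: approx_lim.
  by apply: cmeasurableM; [exact: cmeasurable_cst|exact: cmeasurable_real].
move=> e e0.
have mku n : cmeasurable D (fun x => c * (u x)%:C - c * (k n x)%:C).
  by apply: cmeasurableB; apply: cmeasurableM; try exact: cmeasurable_cst;
    apply: cmeasurable_real => //; exact: measurable_funTS.
pose w n x := (cabs (c * (u x)%:C - c * (k n x)%:C)%R `^ p * sigma x)%:E.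
have wE n x : D x -> w n x = ((cabs c * (u x - k n x)) `^ p * sigma x)%:E.
  move=> Dx; rewrite /w -mulrBr -rmorphB cabsM cabs_real ger0_norm//.
  by rewrite subr_ge0 ku.
have mcu : cmeasurable D (fun x => c * (u x)%:C).
  by apply: cmeasurableM; [exact: cmeasurable_cst|exact: cmeasurable_real].
(* The dominating function, since [0 <= u - k n <= u] on [D]. *)
have ig : mu.-integrable D (fun x => (cabs (c * (u x)%:C) `^ p * sigma x)%:E).
  apply/integrableP; split; first exact: measurable_wnorm.
  under eq_integral => x /set_mem Dx.
    rewrite gee0_abs; last exact: (wnorm_integrand_ge0 (fun x => c * (u x)%:C)).
    rewrite cabsM cabs_real ger0_norm ?u0// powRM ?cabs_ge0 ?u0// -mulrA EFinM.
    over.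
  rewrite ge0_integralZl_EFin ?powR_ge0//.
  - by rewrite lte_mul_pinfty// ?lee_fin ?powR_ge0.
  - by move=> x Dx; rewrite lee_fin mulr_ge0 ?powR_ge0// sigma_ge0.
  - apply/measurable_EFinP; apply: measurable_funM => //.
    exact: (measurableT_comp (measurable_powR p)).
have [] := @dominated_convergence _ _ _ mu D mD w (cst 0%E) _ _ _ _ ig.
- by move=> n; exact: (measurable_wnorm (mku n)).
- exact: measurable_cst.
- apply: aeW => x Dx.
  have /fine_cvgP[_ kx] := cvg_nnsfun_approx mD mEu u0E Dx.
  have : (cabs c * (u x - k n x)) `^ p * sigma x @[n --> \oo] --> 0 * sigma x.
    apply: cvgM; last exact: cvg_cst.
    apply: cvg_powR0 => //.
      by move=> n; rewrite mulr_ge0 ?cabs_ge0// subr_ge0 ku.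
    rewrite -(mulr0 (cabs c)) -(subrr (u x)).
    apply: cvgM; first exact: cvg_cst.
    by apply: cvgB; [exact: cvg_cst|exact: kx].
  rewrite mul0r => H; under eq_fun do rewrite wE//.
  by apply: cvg_EFin; [near=> n|exact: H].
- apply: aeW => x n Dx; rewrite gee0_abs; last first.
    exact: (wnorm_integrand_ge0 (fun x => c * (u x)%:C - c * (k n x)%:C)).
  rewrite wE// cabsM cabs_real ger0_norm ?u0// lee_fin ler_wpM2r ?sigma_ge0//.
  apply: (ge0_ler_powR (ltW p_gt0)); rewrite ?nnegrE ?mulr_ge0 ?cabs_ge0 ?subr_ge0 ?ku ?u0//.
  by rewrite ler_wpM2l ?cabs_ge0// gerBl.
move=> _ _; rewrite integral0 => H.
have [n _ /(_ n (leqnn n)) /= He] := H _ (open_nbhs_nbhs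
  (conj (@open_ereal_lt_ereal R e%:E) (e0 : [set y | (y < e%:E)%E] 0%E))).
exists (fun x => c * (k n x)%:C); last exact: He.
by apply: approx_nnsfun uoo => x; exact: ku.
Unshelve. all: by end_near. Qed.

Lemma weighted_approximation f (e : R) : cmeasurable D f ->
  (wnorm f < +oo)%E -> 0 < e ->
  exists2 g, G g & (wnorm (fun x => f x - g x)%R < e%:E)%E.
Proof.
move=> mf foo e0; have [mf1 mf2] := mf.
have part u c : measurable_fun D u -> (forall x, D x -> 0 <= u x <= cabs (f x)) ->
    approx (fun x => c * (u x)%:C).
  move=> mfu uf; have u0 x : D x -> 0 <= u x by move=> /uf /andP[].
  apply: (approx_nonneg c mfu u0).
  apply: le_lt_trans foo; apply: ge0_le_integral_any => // x Dx.
  - by rewrite lee_fin mulr_ge0 ?powR_ge0// sigma_ge0.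
  - exact: wnorm_integrand_ge0.
  - have /andP[ux0 ufx] := uf _ Dx.
    rewrite lee_fin ler_wpM2r ?sigma_ge0//.
    by apply: (ge0_ler_powR (ltW p_gt0)); rewrite ?nnegrE ?cabs_ge0.
pose pos (r : R) := Num.max r 0.
have posB (r : R) : r = pos r - pos (- r).
  rewrite /pos; have [r0|r0] := leP r 0.
    by rewrite max_l ?oppr_ge0// sub0r opprK.
  by rewrite max_r ?subr0// oppr_le0 ltW.
have pos_le (r s : R) : `|r| <= s -> 0 <= pos r <= s.
  move=> rs; rewrite /pos le_max lexx orbT ge_max (le_trans (ler_norm _) rs).
  by rewrite (le_trans _ rs).
suff [_ /(_ e e0)] : approx f by [].
apply: (@approx_eq (fun x => (1 * (pos (complex.Re (f x)))%:C +
    (- 1) * (pos (- complex.Re (f x)))%:C) +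
    ('i * (pos (complex.Im (f x)))%:C + (- 'i) * (pos (- complex.Im (f x)))%:C))).
  move=> x _; rewrite mul1r mulN1r mulNr -mulrBr -!rmorphB -!posB.
  by rewrite [RHS]complexE mulrC.
apply: approx_add; apply: approx_add; apply: part.
- exact: measurable_maxr.
- by move=> x _; apply: pos_le; exact: le_Re_cabs.
- by apply: measurable_maxr => //; exact: measurable_funN.
- by move=> x _; apply: pos_le; rewrite normrN; exact: le_Re_cabs.
- exact: measurable_maxr.
- by move=> x _; apply: pos_le; exact: le_Im_cabs.
- by apply: measurable_maxr => //; exact: measurable_funN.
- by move=> x _; apply: pos_le; rewrite normrN; exact: le_Im_cabs.
Qed.

End weighted_density.

Section integral_pieces.
Context d (T : measurableType d) {R : realType}.
Variables (mu : {measure set T -> \bar R}) (D : set T) (sigma : T -> R) (p : R).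
Hypotheses (mD : measurable D) (msigma : measurable_fun D sigma)
  (sigma_ge0 : forall x, D x -> 0 <= sigma x) (p_gt0 : 0 < p).

Lemma ge0_integral_setU_le (A B : set T) (f : T -> \bar R) :
  measurable A -> measurable B -> measurable_fun (A `|` B) f ->
  (forall x, (A `|` B) x -> (0 <= f x)%E) ->
  (\int[mu]_(x in A `|` B) f x <=
   \int[mu]_(x in A) f x + \int[mu]_(x in B) f x)%E.
Proof.
move=> mA mB mf f0.
have E : A `|` B = A `|` (B `\` A) by rewrite setUDr setDv setD0.
rewrite E ge0_integral_setU -?E//; last 2 first.
- exact: measurableD.
- by apply/disj_setPS => x [? []].
apply: leeD => //; apply: ge0_subset_integral_any; first by move=> x [].
by move=> x Bx; apply: f0; right.
Qed.

Lemma wnorm_piece_le (W : set T) (f : T -> R[i]) (b : R) : measurable W ->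
  W `<=` D -> 0 <= b -> (forall x, W x -> cabs (f x) `^ p <= b) ->
  (\int[mu]_(x in W) (cabs (f x) `^ p * sigma x)%:E <=
   b%:E * \int[mu]_(x in W) (sigma x)%:E)%E.
Proof.
move=> mW WD b0 fb.
have s0 x : W x -> (0 <= (sigma x)%:E)%E.
  by move=> /WD Dx; rewrite lee_fin sigma_ge0.
have ms : measurable_fun W (EFin \o sigma).
  by apply/measurable_EFinP; exact: measurable_funS WD _.
rewrite -(ge0_integralZl_EFin mu mW s0 ms b0).
apply: ge0_le_integral_any => // x Wx.
- by rewrite lee_fin mulr_ge0 ?powR_ge0// sigma_ge0//; exact: WD.
- by rewrite -EFinM lee_fin mulr_ge0// sigma_ge0//; exact: WD.
- by rewrite -EFinM lee_fin ler_wpM2r ?fb// sigma_ge0//; exact: WD.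
Qed.

End integral_pieces.

Lemma complex_rational_approx {R : realType} (c : R[i]) (e : R) : 0 < e ->
  exists a b : rat, cabs (c - (ratr a +i* ratr b)) < e.
Proof.
move=> e0; have e20 : 0 < e / 2 by rewrite divr_gt0.
have near_rat (x : R) : exists a : rat, `|x - ratr a| < e / 2.
  have [|a] := @rat_in_itvoo R (x - e / 2) (x + e / 2).
    by rewrite ltrBlDr -addrA -splitr ltrDl.
  by rewrite in_itv/= => xa; exists a; rewrite distrC ltr_distl.
have [a xa] := near_rat (complex.Re c); have [b xb] := near_rat (complex.Im c).
exists a, b; case: c xa xb => x y /= xa xb.
have -> : (x +i* y - (ratr a +i* ratr b)) =
    (x - ratr a)%:C + (0 +i* (y - ratr b)).
  by apply/eqP; rewrite eq_complex /= addr0 add0r !eqxx.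
rewrite (le_lt_trans (cabsD _ _))// [e]splitr ltrD// ?cabs_real//.
by rewrite cabsE /= expr0n add0r sqrtr_sqr.
Qed.

(** The budget of [step_indicator_approx]: three pieces of small mass at [e / 8] each, and the
    common piece at [e / 2]. *)
Lemma three_eighths_half_lt {R : realType} (e : R) : 0 < e ->
  e / 8 + (e / 8 + (e / 8 + e / 2)) < e.
Proof. by move=> e0; lra. Qed.

(** * Density of step functions of component and time *)

Section step_density.
Context {R : realType}.
Notation L := (lebesgue_type R).
Notation mu := (leb R).
Variables (D : set L) (sigma : L -> R) (iota : L -> nat) (tau : L -> R) (p : R).
Hypotheses (mD : measurable D) (msigma : measurable_fun D sigma)
  (sigma_ge0 : forall x, D x -> 0 <= sigma x)
  (miota : forall n, measurable (D `&` [set x | iota x = n]))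
  (mtau : measurable_fun D tau) (p_gt0 : 0 < p)
  (sigma_fin : forall n,
     (\int[mu]_(x in D `&` [set x | iota x = n]) (sigma x)%:E < +oo)%E).

(* The intervals [q1 < tau < q2] in the components form a base of the topology. *)
Hypothesis tau_base : forall (O : set R) (x : R), open O -> O x -> D x ->
  exists q1 q2 : rat, ratr q1 < tau x < ratr q2 /\
    forall y, D y -> iota y = iota x -> ratr q1 < tau y < ratr q2 -> O y.

Let D_ n := D `&` [set x | (iota x < n)%N].

Let mD_ n : measurable (D_ n). Proof. by apply: measurable_below. Qed.

Let in_code (l : seq basic_itv) : set L :=
  D `&` [set x | has (fun b => in_basic b (iota x) (tau x)) l].

Let measurable_in_code l : measurable (in_code l).
Proof.
elim: l => [|b l IH].
  by rewrite (_ : in_code _ = set0)//; apply/seteqP; split => x // [].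
have -> : in_code (b :: l) = in_code l `|` ((D `&` [set x | iota x = b.1.1]) `&`
    (D `&` tau @^-1` `]ratr b.1.2, ratr b.2[%classic)).
  apply/seteqP; split => x.
    move=> [Dx /=] /orP[|]; last by left.
    rewrite /in_basic => /andP[/eqP bx bt]; right.
    by split; split => //; rewrite /= in_itv.
  case=> [[Dx /= xl]|]; first by split => //=; rewrite xl orbT.
  move=> [[Dx /= xb] [_ /=]]; rewrite in_itv /= => xt; split => //=.
  by rewrite {1}/in_basic xb eqxx xt.
apply: measurableU => //; apply: measurableI => //.
by apply: mtau => //; exact: measurable_itv.
Qed.

(** Extended by 0 outside [D_ n], [sigma] is integrable on the line, and its integral is absolutely
    continuous. *)
Let abs_continuity n (e : R) : 0 < e -> exists2 dl : R, 0 < dl &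
  forall B : set L, measurable B -> B `<=` D_ n -> (mu B < dl%:E)%E ->
  (\int[mu]_(x in B) (sigma x)%:E < e%:E)%E.
Proof.
move=> e0; have DnD : D_ n `<=` D by move=> x [].
have ig : mu.-integrable setT (EFin \o (sigma \_ (D_ n))).
  rewrite -restrict_EFin; apply/integrable_restrict => //; rewrite setTI.
  apply/integrableP; split.
    by apply/measurable_EFinP; exact: measurable_funS DnD _.
  apply: le_lt_trans (mass_below mD msigma sigma_ge0 miota sigma_fin n).
  apply: ge0_le_integral_any => // x [Dx xn].
  - by rewrite lee_fin sigma_ge0.
  - by move=> _; rewrite gee0_abs// lee_fin sigma_ge0.
have [dl [dl0 H]] := integral_normr_continuous ig e0.
exists dl => // B mB BD Bd; have := H B mB Bd.
have E : (\int[mu]_(x in B) (sigma x)%:E =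
    \int[mu]_(x in B) (`|(sigma \_ (D_ n)) x|)%:E)%E.
  apply: eq_integral => x /set_mem Bx.
  by rewrite patchE mem_set ?ger0_norm ?sigma_ge0//; [exact/DnD/BD|exact: BD].
have fin : (\int[mu]_(x in B) (sigma x)%:E \is a fin_num)%E.
  rewrite ge0_fin_numE.
    apply: le_lt_trans (mass_below mD msigma sigma_ge0 miota sigma_fin n).
    apply: ge0_subset_integral_any => // x [Dx _].
    by rewrite lee_fin sigma_ge0.
  by apply: integral_ge0 => x /BD/DnD Dx; rewrite lee_fin sigma_ge0.
by rewrite /Rintegral -E -lte_fin fineK.
Qed.

(** By [tau_base], [O] is on [D_ n] the union of the rational boxes inside it; [l K] keeps those
    among the first [K] codes, and finite mass lets some [K] suffice. *)
Let open_approx (O : set R) n (e : R) : open O -> 0 < e ->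
  exists2 l, in_code l `<=` (O : set L) `&` D_ n &
    (\int[mu]_(x in ((O : set L) `&` D_ n) `\` in_code l) (sigma x)%:E < e%:E)%E.
Proof.
move=> oO e0.
pose good (b : basic_itv) : bool :=
  `[< (b.1.1 < n)%N /\ forall y, D y -> in_basic b (iota y) (tau y) -> O y >].
pose l K := [seq b <- pmap (fun k => unpickle k : option basic_itv) (seq.iota 0 K) | good b].
have lsub K : in_code (l K) `<=` (O : set L) `&` D_ n.
  move=> x [Dx /= /hasP[b]]; rewrite mem_filter => /andP[/asboolP[bn bO] _] xb.
  split; first exact: bO xb.
  by split => //=; move: xb => /andP[/eqP <-].
have mO : measurable (O : set L) by apply: borel_leb; exact: open_measurable.
have OD : (O : set L) `&` D_ n `<=` D by move=> x [_ []].
have [||||||K HK] := @integral_exhaustion _ L R mu ((O : set L) `&` D_ n)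
  (fun K => in_code (l K)) (EFin \o sigma) _ _ _ _ _ _ e e0.
- by apply/measurable_EFinP; exact: measurable_funS OD _.
- by move=> x /OD Dx; rewrite lee_fin sigma_ge0.
- apply: le_lt_trans (mass_below mD msigma sigma_ge0 miota sigma_fin n).
  apply: ge0_subset_integral_any; first by move=> x [].
  by move=> x [Dx _]; rewrite lee_fin sigma_ge0.
- apply/nondecreasing_seqP => K; rewrite subsetEset => x [Dx /= xl].
  split => //=; move: xl => /hasP[b bl xb]; apply/hasP; exists b => //.
  move: bl; rewrite !mem_filter => /andP[-> bl]; rewrite andTb; move: bl.
  by rewrite -(addn1 K) iotaD pmap_cat mem_cat => ->.
- by move=> K; exact: measurable_in_code.
- apply/seteqP; split => [x [K _]|x [Ox [Dx /= xn]]]; first exact: lsub.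
  have [q1 [q2 [xq H]]] := tau_base oO Ox Dx.
  pose b : basic_itv := (iota x, q1, q2).
  exists (pickle b).+1 => //; split => //=.
  apply/hasP; exists b; last by rewrite /in_basic/= eqxx.
  rewrite mem_filter; apply/andP; split.
    apply/asboolP; split => // y Dy; rewrite /in_basic /= => /andP[/eqP yx yq].
    exact: H.
  rewrite mem_pmap; apply/mapP; exists (pickle b); last by rewrite pickleK.
  by rewrite mem_iota /= add0n.
by exists (l K).
Qed.

(** Approximation in stages: [A] by a bounded part [A_ m], this by an open set [O] from outside, [O]
    by boxes from inside, and [c] by a number with rational parts. *)
Lemma step_indicator_approx (A : set L) (c : R[i]) (e : R) :
  measurable A -> A `<=` D -> (\int[mu]_(x in A) (sigma x)%:E < +oo)%E ->
  0 < e -> exists s : step_code,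
    (wnorm mu D sigma p (fun x => c * (\1_A x : R)%:C -
       step_fun s (iota x) (tau x))%R < e%:E)%E.
Proof.
move=> mA AD Aoo e0.
have e_sum := three_eighths_half_lt e0.
pose M := (cabs c + 1) `^ p.
have M0 : 0 < M by rewrite powR_gt0// ltr_wpDl// cabs_ge0.
(* [M] bounds the p-th power of the error everywhere, its [+ 1] leaving room for the rational
   substitute of [c]; so a set of mass below [eta] costs at most [e / 8]. *)
pose eta := e / (M * 8).
have eta0 : 0 < eta by rewrite divr_gt0// mulr_gt0.
(* The bounded interval makes the Lebesgue measure of [A_ m] finite, which turns the bound on the
   measure of [O] into one on [O] minus [A_ m]. *)
pose A_ m := A `&` D_ m `&` `[- (m%:R : R), m%:R]%classic.
have mA_ m : measurable (A_ m).
  apply: measurableI; first exact: measurableI.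
  by apply: borel_leb; exact: measurable_itv.
have [|||||m Hm] := @integral_exhaustion _ L R mu A A_ (EFin \o sigma) _ _ Aoo
    _ _ _ eta eta0.
- by apply/measurable_EFinP; exact: measurable_funS AD _.
- by move=> x /AD Dx; rewrite lee_fin sigma_ge0.
- apply/nondecreasing_seqP => m; rewrite subsetEset => x [[Ax [Dx /= xm]]].
  rewrite in_itv /= => /andP[mx xm']; split; first split => //.
    by split => //=; exact: ltnW.
  have mm : m%:R <= m.+1%:R :> R by rewrite ler_nat.
  by rewrite /= in_itv/= (le_trans _ mx) ?lerN2//= (le_trans xm').
- exact: mA_.
- apply/seteqP; split => [x [m _ [[]]]//|x Ax].
  exists (maxn (iota x).+1 (Num.truncn `|x : R|).+1) => //; split.
    by split => //; split; [exact: AD|rewrite /= leq_max leqnn].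
  rewrite /= in_itv/= -ler_norml (le_trans (ltW (truncnS_gt _)))//.
  by rewrite ler_nat leq_maxr.
have [dl dl0 Hdl] := abs_continuity m eta0.
have Amfin : (mu (A_ m) < +oo)%E.
  apply: (@le_lt_trans _ _ (mu (`[- (m%:R : R), m%:R]%classic : set L))).
    apply: le_measure; rewrite ?inE//; last by move=> x [].
    by apply: borel_leb; exact: measurable_itv.
  rewrite leb_borel lebesgue_measure_itv/=.
  by case: ifP => _; rewrite ?ltry// -EFinB ltry.
have [ O [ oO AO muO]] := outer_measure_open_le (A_ m) (divr_gt0 dl0 (ltr0Sn _ 1)).
have mO : measurable (O : set L) by apply: borel_leb; exact: open_measurable.
have muOA : (mu ((O : set L) `\` A_ m) < dl%:E)%E.
  rewrite measureD//; last first.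
    by apply: le_lt_trans muO _; rewrite lte_add_pinfty// ltry.
  rewrite setIidr//.
  have fA : mu (A_ m) \is a fin_num by rewrite ge0_fin_numE.
  rewrite lteBlDr//; apply: (le_lt_trans muO).
  rewrite addeC lteD2rE// lte_fin ltr_pdivrMr// mulr_natr mulr2n ltrDl//.
have [l lO Hl] := open_approx m oO eta0.
have mass_fin : (\int[mu]_(x in D_ m) (sigma x)%:E \is a fin_num)%E.
  rewrite ge0_fin_numE; first exact: (mass_below mD msigma sigma_ge0 miota sigma_fin).
  by apply: integral_ge0 => x [Dx _]; rewrite lee_fin sigma_ge0.
pose K := fine (\int[mu]_(x in D_ m) (sigma x)%:E)%E.
have K0 : 0 <= K.
  by apply: fine_ge0; apply: integral_ge0 => x [Dx _]; rewrite lee_fin sigma_ge0.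
pose q := e / (2 * (K + 1)).
have q0 : 0 < q by rewrite divr_gt0// mulr_gt0// ltr_wpDl.
(* The bound 1 keeps [cq] within the reach of [M]; the other makes the p-th power of [c - cq] at
   most [q], hence the cost of the common piece, of mass at most [K], at most [e / 2]. *)
have dd0 : 0 < Num.min 1 (q `^ p^-1) by rewrite lt_min ltr01 powR_gt0.
have [a [b]] := complex_rational_approx c dd0.
rewrite lt_min; set cq := _ +i* _ => /andP[cq1 cqq].
have cqM : cabs cq `^ p <= M.
  apply: (ge0_ler_powR (ltW p_gt0)); rewrite ?nnegrE ?cabs_ge0//.
    by rewrite addr_ge0 ?cabs_ge0.
  have -> : cq = c + (- (c - cq)) by rewrite opprB addrC subrK.
  by rewrite (le_trans (cabsD _ _))// lerD2l cabsN ltW.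
have cM : cabs c `^ p <= M.
  apply: (ge0_ler_powR (ltW p_gt0)); rewrite ?nnegrE ?cabs_ge0//.
    by rewrite addr_ge0 ?cabs_ge0.
  by rewrite lerDl.
have ccqM : cabs (c - cq) `^ p <= M.
  apply: (ge0_ler_powR (ltW p_gt0)); rewrite ?nnegrE ?cabs_ge0//.
    by rewrite addr_ge0 ?cabs_ge0.
  by rewrite (le_trans (ltW cq1))// lerDr cabs_ge0.
have ccqq : cabs (c - cq) `^ p <= q.
  have := gt0_ltr_powR p_gt0 (cabs_ge0 (c - cq)) (powR_ge0 _ _) cqq.
  by rewrite -powRrM mulVf ?gt_eqF// powRr1 ?(ltW q0)// => /ltW.
exists [:: (a, b, l)].
pose f (x : L) := c * (\1_A x : R)%:C - step_fun [:: (a, b, l)] (iota x) (tau x).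
have fE x : D x -> f x = c * (if x \in A then 1 else 0) -
    cq * (if x \in in_code l then 1 else 0).
  move=> Dx; rewrite /f /step_fun big_seq1 /=; congr (_ * _ - cq * _).
    by rewrite indicE; case: (x \in A).
  case: ifPn => xl; first by rewrite mem_set.
  by rewrite memNset// => -[_ /=]; exact/negP.
(* The error is supported in these four sets: the part cut off by the truncation, the excess of [O],
   what the boxes miss, and the common part, where the error is [c - cq]. *)
pose W1 := A `\` A_ m; pose W2 := ((O : set L) `&` D_ m) `\` A_ m.
pose W3 := ((O : set L) `&` D_ m) `\` in_code l; pose W4 := A_ m `&` in_code l.
have mOD : measurable ((O : set L) `&` D_ m) by exact: measurableI.
have mW1 : measurable W1 by exact: measurableD.
have mW2 : measurable W2 by exact: measurableD.
have mW3 : measurable W3 by apply: measurableD => //; exact: measurable_in_code.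
have mW4 : measurable W4 by apply: measurableI => //; exact: measurable_in_code.
have W1D : W1 `<=` D by move=> x [/AD].
have W2D : W2 `<=` D by move=> x [[_ []]].
have W3D : W3 `<=` D by move=> x [[_ []]].
have W4D : W4 `<=` D by move=> x [_ []].
have W4Dm : W4 `<=` D_ m by move=> x [[[]]].
have fM x : D x -> cabs (f x) `^ p <= M.
  move=> Dx; rewrite fE//; case: ifP => _; case: ifP => _;
    rewrite ?mulr1 ?mulr0 ?subr0 ?sub0r ?cabsN ?cabs0//.
  by rewrite powR0 ?gt_eqF// ltW.
have fq x : W4 x -> cabs (f x) `^ p <= q.
  move=> W4x; have [[[Ax _] _] xl] := W4x.
  by rewrite (fE _ (W4D _ W4x)) (mem_set Ax) (mem_set xl) !mulr1.
have mf : cmeasurable D f.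
  apply: cmeasurableB.
    apply: cmeasurableM; first exact: cmeasurable_cst.
    by apply: cmeasurable_real; exact: measurable_indic.
  have [n [A' [B' [_ _ _ mstep]]]] := @step_fun_tame R [:: (a, b, l)].
  exact: (cmeasurable_coord mD miota mtau mstep).
pose F x := (cabs (f x) `^ p * sigma x)%:E.
have mF : measurable_fun D F by apply: (measurable_wnorm p msigma mf).
have F0 x : D x -> (0 <= F x)%E by move=> Dx; exact: (wnorm_integrand_ge0 p sigma_ge0 f Dx).
have WD : W1 `|` (W2 `|` (W3 `|` W4)) `<=` D.
  by move=> x [/W1D|[/W2D|[/W3D|/W4D]]].
apply: (@le_lt_trans _ _ (\int[mu]_(x in W1 `|` (W2 `|` (W3 `|` W4))) F x)%E).
  apply: ge0_le_integral_any => // x Dx.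
    by apply: F0; exact: WD.
  move=> nW; rewrite -[X in cabs X]/(f x) fE//.
  have [xA|xA] := boolP (x \in A); have [xl|xl] := boolP (x \in in_code l);
    rewrite ?mulr1 ?mulr0 ?subr0 ?sub0r.
  - exfalso; apply: nW; have [xm|xm] := boolP (x \in A_ m).
      by do 3 right; split; exact: set_mem.
    by left; split; [exact: set_mem|move/mem_set; exact/negP].
  - exfalso; apply: nW; have [xm|xm] := boolP (x \in A_ m).
      do 2 right; left; split.
        by split; [exact/AO/set_mem|move/set_mem : xm => [[]]].
      by move/mem_set; exact/negP.
    by left; split; [exact: set_mem|move/mem_set; exact/negP].
  - exfalso; apply: nW; right; left; split; first exact/lO/set_mem.
    by move=> [[/mem_set Ax _] _]; rewrite Ax in xA.
  - by rewrite cabs0 powR0 ?gt_eqF// mul0r.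
have piece W : measurable W -> W `<=` D ->
    (\int[mu]_(x in W) (sigma x)%:E < eta%:E)%E ->
    (\int[mu]_(x in W) F x <= (e / 8)%:E)%E.
  move=> mW WD' We.
  apply: (le_trans (wnorm_piece_le mu mD msigma sigma_ge0 mW WD' (ltW M0) _)).
    by move=> x /WD'; exact: fM.
  have -> : e / 8 = M * eta.
    by rewrite /eta mulrCA invfM (mulrA M) divff ?gt_eqF// mul1r.
  by rewrite EFinM lee_wpmul2l ?lee_fin ?(ltW M0)// ltW.
have mFS W : W `<=` D -> measurable_fun W F by move=> WD'; exact: measurable_funS WD' _.
have sub W W' : W `<=` D -> W' `<=` D -> W `|` W' `<=` D by move=> WD' W'D x [/WD'|/W'D].
have S34 : W3 `|` W4 `<=` D by exact: sub.
have S234 : W2 `|` (W3 `|` W4) `<=` D by exact: sub.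
have m34 : measurable (W3 `|` W4) by exact: measurableU.
have m234 : measurable (W2 `|` (W3 `|` W4)) by exact: measurableU.
have H1 := ge0_integral_setU_le mu mW1 m234 (mFS _ WD) (fun x Wx => F0 x (WD _ Wx)).
have H2 := ge0_integral_setU_le mu mW2 m34 (mFS _ S234) (fun x Wx => F0 x (S234 _ Wx)).
have H3 := ge0_integral_setU_le mu mW3 mW4 (mFS _ S34) (fun x Wx => F0 x (S34 _ Wx)).
apply: (le_lt_trans H1); apply: (@le_lt_trans _ _
  ((e / 8)%:E + ((e / 8)%:E + ((e / 8)%:E + (e / 2)%:E)))%E); last first.
  by rewrite -!EFinD lte_fin.
apply: leeD; first exact: piece.
apply: (le_trans H2); apply: leeD.
  apply: piece => //; apply: Hdl => //; first by move=> x [[]].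
  apply: le_lt_trans muOA; apply: le_measure; rewrite ?inE//.
    exact: measurableD.
  by move=> x [[Ox _]].
apply: (le_trans H3); apply: leeD; first exact: piece.
apply: (le_trans (wnorm_piece_le mu mD msigma sigma_ge0 mW4 W4D (ltW q0) fq)).
apply: (@le_trans _ _ (q%:E * \int[mu]_(x in D_ m) (sigma x)%:E)%E).
  apply: lee_wpmul2l; first by rewrite lee_fin ltW.
  apply: ge0_subset_integral_any => // x [Dx _].
  by rewrite lee_fin sigma_ge0.
rewrite -(fineK mass_fin) -/K -EFinM lee_fin.
apply: (@le_trans _ _ (q * (K + 1))).
  by rewrite ler_wpM2l ?(ltW q0)// lerDl.
by rewrite /q invfM (mulrA e) divfK// gt_eqF// ltr_wpDl.
Qed.

Lemma step_fun_approx (f : L -> R[i]) (e : R) : cmeasurable D f ->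
  (wnorm mu D sigma p f < +oo)%E -> 0 < e -> exists s : step_code,
  (wnorm mu D sigma p (fun x => f x - step_fun s (iota x) (tau x))%R < e%:E)%E.
Proof.
move=> mf foo e0.
pose G (g : L -> R[i]) := exists s : step_code,
  g = fun x => step_fun s (iota x) (tau x).
have [||| g [s ->] He] := @weighted_approximation _ L R mu D sigma p mD msigma
  sigma_ge0 p_gt0 G _ _ _ f e mf foo e0.
- move=> _ [s ->]; have [n [A [B [_ _ _ mstep]]]] := @step_fun_tame R s.
  exact: (cmeasurable_coord mD miota mtau mstep).
- move=> _ _ [s ->] [s' ->]; exists (s ++ s'); apply/funext => x.
  by rewrite /step_fun big_cat.
- move=> A c e' mA AD Aoo e'0.
  have [s Hs] := step_indicator_approx c mA AD Aoo e'0.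
  by exists (fun x => step_fun s (iota x) (tau x)) => //; exists s.
by exists s.
Qed.

End step_density.

(** * Finite component integrals imply chaos *)

Section null_sets.
Context {R : realType}.
Notation L := (lebesgue_type R).
Variables (N : set L).
Hypotheses (mN : measurable N) (N0 : leb R N = 0%E).

Lemma null_measurable_fun d (Y : measurableType d) (f : L -> Y) :
  measurable_fun N f.
Proof.
by move=> _ B _; have [] := leb_null_sub mN N0 (@subIsetl _ N (f @^-1` B)).
Qed.

Lemma measurable_funU_null d (Y : measurableType d) (A : set L) (f : L -> Y) :
  measurable A -> measurable_fun A f -> measurable_fun (A `|` N) f.
Proof.
by move=> mA mf; apply/measurable_funU => //; split => //; exact: null_measurable_fun.
Qed.

Lemma ge0_integralU_null (A : set L) (f : L -> \bar R) : measurable A ->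
  measurable_fun A f -> (forall x, (A `|` N) x -> (0 <= f x)%E) ->
  (\int[leb R]_(x in A `|` N) f x = \int[leb R]_(x in A) f x)%E.
Proof.
move=> mA mf f0; apply/eqP; rewrite eq_le; apply/andP; split.
  apply: (le_trans (ge0_integral_setU_le _ mA mN _ f0)).
    exact: measurable_funU_null.
  by rewrite (ge0_integral_null mN N0) ?adde0// => x Nx; apply: f0; right.
by apply: ge0_subset_integral_any => // x Ax; left.
Qed.

End null_sets.

Section poweR_root.
Context {R : realType}.
Implicit Types (I : \bar R) (p e : R).

Lemma poweR_root_lt I p e : 0 < p -> 0 < e -> (0 <= I)%E ->
  ((I `^ p^-1 < e%:E)%E <-> (I < (e `^ p)%:E)%E).
Proof.
move=> p0 e0 I0; have pV0 : 0 < p^-1 by rewrite invr_gt0.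
case: I I0 => [r| |]//.
- rewrite lee_fin => r0; rewrite poweR_EFin !lte_fin; split => H.
    have := gt0_ltr_powR p0 (powR_ge0 _ _) (ltW e0) H.
    by rewrite -powRrM mulVf ?gt_eqF// powRr1.
  have := gt0_ltr_powR pV0 r0 (powR_ge0 _ _) H.
  by rewrite -powRrM mulfV ?gt_eqF// powRr1// ltW.
- by move=> _; rewrite poweRyr ?gt_eqF//; split; rewrite ltNge leey.
Qed.

Lemma poweR_root_lty I p : 0 < p -> (0 <= I)%E ->
  ((I `^ p^-1 < +oo)%E <-> (I < +oo)%E).
Proof.
move=> p0; have pV0 : 0 < p^-1 by rewrite invr_gt0.
by case: I => [r| |]// _; [rewrite poweR_EFin !ltry|rewrite poweRyr ?gt_eqF].
Qed.

End poweR_root.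

(** * Countable indexing of the components *)

Section component_index.
Context {R : realType}.
Variables (Omega : set R) (F : R -> R).
Hypotheses (Omega_open : open Omega) (F_C1 : is_C1_on Omega F).
Let U := Omega `\` zeros Omega F.
Let comp x := connected_component U x.

Definition nth_rat (n : nat) : R := ratr (odflt 0 (unpickle n : option rat)).

(** The number of some rational in the component. It is chosen from a set that depends only on the
    component, so it is constant there although many numbers are eligible. *)
Definition component_index x : nat :=
  xget 0%N [set n | connected_component (Omega `\` zeros Omega F) x (nth_rat n)].

Lemma component_indexP x : U x -> comp x (nth_rat (component_index x)).
Proof.
move=> Ux; rewrite /component_index; case: xgetP => [_ -> //|H]; exfalso.
have [e /= e0 He] := (@nbhs_ballP _ _ _ _).1
  (component_open Omega_open F_C1 (connected_component_refl Ux)).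
have [|q] := @rat_in_itvoo R x (x + e); first by rewrite ltrDl.
rewrite in_itv/= => /andP[xq qe].
apply: (H (pickle q)) => /=; rewrite /nth_rat pickleK /=; apply: He.
by rewrite /ball /= distrC gtr0_norm ?subr_gt0// ltrBlDl.
Qed.

Lemma component_index_eq x y : comp x y -> component_index y = component_index x.
Proof.
move=> xy; rewrite /component_index.
by have -> : connected_component (Omega `\` zeros Omega F) x =
  connected_component (Omega `\` zeros Omega F) y by exact: same_connected_component.
Qed.

Lemma component_index_inj x y : U x -> U y ->
  component_index x = component_index y -> comp x y.
Proof.
move=> Ux Uy xy; have := component_indexP Ux; rewrite xy => Cx.
by apply: (connected_component_trans Cx); apply/connected_component_sym/component_indexP.
Qed.

Lemma component_index_set n : U `&` [set x | component_index x = n] = set0 \/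
  [/\ U (nth_rat n), component_index (nth_rat n) = n &
      U `&` [set x | component_index x = n] = comp (nth_rat n)].
Proof.
have [[x [Ux /= xn]]|] := pselect (exists x, U x /\ component_index x = n).
  right; have Cx := component_indexP Ux; rewrite xn in Cx.
  have nx : component_index (nth_rat n) = n by rewrite (component_index_eq Cx).
  have Un : U (nth_rat n) by exact: connected_component_sub Cx.
  split => //; apply/seteqP; split => y.
    by move=> [Uy /= yn]; apply: component_index_inj => //; rewrite nx yn.
  move=> Cy; split; first exact: connected_component_sub Cy.
  by rewrite /= (component_index_eq Cy).
move=> H; left; apply/seteqP; split => // x [Ux /= xn].
by apply: H; exists x.
Qed.

End component_index.

(** * The semigroup as translation in the coordinates *)

Section sufficiency.
Context {R : realType}.
Notation L := (lebesgue_type R).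
Variables (p : R) (Omega : set R) (F : R -> R) (h : R -> R[i])
  (J : R -> set R) (phi : R -> R -> R) (rho : R -> R).
Hypotheses (p_gt0 : 0 < p) (Omega_open : open Omega) (F_C1 : is_C1_on Omega F)
  (h_cont : forall x, Omega x -> {for x, continuous (h : R -> R[i]^o)})
  (phi_flow : is_flow Omega F J phi) (Omega_fwd : forward_invariant Omega J)
  (rho_meas : lebesgue_measurable_fun Omega rho)
  (rho_gt0 : forall x, Omega x -> 0 < rho x).
Let U : set R := Omega `\` zeros Omega F.
Let comp (x : R) : set R := connected_component U x.
Hypotheses (zeros_null : lebesgue_measure (zeros Omega F) = 0%E)
  (mass_lty : forall z, U z -> exists2 x, comp z x &
     (component_integral p rho F h (comp z) x < +oo)%E).

Let iota : L -> nat := component_index Omega F.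

Let zerosE : Omega = U `|` zeros Omega F.
Proof.
have ZO : zeros Omega F `<=` Omega by move=> x [].
by rewrite setUC /U (setDUK ZO).
Qed.

Let borelU : measurable (U : set R).
Proof. exact: open_measurable (regular_open Omega_open F_C1). Qed.

Let comp_measurable (z : R) : measurable (comp z : set R).
Proof. by apply: open_measurable; exact: component_open. Qed.

Let mU : measurable (U : set L). Proof. exact: borel_leb. Qed.

Let mZ : measurable (zeros Omega F : set L).
Proof.
have -> : zeros Omega F = Omega `\` U.
  by rewrite /U setDD setIidr// => x [].
by apply: measurableD => //; apply: borel_leb; exact: open_measurable.
Qed.

(** The base points come from the finiteness hypothesis; choosing them per index and not per point
    makes them constant on components. *)
Let base_ex : exists base : nat -> R, forall n, U (nth_rat n) ->
  comp (nth_rat n) (base n) /\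
  (component_integral p rho F h (comp (nth_rat n)) (base n) < +oo)%E.
Proof.
suff /choice[base baseP] : forall n, exists b, U (nth_rat n) ->
    comp (nth_rat n) b /\
    (component_integral p rho F h (comp (nth_rat n)) b < +oo)%E by exists base.
move=> n; have [/mass_lty[b]|] := pselect (U (nth_rat n)); first by exists b.
by exists 0.
Qed.

Let base := projT1 (cid base_ex).

Let baseP n : U (nth_rat n) -> comp (nth_rat n) (base n) /\
  (component_integral p rho F h (comp (nth_rat n)) (base n) < +oo)%E.
Proof. by rewrite /base; case: cid => b /= /(_ n). Qed.

Let base_comp x : U x -> comp (nth_rat (iota x)) x /\
  comp (nth_rat (iota x)) (base (iota x)).
Proof.
move=> Ux; have Cx := component_indexP Omega_open F_C1 Ux.
split; first exact: connected_component_sym.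
by apply: (baseP _).1; exact: connected_component_sub Cx.
Qed.

Let tau (x : L) : R := flow_time F (base (iota x)) x.
Let E (x : L) : R[i] := growth F h (base (iota x)) x.
Let sigma (x : L) : R :=
  expR (- p * log_growth F h (base (iota x)) x) * rho x.

Let sigmaE x : sigma x = cabs (E x) `^ (- p) * rho x.
Proof.
rewrite /sigma /E cabs_growth; congr (_ * _).
by rewrite mulrC expRM.
Qed.

Let sigma_ge0 x : U x -> 0 <= sigma x.
Proof. by move=> [Ox _]; rewrite mulr_ge0 ?expR_ge0// ltW// rho_gt0. Qed.

Let miota n : measurable ((U : set L) `&` [set x | iota x = n]).
Proof.
have [->//|[_ _ ->]] := component_index_set Omega_open F_C1 n.
apply: borel_leb; exact: comp_measurable.
Qed.

(* On each component the data [base] are constant. *)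
Let measurable_on_components (g : R -> R -> R) :
  (forall z x0, comp z x0 -> measurable_fun (comp z) (g x0)) ->
  measurable_fun (U : set L) (fun x : L => g (base (iota x)) x : R).
Proof.
move=> mg.
apply: (measurable_index_fun miota (g := fun n x => g (base n) x)) => n.
have [->|[Un _ ->]] := component_index_set Omega_open F_C1 n.
  exact: measurable_fun_set0.
apply: measurable_fun_borel_leb; first exact: comp_measurable.
exact: mg (baseP Un).1.
Qed.

Let mtau : measurable_fun (U : set L) tau.
Proof. by apply: measurable_on_components => z x0; exact: measurable_flow_time. Qed.

Let mE : cmeasurable (U : set L) E.
Proof.
split.
- apply: (measurable_on_components (g := fun b x => complex.Re (growth F h b x))).
  by move=> z x0 Cx0; exact: (measurable_growth Omega_open F_C1 h_cont Cx0).1.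
- apply: (measurable_on_components (g := fun b x => complex.Im (growth F h b x))).
  by move=> z x0 Cx0; exact: (measurable_growth Omega_open F_C1 h_cont Cx0).2.
Qed.

Let mrho : measurable_fun (U : set L) rho.
Proof.
apply: measurable_funS rho_meas; first by apply: borel_leb; exact: open_measurable.
by move=> x [].
Qed.

Let msigma : measurable_fun (U : set L) sigma.
Proof.
rewrite (_ : sigma = fun x => cabs (E x) `^ (- p) * rho x); last first.
  by apply/funext => x; exact: sigmaE.
exact: (measurable_funM (measurable_powR_cabs (- p) mE) mrho).
Qed.

Let sigma_fin n :
  (\int[leb R]_(x in (U : set L) `&` [set x | iota x = n]) (sigma x)%:E < +oo)%E.
Proof.
have [->|[Un _ EU]] := component_index_set Omega_open F_C1 n.
  by rewrite integral_set0.
have -> : (\int[leb R]_(x in (U : set L) `&` [set x | iota x = n])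
    (sigma x)%:E)%E =
    component_integral p rho F h (comp (nth_rat n)) (base n).
  rewrite EU; apply: eq_integral => x /set_mem Cx.
  by rewrite /sigma (_ : iota x = n)//; move: Cx; rewrite -EU => -[].
exact: (baseP Un).2.
Qed.

(** [tau] is strictly monotone on the component, so rationals separating its values at [x - e / 2],
    [x] and [x + e / 2] confine [y] between the two outer points. *)
Let tau_base (O : set R) (x : R) : open O -> O x -> U x ->
  exists q1 q2 : rat, ratr q1 < tau x < ratr q2 /\
    forall y, U y -> iota y = iota x -> ratr q1 < tau y < ratr q2 -> O y.
Proof.
move=> oO Ox Ux; have [Cx Cb] := base_comp Ux.
set z := nth_rat (iota x) in Cx Cb.
have oC : open (comp z) by exact: component_open.
have [e /= e0 He] := (@nbhs_ballP _ _ _ _).1 (openI oO oC x (conj Ox Cx)).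
have e20 : 0 < e / 2 by rewrite divr_gt0.
have e2e : e / 2 < e by rewrite ltr_pdivrMr// mulr_natr mulr2n ltrDl.
pose a := x - e / 2; pose b := x + e / 2.
have [Oa Ca] : O a /\ comp z a.
  by apply: He; rewrite /ball /= /a opprB addrC subrK gtr0_norm.
have [Ob Cb'] : O b /\ comp z b.
  by apply: He; rewrite /ball /= /b opprD addrA subrr add0r normrN gtr0_norm.
have ax : a < x by rewrite ltrBlDr ltrDl.
have xb : x < b by rewrite ltrDl.
have abO y : a < y < b -> O y.
  move=> /andP[ay yb]; have [] // : (O `&` comp z) y.
  apply: He; rewrite /ball /= (lt_trans _ e2e)// ltr_norml.
  by move: ay yb; rewrite /a /b => ay yb; apply/andP; split; lra.
have [sg sg1 sgF] := field_sign F_C1 Cb.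
have mono c d : comp z c -> comp z d -> c < d ->
    sg * flow_time F (base (iota x)) c < sg * flow_time F (base (iota x)) d.
  by move=> Cc Cd; apply: (flow_time_mono Omega_open F_C1 Cb sgF).
have mono' c d : comp z c -> comp z d ->
    sg * flow_time F (base (iota x)) c < sg * flow_time F (base (iota x)) d -> c < d.
  move=> Cc Cd cd; rewrite ltNge le_eqVlt; apply/negP => /orP[/eqP E1|/mono-/(_ Cd Cc)].
    by move: cd; rewrite E1 ltxx.
  by move=> /(lt_trans cd); rewrite ltxx.
have inC y : U y -> iota y = iota x -> comp z y.
  by move=> Uy yx; have [+ _] := base_comp Uy; rewrite yx.
have Tax := mono _ _ Ca Cx ax; have Txb := mono _ _ Cx Cb' xb.
case: sg1 => sgE; rewrite sgE ?mul1r ?mulN1r ?ltrN2 in Tax Txb mono'.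
- have [q1] := rat_in_itvoo Tax; rewrite in_itv/= => /andP[aq1 q1x].
  have [q2] := rat_in_itvoo Txb; rewrite in_itv/= => /andP[xq2 q2b].
  exists q1, q2; split; first by rewrite /tau q1x.
  move=> y Uy yx; rewrite /tau yx => /andP[q1y yq2].
  have Cy := inC _ Uy yx.
  by apply: abO; apply/andP; split; apply: mono' => //; rewrite !mul1r;
    [exact: lt_trans q1y|exact: lt_trans q2b].
- have [q1] := rat_in_itvoo Txb; rewrite in_itv/= => /andP[aq1 q1x].
  have [q2] := rat_in_itvoo Tax; rewrite in_itv/= => /andP[xq2 q2b].
  exists q1, q2; split; first by rewrite /tau q1x.
  move=> y Uy yx; rewrite /tau yx => /andP[q1y yq2].
  have Cy := inC _ Uy yx.
  by apply: abO; apply/andP; split; apply: mono' => //; rewrite !mulN1r ltrN2;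
    [exact: lt_trans q2b|exact: lt_trans q1y].
Qed.

(** The inverse of the passage from [f] to the coordinates of [E f]. *)
Let lift (k : nat -> R -> R[i]) (x : R) : R[i] :=
  (E x)^-1 * k (iota x) (tau x).

Let semigroup_lift k t x : U x -> 0 <= t ->
  semigroup_op phi h t (lift k) x = lift (fun i r => k i (r + t)) x.
Proof.
move=> Ux t0; have [Cx Cb] := base_comp Ux.
have Cpx := component_flow phi_flow Omega_fwd Cx t0.
have iE : iota (phi t x) = iota x.
  by rewrite /iota (component_index_eq Cpx) (component_index_eq Cx).
rewrite /semigroup_op /lift /E /tau iE.
rewrite (flow_time_flow Omega_open F_C1 phi_flow Omega_fwd Cb Cx t0).
rewrite (growth_flow Omega_open F_C1 phi_flow Omega_fwd h_cont Cb Cx t0).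
have h0 : cocycle phi h t x != 0 by exact: cexp_neq0.
by rewrite invfM !mulrA (mulrC (cocycle _ _ _ _)) -(mulrA (_^-1)) mulfV// mulr1.
Qed.

Let measurable_rho_integrand (f : R -> R[i]) :
  cmeasurable (U : set L) (f : L -> R[i]) ->
  measurable_fun (U : set L) (fun x : L => (cabs (f x) `^ p * rho x)%:E).
Proof.
move=> mf; apply/measurable_EFinP.
exact: (measurable_funM (measurable_powR_cabs p mf) mrho).
Qed.

Let rho_integral (f : R -> R[i]) : \bar R :=
  (\int[leb R]_(x in Omega) (cabs (f x) `^ p * rho x)%:E)%E.

Let rho_integrand_ge0 (f : R -> R[i]) (x : R) : Omega x ->
  (0 <= (cabs (f x) `^ p * rho x)%:E)%E.
Proof. by move=> Ox; rewrite lee_fin mulr_ge0 ?powR_ge0// ltW// rho_gt0. Qed.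

Let rho_integral_wnorm (f : R -> R[i]) :
  cmeasurable (U : set L) (f : L -> R[i]) ->
  rho_integral f = wnorm (leb R) (U : set L) sigma p (fun x => E x * f x).
Proof.
move=> mf; rewrite /rho_integral {1}zerosE.
have UZ0 x : (U `|` zeros Omega F) x -> (0 <= (cabs (f x) `^ p * rho x)%:E)%E.
  by rewrite -zerosE; exact: rho_integrand_ge0.
rewrite (ge0_integralU_null mZ zeros_null mU (measurable_rho_integrand mf) UZ0).
apply: eq_integral => x /set_mem Ux; congr (_%:E).
rewrite sigmaE cabsM powRM ?cabs_ge0// mulrACA powRN divff ?mul1r//.
by rewrite gt_eqF// powR_gt0// cabs_gt0 growth_neq0.
Qed.

Let rho_integral_ge0 f : (0 <= rho_integral f)%E.
Proof. by apply: integral_ge0 => x; exact: rho_integrand_ge0. Qed.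

Let mul_lift k x : E x * lift k x = k (iota x) (tau x).
Proof. by rewrite /lift mulrA divff ?mul1r//; exact: growth_neq0. Qed.

Let lift_measurable k : (forall i, cmeasurable setT (k i)) ->
  cmeasurable (U : set L) (lift k).
Proof.
move=> mk; apply: cmeasurableM; first exact: cmeasurableV.
exact: (cmeasurable_coord mU miota mtau mk).
Qed.

Let lift_in_Lp k : (forall i, cmeasurable setT (k i)) ->
  (energy (leb R) (U : set L) sigma iota tau p k < +oo)%E ->
  in_Lp Omega p rho (lift k).
Proof.
move=> mk koo; have [mk1 mk2] := lift_measurable mk; split.
- by rewrite /lebesgue_measurable_fun zerosE; exact: (measurable_funU_null mZ zeros_null mU mk1).
- by rewrite /lebesgue_measurable_fun zerosE; exact: (measurable_funU_null mZ zeros_null mU mk2).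
- apply/(poweR_root_lty p_gt0 (rho_integral_ge0 (lift k))).
  rewrite rho_integral_wnorm; last exact: lift_measurable.
  by rewrite (eq_wnorm (leb R) _ _ (g := fun x => k (iota x) (tau x)))// => x _; exact: mul_lift.
Qed.

Let in_Lp_measurable g : in_Lp Omega p rho g -> cmeasurable (U : set L) (g : L -> R[i]).
Proof.
have mO : measurable (Omega : set L) by apply: borel_leb; exact: open_measurable.
have UO : (U : set L) `<=` (Omega : set L) by move=> x [].
by move=> [mg1 mg2 _]; split; [exact: (measurable_funS mO UO mg1)|exact: (measurable_funS mO UO mg2)].
Qed.

Let mEg g : in_Lp Omega p rho g -> cmeasurable (U : set L) (fun x : L => E x * g x).
Proof. by move=> /in_Lp_measurable mg; exact: cmeasurableM. Qed.

Let Lp_norm_lt f k g (e : R) : (forall x, U x -> f x = lift k x) ->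
  (forall i, cmeasurable setT (k i)) -> in_Lp Omega p rho g -> 0 < e ->
  (wnorm (leb R) (U : set L) sigma p
     (fun x => k (iota x) (tau x) - E x * g x)%R < (e `^ p)%:E)%E ->
  (Lp_norm Omega p rho (f - g)%R < e%:E)%E.
Proof.
move=> fk mk gL e0 H; apply/(poweR_root_lt p_gt0 e0 (rho_integral_ge0 _)).
have mg := in_Lp_measurable gL; have ml := lift_measurable mk.
have [mfg1 mfg2] := cmeasurableB ml mg.
rewrite rho_integral_wnorm.
  rewrite (eq_wnorm (leb R) _ _ (g := fun x => k (iota x) (tau x) - E x * g x))// => x Ux.
  have -> : (f - g)%R x = lift k x - g x by rewrite -fk.
  by rewrite mulrBr mul_lift.
have fgE x : U x -> (f - g)%R x = lift k x - g x by move=> Ux; rewrite -fk.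
split; [apply: eq_measurable_fun mfg1|apply: eq_measurable_fun mfg2] => x /set_mem Ux;
  by rewrite fgE.
Qed.

Let codes_dense g (e : R) : in_Lp Omega p rho g -> 0 < e -> exists s : step_code,
  (wnorm (leb R) (U : set L) sigma p
     (fun x => E x * g x - step_fun s (iota x) (tau x))%R < e%:E)%E.
Proof.
move=> gL e0.
apply: (step_fun_approx mU msigma sigma_ge0 miota mtau p_gt0 sigma_fin tau_base
  (mEg gL) _ e0).
rewrite -rho_integral_wnorm; last exact: in_Lp_measurable.
have [_ _] := gL; exact: (poweR_root_lty p_gt0 (rho_integral_ge0 g)).1.
Qed.

(* Passing through a step function close to [E g]. *)
Let approx_by_lift (P : (nat -> R -> R[i]) -> Prop) :
  (forall k, P k -> forall i, cmeasurable setT (k i)) ->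
  (forall (s : step_code) (e : R), 0 < e -> exists2 k, P k &
    (energy (leb R) (U : set L) sigma iota tau p
      (fun i r => k i r - step_fun s i r)%R <= e%:E)%E) ->
  forall g, in_Lp Omega p rho g -> forall e : R, 0 < e -> exists2 k, P k &
  forall f, (forall x, U x -> f x = lift k x) ->
  (Lp_norm Omega p rho (f - g)%R < e%:E)%E.
Proof.
move=> mP PD g gL e e0.
have [e' e'0 He'] := wnormD_small (leb R) mU msigma sigma_ge0 p_gt0
  (powR_gt0 p e0).
have [s Hs] := codes_dense gL e'0.
have [k Pk Hk] := PD s _ (divr_gt0 e'0 (ltr0Sn _ 1)).
exists k => // f fk; apply: (Lp_norm_lt fk (mP _ Pk) gL e0).
have [n [A [B [_ _ _ ms]]]] := @step_fun_tame R s.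
have mcoord j := cmeasurable_coord mU miota mtau j.
have := He' _ _ (cmeasurableB (mcoord _ (mP _ Pk)) (mcoord _ ms))
  (cmeasurableN (cmeasurableB (mEg gL) (mcoord _ ms))).
have sumE : wnorm (leb R) (U : set L) sigma p (fun x =>
    (k (iota x) (tau x) - step_fun s (iota x) (tau x)) +
    - (E x * g x - step_fun s (iota x) (tau x))) =
  wnorm (leb R) (U : set L) sigma p (fun x => k (iota x) (tau x) - E x * g x).
  by apply: eq_wnorm => x _; rewrite opprB addrA subrK.
rewrite sumE; apply.
  apply: (le_lt_trans Hk); rewrite lte_fin ltr_pdivrMr//.
  by rewrite mulr_natr mulr2n ltrDl.
apply: le_lt_trans Hs; apply: (le_wnorm (leb R) sigma_ge0 p_gt0) => x _.
by rewrite cabsN.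
Qed.

Lemma component_integrals_chaotic : chaotic Omega p rho (semigroup_op phi h).
Proof.
split.
  have [k [mk koo kd]] := universal_function mU msigma sigma_ge0 miota mtau
    p_gt0 sigma_fin.
  exists (lift k); first exact: lift_in_Lp.
  pose P (k' : nat -> R -> R[i]) :=
    exists2 t, 0 <= t & k' = fun i r => k i (r + t).
  move=> g gL e e0.
  have [||_ [t t0 ->] H] := @approx_by_lift P _ _ g gL e e0.
  - by move=> _ [t _ ->]; exact: cmeasurable_shift.
  - move=> s e' e'0; have [t t0 Ht] := kd s e' e'0.
    by exists (fun i r => k i (r + t)) => //; exists t.
  exists (semigroup_op phi h t (lift k)).
    by exists t => //=; rewrite in_itv/= t0.
  by apply: H => x Ux; exact: semigroup_lift.
pose P (k' : nat -> R -> R[i]) := [/\ forall i, cmeasurable setT (k' i),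
  (energy (leb R) (U : set L) sigma iota tau p k' < +oo)%E &
  exists2 t : R, 0 < t & forall i r, k' i (r + t) = k' i r].
move=> g gL e e0.
have [||k [mk koo [t t0 kt]] H] := @approx_by_lift P _ _ g gL e e0.
- by move=> k [].
- move=> s e' e'0; have [n [A [B sT]]] := @step_fun_tame R s.
  have [t [k [t0 mk kt koo Hk]]] := tame_periodic mU msigma sigma_ge0 miota mtau
    p_gt0 sigma_fin sT e'0.
  by exists k => //; split => //; exists t.
exists (lift k); last exact: H.
split; first exact: lift_in_Lp.
(* Off the null set of zeros the periodicity of [lift k] is exact. *)
exists t => //; exists (zeros Omega F); split => // x /=.
move=> /not_implyP[Ox nE]; apply: contrapT => nZ; apply: nE.
rewrite (semigroup_lift k (conj Ox nZ) (ltW t0)).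
by rewrite /lift kt.
Qed.

End sufficiency.

(** * Hypercyclicity forces the zero set to be null *)

Section positive_mass.
Context d (T : measurableType d) {R : realType}.
Variable mu : {measure set T -> \bar R}.

Lemma integral_pos_gt0 (A : set T) (f : T -> R) : measurable A ->
  measurable_fun A f -> (forall x, A x -> 0 < f x) -> mu A <> 0%E ->
  (0 < \int[mu]_(x in A) (f x)%:E)%E.
Proof.
move=> mA mf f0 A0; have f_ge0 x : A x -> (0 <= (f x)%:E)%E.
  by move=> Ax; rewrite lee_fin ltW// f0.
rewrite lt_neqAle integral_ge0// andbT; apply/eqP => I0; apply: A0.
have mEf : measurable_fun A (EFin \o f) by exact/measurable_EFinP.
have [] : ae_eq mu A (EFin \o f) (cst 0%E).
  apply/(ae_eq_integral_abs mu mA mEf); rewrite [RHS]I0.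
  apply: eq_integral => x /set_mem Ax.
  by rewrite gee0_abs//; exact: f_ge0.
move=> N [mN N0 AN]; apply/eqP; rewrite eq_le measure_ge0 andbT -N0.
apply: le_measure; rewrite ?inE// => x Ax; apply: AN => /(_ Ax) /= [fx0].
by have := f0 _ Ax; rewrite fx0 ltxx.
Qed.

Lemma bigcup_measure_neq0 (A : (set T)^nat) : (forall n, measurable (A n)) ->
  mu (\bigcup_n A n) <> 0%E -> exists n, mu (A n) <> 0%E.
Proof.
move=> mA UA0; apply: contrapT => H; apply: UA0.
have A0 n : mu (A n) = 0%E by apply: contrapT => An; apply: H; exists n.
have [N [mN N0 AN]] : mu.-negligible (\bigcup_n A n).
  by apply: negligible_bigcup => n; exists (A n); split.
apply/eqP; rewrite eq_le measure_ge0 andbT -N0.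
by apply: le_measure; rewrite ?inE//; exact: bigcupT_measurable.
Qed.

End positive_mass.

Section lebesgue_borel.
Context {R : realType}.
Notation L := (lebesgue_type R).

Lemma leb_null_borel_cover (N : set L) : leb R N = 0%E ->
  exists2 B : set R, measurable B /\ lebesgue_measure B = 0%E & N `<=` B.
Proof.
move=> N0; have [G [oG NG G0]] := outer_measure_Gdelta N.
exists (\bigcap_i G i) => //; split; last by rewrite G0.
by apply: bigcapT_measurable => i; exact: open_measurable.
Qed.

(** A Lebesgue set is the union of a Borel set and part of a null set. The Borel part is what can
    later be carried to times through the Borel map [time_inv]. *)
Lemma leb_borel_subset (A : set L) : measurable A -> leb R A <> 0%E ->
  exists2 B : set R, measurable B /\ lebesgue_measure B <> 0%E & B `<=` A.
Proof.
rewrite -completed_caratheodory_measurable g_sigma_completed_algebra_genE.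
move=> [B /= mB [N negN <-]] BN0; exists B => //; split => // B0; apply: BN0.
have [M [mM M0 NM]] := negN.
have mBM : measurable (B `|` M : set L) by apply: borel_leb; exact: measurableU.
have BM0 : leb R (B `|` M) = 0%E.
  apply/eqP; rewrite eq_le measure_ge0 andbT leb_borel.
  have <- : (lebesgue_measure B + lebesgue_measure M = 0)%E by rewrite B0 M0 adde0.
  exact: measureU2.
have BNM : B `|` N `<=` B `|` M by move=> x [Bx|/NM Mx]; [left|right].
exact: (leb_null_sub mBM BM0 BNM).2.
Qed.

(** [rho] may fail to be locally integrable, so an indicator is sure to lie in the space only after
    cutting to [rho < n] and to a bounded interval; some cut keeps positive measure. *)
Lemma finite_mass_subset (D : set L) (rho : L -> R) : measurable D ->
  measurable_fun D rho -> (forall x, D x -> 0 < rho x) -> leb R D <> 0%E ->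
  exists A : set L, [/\ measurable A, A `<=` D, leb R A <> 0%E,
    (0 < \int[leb R]_(x in A) (rho x)%:E)%E &
    (\int[leb R]_(x in A) (rho x)%:E < +oo)%E].
Proof.
move=> mD mrho rho0 D0.
pose A n : set L := (D `&` rho @^-1` `]-oo, n%:R[%classic) `&`
  `[- (n%:R : R), n%:R]%classic.
have mA n : measurable (A n).
  apply: measurableI; first by apply: mrho => //; exact: measurable_itv.
  by apply: borel_leb; exact: measurable_itv.
have DA : D = \bigcup_n A n.
  apply/seteqP; split => [x Dx|x [n _ [[]]]//].
  exists (maxn (Num.truncn `|rho x|).+1 (Num.truncn `|x : R|).+1) => //.
  split; first split => //=; rewrite /= in_itv/=.
    rewrite (le_lt_trans (ler_norm _))// (lt_le_trans (truncnS_gt _))//.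
    by rewrite ler_nat leq_maxl.
  rewrite -ler_norml (le_trans (ltW (truncnS_gt _)))//.
  by rewrite ler_nat leq_maxr.
have [n An0] : exists n, leb R (A n) <> 0%E.
  by apply: bigcup_measure_neq0 => //; rewrite -DA.
have AD : A n `<=` D by move=> x [[]].
have mrA : measurable_fun (A n) rho by exact: measurable_funS AD _.
exists (A n); split => //.
  by apply: integral_pos_gt0 => // x /AD; exact: rho0.
apply: (@le_lt_trans _ _ (\int[leb R]_(x in A n) (cst n%:R%:E x))%E).
  apply: ge0_le_integral_any => // x Ax.
  - by rewrite lee_fin ltW// rho0//; exact: AD.
  - by rewrite /= lee_fin.
  - by move=> _; rewrite lee_fin; case: Ax => [[_ /=]]; rewrite in_itv/= => /ltW.
rewrite integral_cst// lte_mul_pinfty// ?lee_fin//.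
apply: (@le_lt_trans _ _ (leb R (`[- (n%:R : R), n%:R]%classic : set L))).
  apply: le_measure; rewrite ?inE//; last by move=> x [].
  by apply: borel_leb; exact: measurable_itv.
rewrite leb_borel lebesgue_measure_itv/=.
by case: ifP => _; rewrite ?ltry// -EFinB ltry.
Qed.

End lebesgue_borel.

Section necessity_zeros.
Context {R : realType}.
Notation L := (lebesgue_type R).
Variables (p : R) (Omega : set R) (F : R -> R) (h : R -> R[i])
  (J : R -> set R) (phi : R -> R -> R) (rho : R -> R).
Hypotheses (p_gt0 : 0 < p) (Omega_open : open Omega) (F_C1 : is_C1_on Omega F)
  (phi_flow : is_flow Omega F J phi)
  (rho_meas : lebesgue_measurable_fun Omega rho)
  (rho_gt0 : forall x, Omega x -> 0 < rho x).

Lemma rho_integral_subset (A : set L) (f : R -> R[i]) : A `<=` Omega ->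
  (\int[leb R]_(x in A) (cabs (f x) `^ p * rho x)%:E <=
   \int[leb R]_(x in Omega) (cabs (f x) `^ p * rho x)%:E)%E.
Proof.
move=> AO; apply: ge0_subset_integral_any => // x Ox.
by rewrite lee_fin mulr_ge0 ?powR_ge0// ltW// rho_gt0.
Qed.

Lemma in_Lp_indic (A : set L) (c : R[i]) : measurable A -> A `<=` Omega ->
  (\int[leb R]_(x in A) (rho x)%:E < +oo)%E ->
  in_Lp Omega p rho (fun x => c * (\1_A x : R)%:C).
Proof.
move=> mA AO Aoo.
have mO : measurable (Omega : set L) by apply: borel_leb; exact: open_measurable.
have [m1 m2] : cmeasurable (Omega : set L) (fun x : L => c * (\1_A x : R)%:C).
  apply: cmeasurableM; first exact: cmeasurable_cst.
  by apply: cmeasurable_real; exact: measurable_indic.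
split => //; apply/(poweR_root_lty p_gt0).
  apply: integral_ge0 => x Ox.
  by rewrite lee_fin mulr_ge0 ?powR_ge0// ltW// rho_gt0.
apply: (@le_lt_trans _ _ ((cabs c `^ p)%:E * \int[leb R]_(x in A) (rho x)%:E)%E).
  have rho0 x : A x -> (0 <= (rho x)%:E)%E.
    by move=> Ax; rewrite lee_fin ltW// rho_gt0//; exact: AO.
  have mr : measurable_fun A (EFin \o rho).
    by apply/measurable_EFinP; exact: (measurable_funS mO AO rho_meas).
  rewrite -(ge0_integralZl_EFin (leb R) mA rho0 mr (powR_ge0 _ _)).
  apply: ge0_le_integral_any => x.
  - by move=> Ox; rewrite lee_fin mulr_ge0 ?powR_ge0// ltW// rho_gt0.
  - by move=> Ax; apply: mule_ge0; [rewrite lee_fin powR_ge0|exact: rho0].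
  - by move=> _ Ax; rewrite indicE mem_set// mulr1 EFinM.
  - by move=> _ Ax; rewrite indicE memNset// mulr0 cabs0 powR0 ?gt_eqF// mul0r.
by rewrite lte_mul_pinfty// lee_fin powR_ge0.
Qed.

Lemma dense_rho_integral (P : set (R -> R[i])) (g : R -> R[i]) (e : R) :
  dense_in_Lp Omega p rho P -> in_Lp Omega p rho g -> 0 < e ->
  exists2 f, P f &
    (\int[leb R]_(x in Omega) (cabs (f x - g x) `^ p * rho x)%:E < e%:E)%E.
Proof.
move=> dP gL e0; have e'0 : 0 < e `^ p^-1 by rewrite powR_gt0.
have [f Pf] := dP g gL _ e'0.
rewrite /Lp_norm poweR_root_lt//; last first.
  apply: integral_ge0 => x Ox.
  by rewrite lee_fin mulr_ge0 ?powR_ge0// ltW// rho_gt0.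
by rewrite -powRrM mulVf ?gt_eqF// powRr1 ?(ltW e0)// => H; exists f.
Qed.

Lemma cocycle_zero (gamma t x : R) :
  (forall x, zeros Omega F x -> h x = gamma%:C) -> zeros Omega F x -> 0 <= t ->
  cocycle phi h t x = (expR (gamma * t))%:C.
Proof.
move=> hz Zx t0; rewrite /cocycle.
have -> : cint `[0, t] (fun s => h (phi s x)) = (gamma * t)%:C.
  have hE s : s \in `[0, t]%classic -> h (phi s x) = gamma%:C.
    move=> /set_mem /=; rewrite in_itv/= => /andP[s0 _].
    by rewrite (flow_zero phi_flow s Zx).2 hz.
  apply/eqP; rewrite eq_complex /=; apply/andP; split; apply/eqP.
    rewrite (eq_Rintegral _ (g := fun=> gamma)); last by move=> s /hE ->.
    exact: Rintegral_itv_cst.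
  rewrite (eq_Rintegral _ (g := fun=> 0)); last by move=> s /hE ->.
  by rewrite Rintegral_itv_cst// mul0r.
by rewrite /cexp /= cos0 sin0 mulr1 mulr0.
Qed.

Lemma hypercyclic_zeros_null (gamma : R) :
  (forall x, zeros Omega F x -> h x = gamma%:C) ->
  hypercyclic Omega p rho (semigroup_op phi h) ->
  lebesgue_measure (zeros Omega F) = 0%E.
Proof.
move=> hz [f fL fd]; apply: contrapT => Z0.
have ZO : zeros Omega F `<=` Omega by move=> x [].
have mO : measurable (Omega : set L) by apply: borel_leb; exact: open_measurable.
have mU := open_measurable (regular_open Omega_open F_C1).
have mZ : measurable (zeros Omega F : set L).
  have -> : zeros Omega F = Omega `\` (Omega `\` zeros Omega F).
    by rewrite setDD setIidr.
  by apply: measurableD => //; exact: borel_leb.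
have [A [mA AZ A0 Agt0 Aoo]] := finite_mass_subset mZ
  (measurable_funS mO ZO rho_meas) (fun x Zx => rho_gt0 (ZO _ Zx)) Z0.
have AO : A `<=` Omega by move=> x /AZ/ZO.
have Afin : (\int[leb R]_(x in A) (rho x)%:E \is a fin_num)%E.
  by rewrite ge0_fin_numE// ltW.
(* Half the mass of [A]: two approximations with errors below [e] contradict a pointwise bound whose
   integral is the whole mass. *)
pose e := fine (\int[leb R]_(x in A) (rho x)%:E)%E / 2.
have e0 : 0 < e by rewrite divr_gt0// -lte_fin fineK.
have near_indic (c : R[i]) : exists2 t, 0 <= t &
    (\int[leb R]_(x in A)
       (cabs ((expR (gamma * t))%:C * f x - c) `^ p * rho x)%:E < e%:E)%E.
  have [g [t /=]] := dense_rho_integral fd (in_Lp_indic c mA AO Aoo) e0.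
  rewrite in_itv/= andbT => t0 <- He; exists t; first exact: t0.
  have HA := rho_integral_subset (fun x => semigroup_op phi h t f x -
    c * (\1_A x : R)%:C) AO.
  have -> : (\int[leb R]_(x in A)
      (cabs ((expR (gamma * t))%:C * f x - c) `^ p * rho x)%:E)%E =
    (\int[leb R]_(x in A) (cabs (semigroup_op phi h t f x -
      c * (\1_A x : R)%:C) `^ p * rho x)%:E)%E.
    apply: eq_integral => x Ax; have Zx := AZ _ (set_mem Ax).
    by rewrite /semigroup_op (flow_zero phi_flow t Zx).2 (cocycle_zero hz Zx t0)
      indicE Ax mulr1.
  exact: le_lt_trans HA He.
have mf : cmeasurable A (f : L -> R[i]).
  have [mf1 mf2 _] := fL.
  by split; [exact: (measurable_funS mO AO mf1)|exact: (measurable_funS mO AO mf2)].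
have mrho : measurable_fun A rho by exact: (measurable_funS mO AO rho_meas).
pose G r c (x : L) := (cabs (r%:C * f x - c) `^ p * rho x)%:E.
have G0 r c x : A x -> (0 <= G r c x)%E.
  by move=> Ax; rewrite lee_fin mulr_ge0 ?powR_ge0// ltW// rho_gt0//; exact: AO.
have mG r c : measurable_fun A (G r c).
  apply/measurable_EFinP; apply: measurable_funM mrho.
  apply: measurable_powR_cabs; apply: cmeasurableB; last exact: cmeasurable_cst.
  by apply: cmeasurableM => //; exact: cmeasurable_cst.
have [t t0 Ht] := near_indic 1; have [s s0 Hs] := near_indic (- 1).
have p1 : 1 `^ p = 1 :> R by rewrite powR1.
have : (\int[leb R]_(x in A) (rho x)%:E < e%:E + e%:E)%E.
  apply: (le_lt_trans _ (lteD Ht Hs)).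
  rewrite -(ge0_integralD _ mA (G0 _ 1) (mG _ 1) (G0 _ (- 1)) (mG _ (- 1))).
  apply: ge0_le_integral_any => // x Ax.
  - by rewrite lee_fin ltW// rho_gt0//; exact: AO.
  - by apply: adde_ge0; exact: G0.
  - rewrite -EFinD lee_fin -mulrDl ler_peMl ?(ltW (rho_gt0 (AO _ Ax)))//.
    (* Positive multiples keep the sign of [Re (f x)]: the multiple at time [s] is at distance at
       least 1 from [- 1], or the one at time [t] at distance at least 1 from [1]. *)
    have [f0|f0] := leP 0 (complex.Re (f x)).
      rewrite -[leLHS]add0r lerD ?powR_ge0// opprK.
      rewrite -[leLHS]p1; apply: (ge0_ler_powR (ltW p_gt0)); rewrite ?nnegrE ?cabs_ge0//.
      apply: le_trans (le_Re_cabs _); apply: le_trans (ler_norm _).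
      by case: (f x) f0 => a b /= a0; rewrite mul0r subr0 lerDr mulr_ge0 ?expR_ge0.
    rewrite -[leLHS]addr0 lerD ?powR_ge0//.
    rewrite -[leLHS]p1; apply: (ge0_ler_powR (ltW p_gt0)); rewrite ?nnegrE ?cabs_ge0//.
    apply: le_trans (le_Re_cabs _); rewrite -normrN; apply: le_trans (ler_norm _).
    case: (f x) f0 => a b /= a0; rewrite mul0r subr0 opprB lerDl.
    by rewrite oppr_ge0 mulr_ge0_le0 ?expR_ge0// ltW.
by rewrite -(fineK Afin) -EFinD lte_fin -splitr ltxx.
Qed.

End necessity_zeros.

(** * Periodic functions force finite component integrals *)

Section integral_cover.
Local Open Scope ereal_scope.
Context d (T : measurableType d) (R : realType) (mu : {measure set T -> \bar R}).

Lemma ge0_integral_cover_le (D A : set T) (E : (set T)^nat) (f : T -> \bar R) :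
  measurable D -> measurable_fun D f -> (forall x, D x -> 0 <= f x) ->
  (forall n, measurable (E n)) -> (forall n, E n `<=` D) ->
  A `<=` \bigcup_n E n ->
  \int[mu]_(x in A) f x <= \sum_(n <oo) \int[mu]_(x in E n) f x.
Proof.
move=> mD mf f0 mE ED AE.
have UD : \bigcup_n E n `<=` D by apply: bigcup_sub => n _; exact: ED.
have mU : measurable (\bigcup_n E n) by exact: bigcupT_measurable.
apply: (@le_trans _ _ (\int[mu]_(x in \bigcup_n E n) f x)).
  by apply: ge0_subset_integral_any => // x /UD /f0.
rewrite seqDU_bigcup_eq ge0_integral_bigcup//.
- apply: lee_nneseries => [n _ _|n _].
    by apply: integral_ge0 => x Ex; exact/f0/(ED n)/(subset_seqDU Ex).
  by apply: ge0_subset_integral_any; [exact: subset_seqDU|move=> x /ED/f0].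
- move=> n; rewrite /seqDU; apply: measurableD => //.
  exact: bigsetU_measurable.
- by rewrite -seqDU_bigcup_eq; exact: measurable_funS UD mf.
- by rewrite -seqDU_bigcup_eq => x /UD/f0.
Qed.

End integral_cover.

(** * Change of variables to the time coordinate *)

Section time_change.
Context {R : realType}.
Notation mu := (@lebesgue_measure R).
Variables (C : set R) (tau F : R -> R) (sg : R).
Hypotheses (oC : open C) (iC : is_interval C) (sg1 : sg = 1 \/ sg = -1)
  (sgF : forall x, C x -> 0 < sg * F x)
  (dtau : forall x, C x -> is_derive x 1 tau (F x)^-1)
  (cF : forall x, C x -> {for x, continuous F})
  (mono : forall x y, C x -> C y -> x < y -> sg * tau x < sg * tau y).
Implicit Types (x y r s c d : R).

Let I : set R := tau @` C.

Let sg_neq0 : sg != 0.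
Proof. by case: sg1 => ->; rewrite ?oppr_eq0 oner_eq0. Qed.

Let tau_continuous x : C x -> {for x, continuous tau}.
Proof.
move=> Cx; apply: differentiable_continuous; apply/derivable1_diffP.
exact: (@ex_derive _ _ _ _ _ _ _ (dtau Cx)).
Qed.

Lemma time_mono_inv x y : C x -> C y -> sg * tau x < sg * tau y -> x < y.
Proof.
move=> Cx Cy xy; rewrite ltNge le_eqVlt; apply/negP => /orP[/eqP yx|yx].
  by move: xy; rewrite yx ltxx.
by have := lt_trans xy (mono Cy Cx yx); rewrite ltxx.
Qed.

Lemma time_inj x y : C x -> C y -> tau x = tau y -> x = y.
Proof.
move=> Cx Cy xy; case: (ltgtP x y) => // H.
  by have := mono Cx Cy H; rewrite xy ltxx.
by have := mono Cy Cx H; rewrite xy ltxx.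
Qed.

Definition time_inv r : R := xget 0 [set x | C x /\ tau x = r].

Lemma time_invP r : I r -> C (time_inv r) /\ tau (time_inv r) = r.
Proof.
move=> [x Cx xr]; rewrite /time_inv; case: xgetP => [y -> []//|].
by move=> /(_ x) []; split.
Qed.

Lemma time_invK x : C x -> time_inv (tau x) = x.
Proof.
move=> Cx; have [Cu tu] := @time_invP (tau x) (ex_intro2 _ _ x Cx erefl).
exact: time_inj.
Qed.

(** By the intermediate value theorem the image of a small interval around [x] contains a
    neighbourhood of [tau x]. This gives both the open range of [tau] and the continuity of its
    inverse. *)
Lemma time_open_map (O : set R) : open O -> open (tau @` (O `&` C)).
Proof.
move=> oO; rewrite openE => _ [x [Ox Cx] <-].
have [e /= e0 He] := (@nbhs_ballP _ _ _ _).1 (openI oO oC x (conj Ox Cx)).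
have e20 : 0 < e / 2 by rewrite divr_gt0.
have e2e : e / 2 < e by rewrite ltr_pdivrMr// mulr_natr mulr2n ltrDl.
have xe y : x - e / 2 <= y <= x + e / 2 -> (O `&` C) y.
  move=> /andP[ay yb]; apply: He; rewrite /ball /= distrC.
  by rewrite (le_lt_trans _ e2e)// ler_distl ay.
have [Oa Ca] : (O `&` C) (x - e / 2) by apply: xe; rewrite lexx/=; lra.
have [Ob Cb] : (O `&` C) (x + e / 2) by apply: xe; rewrite lexx andbT; lra.
have ax : sg * tau (x - e / 2) < sg * tau x by apply: mono => //; lra.
have xb : sg * tau x < sg * tau (x + e / 2) by apply: mono => //; lra.
have cs : sg * s @[s --> tau x] --> sg * tau x.
  by apply: cvgM; [exact: cvg_cst|exact: cvg_id].
have n1 := cvgr_gt _ cs _ ax; have n2 := cvgr_lt _ cs _ xb.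
suff: \forall s \near nbhs (tau x), (tau @` (O `&` C)) s by [].
apply: filterS2 (n1 _) (n2 _) => s as_ sb.
have ab : x - e / 2 <= x + e / 2 by lra.
have ctau : {within `[x - e / 2, x + e / 2], continuous (fun y => sg * tau y)}.
  apply: continuous_in_subspaceT => y /set_mem /=; rewrite in_itv/= => /xe[_ Cy].
  by apply: cvgM; [exact: cvg_cst|exact: tau_continuous].
have [|y] := IVT (v := sg * s) ab ctau.
  by rewrite ge_min le_max (ltW as_) (ltW sb) orbT.
rewrite in_itv/= => /xe Oy /(mulfI sg_neq0) ys.
by exists y.
Qed.

Let oI : open I.
Proof. by have := time_open_map openT; rewrite setTI. Qed.

Lemma measurable_time_inv : measurable_fun I time_inv.
Proof.
apply: open_continuous_measurable_fun => // r /set_mem Ir.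
have [Cu tu] := time_invP Ir.
move=> V /= /(@nbhs_ballP _ _ _ _)[e /= e0 He].
have H := time_open_map (ball_open (time_inv r) e).
have rH : (tau @` (ball (time_inv r) e `&` C)) r.
  by exists (time_inv r) => //; split => //; exact: ballxx.
apply: filterS (open_nbhs_nbhs (conj H rH)) => _ [y [ye Cy] <-].
by rewrite /preimage/= time_invK//; exact: He.
Qed.

(** On [C], [sg * F x] is [|F x|], so this is the density [|tau'|] of [d tau]. *)
Let weight x : R := (sg * F x)^-1.

Let weight_continuous x : C x -> {for x, continuous weight}.
Proof.
move=> Cx; apply: cvgV; first by rewrite gt_eqF// sgF.
by apply: cvgM; [exact: cvg_cst|exact: cF].
Qed.

Let measurable_weight : measurable_fun C weight.
Proof.
apply: open_continuous_measurable_fun => // y /set_mem; exact: weight_continuous.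
Qed.

Let measurable_tau : measurable_fun C tau.
Proof.
apply: open_continuous_measurable_fun => // y /set_mem; exact: tau_continuous.
Qed.

Lemma time_slab c d : I c -> I d -> c <= d ->
  (\int[mu]_(x in C `&` [set x | (c < tau x <= d)%R]) (weight x)%:E)%E = (d - c)%:E.
Proof.
move=> Ic Id cd; have [Cc tc] := time_invP Ic; have [Cd td] := time_invP Id.
have itv_int a b : C a -> C b -> a <= b ->
    (\int[mu]_(x in `[a, b]) (weight x)%:E)%E = (sg * tau b - sg * tau a)%:E.
  move=> Ca Cb ab; apply: (@integral_FTC2 _ (fun x => sg * tau x)) => // x xab.
    have Cx : C x by exact: (iC Ca Cb).
    have -> : weight x = sg *: (F x)^-1.
      rewrite /weight invfM; congr (_ * _).
      by case: sg1 => ->; rewrite ?invrN invr1.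
    by apply: is_deriveZ; exact: dtau.
  by apply: weight_continuous; exact: (iC Ca Cb).
have mitv a b : C a -> C b -> measurable_fun `[a, b] (EFin \o weight).
  move=> Ca Cb; apply/measurable_EFinP.
  apply: measurable_funS measurable_weight; first exact: open_measurable.
  exact: itv_subset_interval.
(* For [sg = - 1] time runs against the line, and the window open at [c] and closed at [d] becomes
   an interval closed on its left. *)
have [sgE|sgE] := sg1.
- have le_cd : time_inv c <= time_inv d.
    rewrite leNgt; apply/negP => /(mono Cd Cc).
    by rewrite tc td sgE !mul1r ltNge cd.
  have -> : C `&` [set x | (c < tau x <= d)%R] = `]time_inv c, time_inv d]%classic.
    apply/seteqP; split => x /=; rewrite in_itv/=.
      move=> [Cx /andP[cx xd]]; apply/andP; split.
        by apply: time_mono_inv => //; rewrite tc sgE !mul1r.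
      rewrite leNgt; apply/negP => /(mono Cd Cx).
      by rewrite td sgE !mul1r ltNge xd.
    move=> /andP[cx xd]; have Cx : C x by apply: (iC Cc Cd); rewrite (ltW cx).
    split => //; apply/andP; split.
      by have := mono Cc Cx cx; rewrite tc sgE !mul1r.
    move: xd; rewrite le_eqVlt => /predU1P[->|/(mono Cx Cd)]; first by rewrite td.
    by rewrite td sgE !mul1r => /ltW.
  rewrite integral_itv_obnd_cbnd; last first.
    apply: measurable_funS (mitv _ _ Cc Cd); first exact: measurable_itv.
    exact: subset_itv_oc_cc.
  by rewrite itv_int// tc td sgE !mul1r.
- have le_cd : time_inv d <= time_inv c.
    rewrite leNgt; apply/negP => /(mono Cc Cd).
    by rewrite tc td sgE !mulN1r ltrN2 ltNge cd.
  have -> : C `&` [set x | (c < tau x <= d)%R] = `[time_inv d, time_inv c[%classic.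
    apply/seteqP; split => x /=; rewrite in_itv/=.
      move=> [Cx /andP[cx xd]]; apply/andP; split; last first.
        by apply: time_mono_inv => //; rewrite tc sgE !mulN1r ltrN2.
      rewrite leNgt; apply/negP => /(mono Cx Cd).
      by rewrite td sgE !mulN1r ltrN2 ltNge xd.
    move=> /andP[dx xc]; have Cx : C x by apply: (iC Cd Cc); rewrite (ltW xc) dx.
    split => //; apply/andP; split.
      by have := mono Cx Cc xc; rewrite tc sgE !mulN1r ltrN2.
    move: dx; rewrite le_eqVlt => /predU1P[<-|/(mono Cd Cx)]; first by rewrite td.
    by rewrite td sgE !mulN1r ltrN2 => /ltW.
  rewrite integral_itv_bndo_bndc; last first.
    apply: measurable_funS (mitv _ _ Cd Cc); first exact: measurable_itv.
    exact: subset_itv_co_cc.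
  by rewrite itv_int// tc td sgE !mulN1r opprK addrC.
Qed.

Lemma time_range_interval : is_interval I.
Proof.
apply/connected_intervalP; apply: connected_continuous_connected.
  exact/connected_intervalP.
by apply: continuous_in_subspaceT => x /set_mem; exact: tau_continuous.
Qed.

Let weight_ge0 x : C x -> (0 <= (weight x)%:E)%E.
Proof. by move=> Cx; rewrite lee_fin invr_ge0 ltW// sgF. Qed.

Let mC : measurable C. Proof. exact: open_measurable. Qed.

Let mweightE : measurable_fun C (fun x => (weight x)%:E).
Proof. exact: (proj2 (measurable_EFinP C weight) measurable_weight). Qed.

Lemma measurable_time_preimage (A : set R) a : measurable A ->
  measurable (C `&` [set x | A (tau x - a)]).
Proof.
move=> mA.
have mt : measurable_fun C (fun x => tau x - a).
  by apply: measurable_funB => //; exact: measurable_tau.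
exact: (mt mC A mA).
Qed.

(** Lebesgue measure is an infimum over covers by half-open intervals, and [time_slab] computes the
    integral over each. They are first cut to []c, d]], because [time_slab] needs its endpoints in
    the range of [tau]. *)
Lemma time_measure_le (A : set R) a c d : I (c + a) -> I (d + a) -> c <= d ->
  A `<=` `]c, d] ->
  (\int[mu]_(x in C `&` [set x | A (tau x - a)%R]) (weight x)%:E <= mu A)%E.
Proof.
move=> Ic Id cd Acd; apply: le_ereal_inf_tmp => _ [V' [mV AV] <-]; pose V : nat -> set R := V'.
pose E k := C `&` [set x | (V k `&` `]c, d]) (tau x - a)].
have mVk k : measurable (V k).
  by have [[u v] _ VE] := mV k; rewrite /V -VE; exact: measurable_itv.
apply: (@le_trans _ _ (\sum_(k <oo) \int[mu]_(x in E k) (weight x)%:E)%E).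
  apply: (@ge0_integral_cover_le _ _ _ mu C) => //.
  - by move=> k; apply: measurable_time_preimage; exact: measurableI.
  - by move=> k x [].
  - move=> x [Cx Ax]; have [k _ Vk] := AV _ Ax.
    by exists k => //; split => //; split => //; exact: Acd.
apply: lee_nneseries => [k _ _|k _].
  by apply: integral_ge0 => x [/weight_ge0].
have [[u v] _ /= Vk] := mV k; rewrite /E /V -Vk.
have [cu|] := leP (Num.max c u) (Num.min d v); last first.
  move=> dc; rewrite (_ : C `&` _ = set0) ?integral_set0 ?wlength_ge0//.
  apply/seteqP; split => // x [Cx [/= ]]; rewrite !in_itv/= => ux cx.
  move: dc; rewrite lt_max !gt_min; lra.
move: cu; rewrite le_min !ge_max => /andP[/andP[_ ud] /andP[cv uv]].
rewrite wlength_itv_bnd//.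
have -> : C `&` [set x | (`]u, v] `&` `]c, d])%classic (tau x - a)] =
   C `&` [set x | (Num.max c u + a < tau x <= Num.min d v + a)%R].
  apply/seteqP; split => x [Cx H]; split => //; move: H; rewrite /= !in_itv/=;
    rewrite -ltrBrDr -lerBlDr gt_max le_min.
    by move=> [/andP[-> ->] /andP[-> ->]].
  by move=> /andP[/andP[-> ->] /andP[-> ->]].
have Iab (b : R) : c <= b <= d -> I (b + a).
  by move=> /andP[cb bd]; apply: (time_range_interval Ic Id); rewrite !lerD2r cb.
have := cd; rewrite time_slab; first last.
- by rewrite lerD2r le_min !ge_max cd cv ud uv.
- by apply: Iab; rewrite le_min cd cv ge_min lexx.
- by apply: Iab; rewrite ge_max cd ud le_max lexx.
move=> _; rewrite lee_fin opprD addrACA subrr addr0.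
by apply: lerB; rewrite ?ge_min ?le_max lexx orbT.
Qed.

(** [time_slab] is an equality on the whole window, so the upper bound for the complement of [A] in
    it is a lower bound for [A]. *)
Lemma time_measure_ge (A : set R) a c d : I (c + a) -> I (d + a) -> c <= d ->
  measurable A -> A `<=` `]c, d] ->
  (mu A <= \int[mu]_(x in C `&` [set x | A (tau x - a)%R]) (weight x)%:E)%E.
Proof.
move=> Ic Id cd mA Acd.
pose S (B : set R) := C `&` [set x | B (tau x - a)].
have W : S `]c, d]%classic = C `&` [set x | (c + a < tau x <= d + a)%R].
  apply/seteqP; split => x [Cx H]; split => //; move: H;
    by rewrite /= in_itv/= ltrBrDr lerBlDr.
have := time_slab Ic Id; rewrite lerD2r => /(_ cd).
rewrite -W -(setDUK Acd) (_ : S _ = S A `|` S (`]c, d] `\` A)); last first.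
  apply/seteqP; split => [x [Cx [H|H]]|x [[Cx H]|[Cx H]]].
  - by left.
  - by right.
  - by split => //; left.
  - by split => //; right.
have mW : measurable (`]c, d] `\` A) by apply: measurableD.
rewrite ge0_integral_setU; first last.
- apply/disj_setPS => x [[_ Ax] [_ [_ nAx]]]; exact: nAx.
- by move=> x [[/weight_ge0]|[/weight_ge0]].
- by apply: measurable_funS mweightE => // x [[]|[]].
- exact: measurable_time_preimage.
- exact: measurable_time_preimage.
have H := @time_measure_le (`]c, d] `\` A) a c d Ic Id cd (@subDsetl _ _ _).
have muW : (mu `]c, d]%classic = (d - c)%:E)%E.
  by rewrite lebesgue_measure_itv/= lte_fin; case: ltgtP cd => // ->; rewrite subrr.
have Afin : (mu A <= (d - c)%:E)%E.
  by rewrite -muW; apply: le_measure => //; rewrite inE.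
have Afn : mu A \is a fin_num by rewrite ge0_fin_numE// (le_lt_trans Afin)// ltry.
have DA : mu (`]c, d] `\` A) = (d - c - fine (mu A))%:E.
  have -> : mu (`]c, d] `\` A) = (mu `]c, d]%classic - mu A)%E.
    have Woo : (mu `]c, d]%classic < +oo)%E by rewrite muW ltry.
    by have := @measureD _ _ R mu _ _ (measurable_itv `]c, d]) mA Woo; rewrite (setIidr Acd).
  by rewrite muW -{1}(fineK Afn) -EFinB.
move: H; rewrite -/(S _) DA => H /eqP.
rewrite eq_le => /andP[_]; rewrite opprD addrACA subrr addr0 => E.
have {}E := le_trans E (leeD2l _ H).
rewrite -(fineK Afn); move: E; case: (integral _ _ _) => [r| |] //=.
  by rewrite -EFinD !lee_fin; lra.
by move=> _; rewrite leey.
Qed.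

(* The window may leave the range of [tau] on the left. *)
Lemma time_slab_le c d : I d -> c <= d ->
  (\int[mu]_(x in C `&` [set x | (c < tau x <= d)%R]) (weight x)%:E
    <= (d - c)%:E)%E.
Proof.
move=> Id cd; have [Ic|nIc] := pselect (I c); first by rewrite time_slab.
have cI y : I y -> c < y.
  move=> Iy; rewrite ltNge; apply/negP => yc; apply: nIc.
  by apply: (time_range_interval Iy Id); rewrite yc cd.
have infI : has_inf I.
  by split; [exists d|exists c => y /cI/ltW].
have infle y : I y -> inf I <= y by move=> Iy; apply: ge_inf => //; case: infI.
have inflt y : I y -> inf I < y.
  move=> Iy; have [e /= e0 He] := (@nbhs_ballP _ _ _ _).1 (oI Iy).
  have e20 : 0 < e / 2 by rewrite divr_gt0.
  apply: (@le_lt_trans _ _ (y - e / 2)); last by rewrite ltrBlDr ltrDl.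
  apply/infle/He; rewrite /ball /= opprB addrC subrK gtr0_norm//.
  by rewrite ltr_pdivrMr// mulr_natr mulr2n ltrDl.
have cinf : c <= inf I by apply: lb_le_inf; [exists d|move=> y /cI/ltW].
(* Starting times in the range that decrease to [inf I]. The range is open, so its infimum is not
   attained and the slabs from [s n] exhaust the window. *)
pose s n := inf I + (d - inf I) * n.+1%:R^-1.
have ld : 0 < d - inf I by rewrite subr_gt0 inflt.
have sd n : s n <= d by rewrite /s -lerBrDl ler_piMr ?(ltW ld)// invf_le1// ler1n.
have sI n : I (s n).
  have [|y Iy ys] := @inf_adherent _ I ((d - inf I) * n.+1%:R^-1) _ infI.
    by rewrite mulr_gt0// invr_gt0.
  by apply: (time_range_interval Iy Id); rewrite (ltW ys) sd.
pose S n := C `&` [set x | s n < tau x <= d].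
have SD : \bigcup_n S n = C `&` [set x | c < tau x <= d].
  apply/seteqP; split => [x [n _ [Cx /andP[sx xd]]]|x [Cx /andP[cx xd]]].
    by split => //; apply/andP; split => //; exact: lt_trans (cI _ (sI n)) sx.
  have xl : 0 < (tau x - inf I) / (d - inf I).
    by rewrite divr_gt0// subr_gt0; apply: inflt; exists x.
  have [n _ /(_ n (leqnn n)) /= nx] := near_infty_natSinv_lt (PosNum xl).
  exists n => //; split => //; apply/andP; split => //.
  by rewrite /s -ltrBrDl mulrC -ltr_pdivlMr.
have mS n : measurable (S n).
  have -> : S n = C `&` [set x | `]s n, d]%classic (tau x - 0)].
    by apply/seteqP; split => x [Cx H]; split => //; move: H;
      rewrite /= in_itv/= subr0.
  exact: measurable_time_preimage.
have ndS : nondecreasing_seq S.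
  apply/nondecreasing_seqP => n; apply/subsetPset => x [Cx /andP[sx xd]].
  split => //; rewrite /mkset xd andbT; apply: le_lt_trans sx.
  by rewrite /s lerD2l ler_pM2l// lef_pV2 ?posrE// ler_nat.
have SC n : S n `<=` C by move=> x [].
have : (\int[mu]_(x in S i) (weight x)%:E @[i --> \oo] -->
        \int[mu]_(x in \bigcup_i S i) (weight x)%:E)%E.
  apply: ge0_nondecreasing_set_cvg_integral => //.
    by move=> n; exact: measurable_funS (SC n) mweightE.
  by move=> n x /(SC n)/weight_ge0.
rewrite SD => /cvg_lim <-//; apply: lime_le.
  apply: ereal_nondecreasing_is_cvgn; apply/nondecreasing_seqP => n.
  apply: ge0_subset_integral_any => [x|x [/weight_ge0]//].
  by move: x; apply/subsetPset; exact: ndS.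
apply: nearW => n; rewrite [leLHS](time_slab (sI n) Id (sd n)) lee_fin lerD2l lerN2.
by apply: le_trans cinf _; rewrite lerDl mulr_ge0// ltW.
Qed.

End time_change.

(** * Admissibility as a one-sided comparison along orbits *)

Section component_weight.
Context {R : realType}.
Notation mu := (@lebesgue_measure R).
Variables (p : R) (Omega : set R) (F : R -> R) (h : R -> R[i])
  (J : R -> set R) (phi : R -> R -> R) (rho : R -> R).
Hypotheses (Omega_open : open Omega) (F_C1 : is_C1_on Omega F)
  (h_cont : forall x, Omega x -> {for x, continuous (h : R -> R[i]^o)})
  (phi_flow : is_flow Omega F J phi) (Omega_fwd : forward_invariant Omega J)
  (rho_adm : p_admissible Omega p rho F h phi).
Implicit Types (x y t s : R).
Let U := Omega `\` zeros Omega F.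
Variables (z x0 sg : R).
Hypothesis rho_gt0 : forall x, Omega x -> 0 < rho x.
Let C := connected_component U z.
Hypotheses (Cx0 : C x0) (sgF : forall x, C x -> 0 < sg * F x).

Let CO x : C x -> Omega x. Proof. by move=> /connected_component_sub[]. Qed.

(** An orbit moves with velocity [F], so along it the derivative of [ln |F|] is [derive1 F]. *)
Lemma derivative_integral_flow x t : C x -> 0 <= t ->
  expR (\int[mu]_(s in `[0, t]) derive1 F (phi s x)) =
  (sg * F (phi t x)) / (sg * F x).
Proof.
move=> Cx t0; have Ox := CO Cx.
have Cs s : 0 <= s -> C (phi s x).
  by move=> s0; exact: (component_flow phi_flow Omega_fwd Cx).
have -> : \int[mu]_(s in `[0, t]) derive1 F (phi s x) =
    ln (sg * F (phi t x)) - ln (sg * F (phi 0 x)).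
  apply: (@Rintegral_FTC2 _ (fun s => ln (sg * F (phi s x)))) => // s /andP[s0 _].
    have Fs := sgF (Cs _ s0).
    have dF : is_derive (phi s x) 1 F (derive1 F (phi s x)).
      by rewrite derive1E; apply: derivableP; exact: (F_C1 (CO (Cs _ s0))).1.
    have dsF : is_derive (phi s x) 1 (fun y => sg * F y) (sg * derive1 F (phi s x)).
      exact: is_deriveZ.
    have dl := is_derive1_comp (g := fun y => sg * F y) (is_derive1_ln Fs) dsF.
    have := is_derive1_comp (g := phi ^~ x) dl (flow_is_derive phi_flow Omega_fwd Ox s0).
    rewrite (_ : _ * _ * _ = derive1 F (phi s x))//.
    move: Fs; rewrite lt0r mulf_eq0 negb_or => /andP[/andP[sn Fn] _].
    by field; rewrite sn Fn.
  apply: (flow_comp_continuous phi_flow Omega_fwd) => //.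
  exact: (F_C1 (CO (Cs _ s0))).2.
have s0 := sgF Cx; have st := sgF (Cs _ t0).
by rewrite (flow_initial phi_flow Ox) -ln_div ?posrE// lnK// posrE divr_gt0.
Qed.

Let E := log_growth F h x0.
(** The density of sigma with respect to [d tau]. *)
Let v x := expR (- p * E x) * rho x * (sg * F x).

(** With the cocycle written as a quotient of growths and [derivative_integral_flow], admissibility
    reads [v x <= M * expR (kappa * t) * v (phi t x)]. Since [kappa] may be negative, the constant
    uniform over [[0, T]] uses [|kappa|]. *)
Lemma weight_flow (T : R) : exists2 K : R, 0 < K &
  forall x t, C x -> 0 <= t <= T -> v x <= K * v (phi t x).
Proof.
have [M [kappa [M1 adm]]] := rho_adm.
have M0 : 0 < M by exact: lt_le_trans M1.
exists (M * expR (`|kappa| * T)); first by rewrite mulr_gt0 ?expR_gt0.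
move=> x t Cx /andP[t0 tT]; have := adm t x t0 (CO Cx).
have Ct := component_flow phi_flow Omega_fwd Cx t0.
rewrite derivative_integral_flow//.
have cE : cabs (cocycle phi h t x) = expR (E (phi t x) - E x).
  have := growth_flow Omega_open F_C1 phi_flow Omega_fwd h_cont Cx0 Cx t0.
  move=> /(congr1 cabs); rewrite cabsM (cabs_growth F h x0 (phi t x)) (cabs_growth F h x0 x) => H.
  by rewrite expRD expRN mulrC -/E H mulKf// gt_eqF// expR_gt0.
rewrite cE -expRM => H.
have Fx := sgF Cx; have Ft := sgF Ct.
have Ept := expR_gt0 (- p * E (phi t x)).
have W := mulr_gt0 Ept Fx.
rewrite -(ler_pM2l W) in H.
have -> : v x = expR (- p * E (phi t x)) * (sg * F x) *
    (expR ((E (phi t x) - E x) * p) * rho x).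
  rewrite /v (_ : - p * E x = - p * E (phi t x) + (E (phi t x) - E x) * p).
    by rewrite expRD; ring.
  by ring.
apply: (le_trans H).
have -> : expR (- p * E (phi t x)) * (sg * F x) *
   (M * expR (kappa * t) * rho (phi t x) * (sg * F (phi t x) / (sg * F x))) =
   M * expR (kappa * t) * v (phi t x).
  rewrite /v; field.
  by move: Fx; rewrite lt0r mulf_eq0 negb_or => /andP[/andP[-> ->]].
rewrite ler_pM2r; last first.
  rewrite mulr_gt0// mulr_gt0//. exact: rho_gt0 (CO Ct).
rewrite ler_pM2l// ler_expR (le_trans (ler_norm _))// normrM (ger0_norm t0).
exact: ler_wpM2l.
Qed.

End component_weight.

Lemma countable_enumeration (K : countType) : exists e : nat -> option K,
  (forall k, exists n, e n = Some k) /\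
  forall i j k, e i = Some k -> e j = Some k -> i = j.
Proof.
exists (@pickle_inv K); split=> [k|i j k ik jk].
  by exists (pickle k); exact: pickleK_inv.
have := @pickle_invK K i; have := @pickle_invK K j.
by rewrite ik jk => /= <- <-.
Qed.

(** * A periodic function on one component *)

Section periodic_component.
Context {R : realType}.
Notation mu := (@lebesgue_measure R).
Notation L := (lebesgue_type R).
Variables (p : R) (Omega : set R) (F : R -> R) (h : R -> R[i])
  (J : R -> set R) (phi : R -> R -> R) (rho : R -> R).
Hypotheses (p_gt0 : 0 < p) (Omega_open : open Omega) (F_C1 : is_C1_on Omega F)
  (h_cont : forall x, Omega x -> {for x, continuous (h : R -> R[i]^o)})
  (phi_flow : is_flow Omega F J phi) (Omega_fwd : forward_invariant Omega J)
  (rho_meas : lebesgue_measurable_fun Omega rho)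
  (rho_gt0 : forall x, Omega x -> 0 < rho x)
  (rho_adm : p_admissible Omega p rho F h phi).
Implicit Types (x y t s q r : R).
Let U := Omega `\` zeros Omega F.
Variables (z x0 : R).
Let C := connected_component U z.
Hypothesis Cx0 : C x0.
Variables (f : R -> R[i]) (T : R).
Hypotheses (fL : in_Lp Omega p rho f) (T_gt0 : 0 < T)
  (f_periodic : ae_eq (leb R) Omega (semigroup_op phi h T f) f)
  (f_neq0 : leb R (C `&` [set x | f x != 0]) <> 0%E).

Let CO x : C x -> Omega x. Proof. by move=> /connected_component_sub[]. Qed.
Let oC : open C. Proof. exact: (component_open Omega_open F_C1). Qed.
Let iC : is_interval C. Proof. exact: component_interval. Qed.
Let mO : measurable (Omega : set L).
Proof. by apply: borel_leb; exact: open_measurable. Qed.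
Let mCB : measurable C. Proof. exact: open_measurable. Qed.
Let mC : measurable (C : set L). Proof. exact: borel_leb. Qed.

Let tau := flow_time F x0.
Let I : set R := tau @` C.
Let E := growth F h x0.
Let lE := log_growth F h x0.
Let G x : R := cabs (E x * f x).
Let sigma x : R := expR (- p * lE x) * rho x.

Let sigma_gt0 x : C x -> 0 < sigma x.
Proof. by move=> Cx; rewrite mulr_gt0 ?expR_gt0 ?rho_gt0//; exact: CO. Qed.

Let measurable_sigma : measurable_fun (C : set L) sigma.
Proof.
apply: measurable_funM; last exact: (measurable_funS mO (fun x => @CO x) rho_meas).
apply: (measurable_fun_borel_leb mCB); apply: (measurableT_comp (f := expR)) => //.
apply: measurable_funM; first exact: measurable_cst.
exact: (measurable_log_growth Omega_open F_C1 h_cont Cx0).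
Qed.

Let cmeasurable_f : cmeasurable (C : set L) f.
Proof.
have [f1 f2 _] := fL.
by split; [exact: (measurable_funS mO (fun x => @CO x) f1)|
  exact: (measurable_funS mO (fun x => @CO x) f2)].
Qed.

Let cmeasurable_E : cmeasurable (C : set L) E.
Proof.
have [m1 m2] := measurable_growth Omega_open F_C1 h_cont Cx0.
by split; exact: (measurable_fun_borel_leb mCB).
Qed.

Let powR_G x : cabs (f x) `^ p * rho x = G x `^ p * sigma x.
Proof.
rewrite /G /sigma cabsM powRM ?cabs_ge0// (cabs_growth F h x0 x) -expRM.
have -> : - p * lE x = - (lE x * p) by ring.
rewrite expRN; set e := expR _; have e0 : e != 0 by rewrite gt_eqF ?expR_gt0.
by field.
Qed.

Let tau_flow x t : C x -> 0 <= t -> tau (phi t x) = tau x + t.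
Proof. exact: (flow_time_flow Omega_open F_C1 phi_flow Omega_fwd Cx0). Qed.

Let C_flow x t : C x -> 0 <= t -> C (phi t x).
Proof. exact: (component_flow phi_flow Omega_fwd). Qed.

Let I_add r t : I r -> 0 <= t -> I (r + t).
Proof.
move=> [x Cx <-] t0; exists (phi t x); [exact: C_flow|exact: tau_flow].
Qed.

Variable sg : R.
Hypotheses (sg1 : sg = 1 \/ sg = -1) (sgF : forall x, C x -> 0 < sg * F x).

Let dtau x : C x -> is_derive x 1 tau (F x)^-1.
Proof. exact: (flow_time_is_derive Omega_open F_C1 Cx0). Qed.
Let cF x : C x -> {for x, continuous F}.
Proof. by move=> /CO; exact: (field_continuous F_C1). Qed.
Let mono x y : C x -> C y -> x < y -> sg * tau x < sg * tau y.
Proof. exact: (flow_time_mono Omega_open F_C1 Cx0 sgF). Qed.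

Let u := time_inv C tau.
Let uP r : I r -> C (u r) /\ tau (u r) = r. Proof. exact: time_invP. Qed.

Let u_flow r t : I r -> 0 <= t -> u (r + t) = phi t (u r).
Proof.
move=> Ir t0; have [Cu tu] := uP Ir; have [Cv tv] := uP (I_add Ir t0).
apply: (time_inj mono) => //; first exact: C_flow.
by rewrite tv tau_flow// tu.
Qed.

Let w x : R := (sg * F x)^-1.
Let w_ge0 x : C x -> 0 <= w x.
Proof. by move=> /sgF Fx; rewrite invr_ge0 ltW. Qed.

Let measurable_w : measurable_fun C w.
Proof.
apply: open_continuous_measurable_fun => // y /set_mem Cy.
apply: cvgV; first by rewrite gt_eqF// sgF.
by apply: cvgM; [exact: cvg_cst|exact: cF].
Qed.

Let v x := sigma x * (sg * F x).
Let sigmaE x : C x -> sigma x = v x * w x.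
Proof. by move=> /sgF Fx; rewrite /v /w mulfK// gt_eqF. Qed.

Let mG : measurable_fun (C : set L) G.
Proof.
by apply: measurable_cabs; exact: cmeasurableM cmeasurable_E cmeasurable_f.
Qed.

(** The sets where [G] exceeds [1 / (n + 1)] cover the support of [f] in [C], so one of them is not
    null; a Borel part of it is kept. *)
Let large_growth : exists2 delta : R, 0 < delta & exists B : set R,
  [/\ measurable B, mu B <> 0%E & forall x, B x -> C x /\ delta < G x].
Proof.
pose S n : set L := C `&` G @^-1` `]n.+1%:R^-1, +oo[.
have mS n : measurable (S n) by apply: mG => //; exact: measurable_itv.
have US : C `&` [set x | f x != 0] `<=` \bigcup_n S n.
  move=> x [Cx fx]; have Gx : 0 < G x.
    by rewrite cabs_gt0 mulf_neq0// growth_neq0.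
  have [n _ /(_ n (leqnn n)) /= nx] := near_infty_natSinv_lt (PosNum Gx).
  by exists n => //; split => //=; rewrite in_itv/= andbT.
have [n Sn0] : exists n, leb R (S n) <> 0%E.
  apply: bigcup_measure_neq0 => // S0; apply: f_neq0.
  exact: (leb_null_sub (bigcupT_measurable _ mS) S0 US).2.
have [B [mB B0] BS] := leb_borel_subset (mS n) Sn0.
exists n.+1%:R^-1; first by rewrite invr_gt0.
exists B; split => // x /BS[Cx] /=.
by rewrite in_itv/= andbT.
Qed.

Let growth_invariant : exists N : set R,
  [/\ measurable N, mu N = 0%E &
      forall x, C x -> ~ N x -> G (phi T x) = G x].
Proof.
have [N' [mN' N'0 HN]] := f_periodic.
have [N [mN N0] N'N] := leb_null_borel_cover N'0.
exists N; split; [exact: mN|exact: N0|move=> x Cx Nx].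
have : semigroup_op phi h T f x = f x.
  by apply: contrapT => fx; apply/Nx/N'N/HN => /(_ (CO Cx)).
rewrite /semigroup_op => fx.
have := growth_flow Omega_open F_C1 phi_flow Omega_fwd h_cont Cx0 Cx (ltW T_gt0).
by rewrite /G -/E => ->; rewrite -mulrA fx.
Qed.

Let oI : open I. Proof. by have := time_open_map oC sg1 dtau mono openT; rewrite setTI. Qed.

(** Countably many windows of length [T], with rational left ends in the range, cover the component,
    so one of them charges [B]. *)
Let charged_window (B : set R) : measurable B -> mu B <> 0%E -> B `<=` C ->
  exists2 q, I q & mu (B `&` [set x | q < tau x <= q + T]) <> 0%E.
Proof.
move=> mB B0 BC.
pose q n : R := nth_rat n.
pose S n := B `&` [set x | I (q n) /\ q n < tau x <= q n + T].
have mS n : measurable (S n).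
  have [Iq|Iq] := pselect (I (q n)); last first.
    by rewrite (_ : S n = set0)//; apply/seteqP; split => // x [_ []].
  have -> : S n = B `&` (C `&` [set x | `]q n, q n + T]%classic (tau x - 0)]).
    apply/seteqP; split => [x [Bx [_ xq]]|x [Bx [_]]] /=; rewrite /= in_itv/= subr0.
      by split => //; split; [exact: BC|].
    by move=> xq.
  apply: measurableI => //.
  apply: (measurable_time_preimage oC dtau); exact: measurable_itv.
have US : B `<=` \bigcup_n S n.
  move=> x Bx; have Cx := BC _ Bx; have Ix : I (tau x) by exists x.
  have [e /= e0 He] := (@nbhs_ballP _ _ _ _).1 (oI Ix).
  (* A rational slightly before [tau x]: within [e], to lie in the open range, and within [T], so
     that its window contains [tau x]. *)
  have me : 0 < Num.min e T by rewrite lt_min e0.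
  have : tau x - Num.min e T < tau x by rewrite ltrBlDr ltrDl.
  move=> /rat_in_itvoo[r]; rewrite in_itv/= => /andP[].
  rewrite ltrBlDr => Hr rx.
  exists (pickle r) => //; split => //.
  have -> : q (pickle r) = ratr r by rewrite /q /nth_rat pickleK.
  have [re rT] : tau x < ratr r + e /\ tau x < ratr r + T.
    by move: Hr; rewrite addr_minr lt_min => /andP[].
  split; last by rewrite rx ltW.
  apply: He; rewrite /ball /= ger0_norm ?subr_ge0 ?ltW//.
  by rewrite ltrBlDr addrC.
have [n Sn0] : exists n, mu (S n) <> 0%E.
  apply: bigcup_measure_neq0 => // S0; apply: B0.
  apply/eqP; rewrite eq_le measure_ge0 andbT -S0.
  by apply: le_measure; rewrite ?inE//; exact: bigcupT_measurable.
have [Iq|Iq] := pselect (I (q n)).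
  exists (q n) => //; rewrite (_ : _ `&` _ = S n)//.
  by apply/seteqP; split => x [Bx]; [split|move=> [_]].
by case: Sn0; rewrite (_ : S n = set0) ?measure0//; apply/seteqP; split => // x [_ []].
Qed.

(** If [A] were null, [time_measure_le] would make the integral of a positive weight vanish over a
    set of positions that is not null. *)
Let window_transport (q : R) (B : set R) : I q -> measurable B ->
  mu (B `&` [set x | q < tau x <= q + T]) <> 0%E -> B `<=` C ->
  let A := `]q, q + T]%classic `&` u @^-1` B in
  measurable A /\ mu A <> 0%E.
Proof.
move=> Iq mB B0 BC A.
have WI : `]q, q + T]%classic `<=` I.
  move=> r /=; rewrite in_itv/= => /andP[qr _].
  by rewrite -(subrK q r) addrC; apply: I_add => //; rewrite subr_ge0 ltW.
have mu_ := measurable_time_inv oC sg1 dtau mono.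
have mA : measurable A.
  by apply: (measurable_funS (open_measurable oI) WI mu_).
split => // A0; apply: B0.
set S := B `&` _.
have IqT : I (q + T) by apply: I_add => //; exact: ltW.
have mS : measurable S.
  have -> : S = B `&` (C `&` [set x | `]q, q + T]%classic (tau x - 0)]).
    apply/seteqP; split => [x [Bx xq]|x [Bx [_]]] /=; rewrite /= in_itv/= subr0.
      by split => //; split; [exact: BC|].
    by move=> xq.
  apply: measurableI => //.
  apply: (measurable_time_preimage oC dtau); exact: measurable_itv.
apply: contrapT => S0.
have SC : S `<=` C by move=> x [/BC].
have w0 x : S x -> 0 < w x by move=> /SC/sgF Fx; rewrite invr_gt0.
have : (0 < \int[mu]_(x in S) (w x)%:E)%E.
  apply: integral_pos_gt0 => //; exact: (measurable_funS mCB SC measurable_w).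
apply/negP; rewrite -leNgt -A0.
have := @time_measure_le _ C tau F sg oC iC sg1 sgF dtau cF mono A 0 q (q + T).
rewrite !addr0 => /(_ Iq IqT); rewrite lerDl => /(_ (ltW T_gt0) (@subIsetl _ _ _)).
apply: le_trans; apply: ge0_subset_integral_any.
  move=> x [Bx xq]; have Cx := BC _ Bx; split => //=; rewrite subr0.
  by split; [rewrite /= in_itv|rewrite /preimage /= /u (time_invK mono Cx)].
by move=> x [Cx _]; rewrite lee_fin; exact: w_ge0.
Qed.

(** By [time_measure_ge], whose parameter [a] absorbs the shift by [k], the measure of [A] is at
    most the integral of the weight over a null set. *)
Let null_transport (q k : R) (N : set R) : I q -> I (q + k) -> measurable N ->
  mu N = 0%E ->
  let A := `]q, q + T]%classic `&` [set r | N (u (r + k))] in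
  measurable A /\ mu A = 0%E.
Proof.
move=> Iq Iqk mN N0 A.
have WI : `]q, q + T]%classic `<=` [set r | I (r + k)].
  move=> r /=; rewrite in_itv/= => /andP[qr _].
  rewrite -(subrK q r) addrAC (_ : r - q + k + q = (q + k) + (r - q)); last by ring.
  by apply: I_add => //; rewrite subr_ge0 ltW.
have mu_ := measurable_time_inv oC sg1 dtau mono.
have muk : measurable_fun `]q, q + T]%classic (fun r => u (r + k)).
  apply: (measurable_comp (open_measurable oI) _ mu_).
    by move=> _ [r /WI Ir <-].
  by apply: measurable_funD; [exact: measurable_id|exact: measurable_cst].
have mA : measurable A by exact: muk.
split => //; apply/eqP; rewrite eq_le measure_ge0 andbT.
have IqT : I (q + T + k) by rewrite addrAC; apply: I_add => //; exact: ltW.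
have qT : q <= q + T by rewrite lerDl ltW.
have := @time_measure_ge _ C tau F sg oC iC sg1 sgF dtau cF mono A k q (q + T)
  Iqk IqT qT mA (@subIsetl _ _ _).
move=> /le_trans; apply.
have mNC : measurable (N `&` C) by exact: measurableI.
have NC0 : mu (N `&` C) = 0%E.
  apply/eqP; rewrite eq_le measure_ge0 andbT -N0.
  by apply: le_measure; rewrite ?inE// => x [].
have wNC x : (N `&` C) x -> (0 <= (w x)%:E)%E by move=> [_ /w_ge0].
have <- : (\int[mu]_(x in N `&` C) (w x)%:E = 0)%E.
  by apply: ge0_integral_null.
apply: ge0_subset_integral_any => //.
by move=> x [Cx [_ /=]]; rewrite subrK /u (time_invK mono Cx).
Qed.

Let shift (k : int) : R := k%:~R * T.

Let shiftD (k : int) (n : nat) : shift (k + n%:Z) = shift k + n%:R * T.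
Proof. by rewrite /shift intrD mulrDl. Qed.

Let I_shift q (k : int) (n : nat) : I (q + shift k) -> I (q + shift (k + n%:Z)).
Proof.
by move=> Iq; rewrite shiftD addrA; apply: I_add => //; rewrite mulr_ge0// ltW.
Qed.

(* A set of times [B1] of positive measure along whose translates by periods
   [G] stays bounded below. *)
Let good_times : exists delta q : R, exists B1 : set R,
  [/\ 0 < delta, I q, measurable B1, B1 `<=` `]q, q + T]%classic &
      mu B1 <> 0%E /\
      forall (k : int) r, I (q + shift k) -> B1 r -> delta < G (u (r + shift k))].
Proof.
have [delta d0 [B [mB B0 BG]]] := large_growth.
have BC : B `<=` C by move=> x /BG[].
have [q Iq Bq0] := charged_window mB B0 BC.
have [mA A0] := window_transport Iq mB Bq0 BC.
set A := _ `&` _ in mA A0.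
have [N [mN N0 NG]] := growth_invariant.
(* Times of the base window whose translate by [k] periods meets the exceptional set of the
   periodicity. There are countably many [k], so removing all of them costs a null set. *)
pose bad (k : int) := `]q, q + T]%classic `&` [set r | N (u (r + shift k))].
have [e [eS _]] := countable_enumeration int.
pose badn n := if e n is Some k then
  (if pselect (I (q + shift k)) then bad k else set0) else set0.
have mbad n : measurable (badn n) /\ mu (badn n) = 0%E.
  rewrite /badn; case: (e n) => [k|]; last by rewrite measure0.
  case: pselect => [Iqk|nI] /=; last by split => //; exact: measure0.
  exact: null_transport.
exists delta, q, (A `\` \bigcup_n badn n).
have mU : measurable (\bigcup_n badn n).
  by apply: bigcupT_measurable => n; exact: (mbad n).1.
have U0 : mu (\bigcup_n badn n) = 0%E.
  apply: contrapT => H; have [n Hn] : exists n, mu (badn n) <> 0%E.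
    by apply: bigcup_measure_neq0 => // n; exact: (mbad n).1.
  by apply: Hn; exact: (mbad n).2.
split => //.
- exact: measurableD.
- by move=> x [[]].
have Wq r : `]q, q + T]%classic r -> 0 <= r - q.
  by rewrite /= in_itv/= => /andP[/ltW]; rewrite subr_ge0.
have Ir r (k : int) : `]q, q + T]%classic r -> I (q + shift k) -> I (r + shift k).
  move=> /Wq qr Iqk; rewrite -(subrK q r) addrAC.
  by rewrite (_ : _ + q = q + shift k + (r - q)); [exact: I_add|ring].
split.
  move=> D0; apply: A0; apply/eqP; rewrite eq_le measure_ge0 andbT.
  have <- : (mu (A `\` \bigcup_n badn n) + mu (\bigcup_n badn n) = 0)%E.
    by rewrite D0 U0 adde0.
  apply: (@le_trans _ _ (mu ((A `\` \bigcup_n badn n) `|` \bigcup_n badn n))).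
    apply: le_measure; rewrite ?inE//.
      by apply: measurableU => //; exact: measurableD.
    by move=> x Ax; have [|] := pselect ((\bigcup_n badn n) x); [right|left].
  by apply: measureU2 => //; exact: measurableD.
have step (k : int) r : I (q + shift k) -> (A `\` \bigcup_n badn n) r ->
    G (u (r + shift (k + 1))) = G (u (r + shift k)).
  move=> Iqk [[Wr _] nb].
  have Irk : I (r + shift k) by exact: Ir.
  have -> : r + shift (k + 1) = r + shift k + T.
    by rewrite (shiftD k 1) mul1r addrA.
  rewrite (u_flow Irk (ltW T_gt0)); apply: NG; first by case: (uP Irk).
  move=> NN; apply: nb; have [n en] := eS k; exists n => //.
  by rewrite /badn en; case: pselect.
have steps (n : nat) (k : int) r : I (q + shift k) ->
    (A `\` \bigcup_n badn n) r -> G (u (r + shift (k + n%:Z))) = G (u (r + shift k)).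
  move=> Iqk Br; elim: n => [|n IH]; first by rewrite addr0.
  rewrite -IH -addn1 PoszD addrA; apply: step Br; exact: I_shift.
have G0 r : (A `\` \bigcup_n badn n) r -> delta < G (u (r + shift 0)).
  by move=> [[_ Br] _]; rewrite /shift mul0r addr0; exact: (BG _ Br).2.
have Iq0 : I (q + shift 0) by rewrite /shift mul0r addr0.
(* The range is closed only under forward time, so for negative [k] the [n + 1] steps lead from [k]
   up to 0 and the equality is read backwards. *)
move=> [n|n] r Iqk Br.
  by have := steps n 0 r Iq0 Br; rewrite add0r => ->; exact: G0.
have := steps n.+1 _ r Iqk Br; rewrite NegzE addNr => <-; exact: G0.
Qed.

Let weightK : exists2 K : R, 0 < K & forall x y, C x -> C y ->
  tau x <= tau y <= tau x + (T + T) -> v x <= K * v y.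
Proof.
have [K K0 HK] := weight_flow Omega_open F_C1 h_cont phi_flow Omega_fwd rho_adm
  rho_gt0 Cx0 sgF (T + T).
exists K => // x y Cx Cy /andP[xy yx].
have t0 : 0 <= tau y - tau x by rewrite subr_ge0.
have <- : phi (tau y - tau x) x = y.
  apply: (time_inj mono) => //; first exact: C_flow.
  by rewrite tau_flow// addrC subrK.
by apply: HK => //; rewrite t0 lerBlDl.
Qed.

Let v_gt0 x : C x -> 0 < v x.
Proof. by move=> Cx; rewrite mulr_gt0 ?sigma_gt0 ?sgF. Qed.

Let f_ge0 x : C x -> (0 <= (cabs (f x) `^ p * rho x)%:E)%E.
Proof.
by move=> /CO Ox; rewrite lee_fin mulr_ge0 ?powR_ge0// ltW// rho_gt0.
Qed.

Let measurable_f : measurable_fun (C : set L) (fun x => (cabs (f x) `^ p * rho x)%:E).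
Proof.
apply/measurable_EFinP; apply: measurable_funM.
  exact: measurable_powR_cabs.
exact: (measurable_funS mO (fun x => @CO x) rho_meas).
Qed.

Let weight_integral (D : set R) (c : R) : measurable D -> D `<=` C -> 0 <= c ->
  (\int[leb R]_(x in D) (c * w x)%:E = c%:E * \int[mu]_(x in D) (w x)%:E)%E.
Proof.
move=> mD DC c0.
have w0 x : D x -> (0 <= (w x)%:E)%E by move=> /DC/w_ge0.
have mw : measurable_fun D (fun x => (w x)%:E).
  exact: (proj2 (measurable_EFinP D w) (measurable_funS mCB DC measurable_w)).
rewrite -(leb_integral_borel mD mw w0).
have mwL := measurable_fun_borel_leb mD mw.
have H := ge0_integralZl_EFin (leb R) (borel_leb mD) w0 mwL c0.
rewrite -H; apply: eq_integral => x _.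
by rewrite EFinM.
Qed.

(** The window ends at [q + shift k], where [image] begins. [weightK] bounds [v] at an earlier time
    by [v] at a later one, so it applies from the window to this time and from there to the
    image. *)
Let window q (k : int) : set R :=
  C `&` [set x | q + shift k - T < tau x <= q + shift k].

Let measurable_window q k : measurable (window q k).
Proof.
have -> : window q k =
    C `&` [set x | `]q + shift k - T, q + shift k]%classic (tau x - 0)].
  by apply/seteqP; split => x [Cx H]; split => //; move: H;
    rewrite /= in_itv/= subr0.
apply: (measurable_time_preimage oC dtau); exact: measurable_itv.
Qed.

Let window_integral_le (K q : R) (k : int) : 0 < K ->
  (forall x y, C x -> C y -> tau x <= tau y <= tau x + (T + T) -> v x <= K * v y) ->
  I (q + shift k) ->
  (\int[leb R]_(x in window q k) (sigma x)%:E <=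
   (K * v (u (q + shift k)) * T)%:E)%E.
Proof.
move=> K0 HK Iqk; have [Cy ty] := uP Iqk.
have WC : window q k `<=` C by move=> x [].
have c0 : 0 <= K * v (u (q + shift k)) by rewrite mulr_ge0// ltW// v_gt0.
apply: (@le_trans _ _ (\int[leb R]_(x in window q k)
    (K * v (u (q + shift k)) * w x)%:E)%E).
  apply: ge0_le_integral_any => // x.
  - by move=> /WC/sigma_gt0/ltW.
  - by move=> /WC/w_ge0 w0; rewrite lee_fin mulr_ge0.
  - move=> [Cx /andP[xq qx]] _; rewrite lee_fin sigmaE// ler_wpM2r ?w_ge0//.
    apply: HK => //; rewrite ty qx/=.
    have := T_gt0; move: xq; lra.
rewrite weight_integral// (EFinM _ T); apply: lee_wpmul2l; first by rewrite lee_fin.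
(* The window may reach back beyond the start of the range of [tau], hence an inequality in place of
   [time_slab]. *)
have := @time_slab_le _ C tau F sg oC iC sg1 sgF dtau cF mono
  (q + shift k - T) (q + shift k) Iqk.
rewrite gerDl oppr_le0 => /(_ (ltW T_gt0)).
by have -> : q + shift k - (q + shift k - T) = T by ring.
Qed.

Let image q (B : set R) (k : int) : set R :=
  C `&` [set x | B (tau x - shift k)].

Let image_integral_ge (K q delta : R) (B : set R) (k : int) : 0 < K ->
  (forall x y, C x -> C y -> tau x <= tau y <= tau x + (T + T) -> v x <= K * v y) ->
  0 < delta -> measurable B -> B `<=` `]q, q + T]%classic ->
  (forall r, B r -> delta < G (u (r + shift k))) ->
  I q -> I (q + shift k) ->
  ((delta `^ p * (v (u (q + shift k)) / K))%:E * mu B <=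
   \int[leb R]_(x in image q B k) (cabs (f x) `^ p * rho x)%:E)%E.
Proof.
move=> K0 HK d0 mB BW BG Iq Iqk; have [Cy ty] := uP Iqk.
set c := delta `^ p * _.
have c0 : 0 <= c by rewrite mulr_ge0 ?powR_ge0// divr_ge0 ?(ltW K0)// ltW// v_gt0.
have QC : image q B k `<=` C by move=> x [].
have mQ : measurable (image q B k) by exact: (measurable_time_preimage oC dtau).
apply: (@le_trans _ _ (\int[leb R]_(x in image q B k) (c * w x)%:E)%E); last first.
  apply: ge0_le_integral_any => // x.
  - by move=> /QC/w_ge0 w0; rewrite lee_fin mulr_ge0.
  - by move=> /QC/f_ge0.
  - move=> [Cx Bx] _; rewrite lee_fin powR_G sigmaE// mulrA.
    rewrite ler_wpM2r ?w_ge0//; apply: ler_pM; rewrite ?powR_ge0//.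
    + by rewrite divr_ge0 ?(ltW K0)// ltW// v_gt0.
    + apply: (ge0_ler_powR (ltW p_gt0)); rewrite ?nnegrE ?cabs_ge0 ?(ltW d0)//.
      by have := BG _ Bx; rewrite subrK /u (time_invK mono Cx) => /ltW.
    + rewrite ler_pdivrMr// mulrC; apply: HK => //; rewrite ty.
      have := BW _ Bx; rewrite /= in_itv/= => /andP[qx xq].
      have := T_gt0; move: qx xq; lra.
rewrite weight_integral//; apply: lee_wpmul2l; first by rewrite lee_fin.
have IqTk : I (q + T + shift k) by rewrite addrAC; apply: I_add => //; exact: ltW.
apply: (@time_measure_ge _ C tau F sg oC iC sg1 sgF dtau cF mono B (shift k) q (q + T)) => //.
by rewrite lerDl ltW.
Qed.

Let window_cover q x : C x -> exists k, window q k x.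
Proof.
move=> Cx; pose k : int := Num.ceil ((tau x - q) / T).
exists k; split; first exact: Cx.
rewrite /mkset.
have := ceil_itv ((tau x - q) / T).
rewrite -/k ltr_pdivlMr// ler_pdivrMr// intrD mulrDl mulN1r /shift => /andP[].
by rewrite ltrBrDl lerBlDl -addrA => -> ->.
Qed.

(** The number of the period can be read off the time of [x] by [Num.ceil]; the half-open window
    makes it unique. *)
Let image_disjoint q (B : set R) x (j k : int) : B `<=` `]q, q + T]%classic ->
  image q B j x -> image q B k x -> j = k.
Proof.
move=> BW [_ /BW jx] [_ /BW kx].
have ceilE (i : int) : (tau x - shift i) \in `]q, q + T] ->
    Num.ceil ((tau x - q) / T) = i + 1.
  rewrite in_itv/= => /andP[qi iq]; apply: ceil_def.
  rewrite addrK ltr_pdivlMr// ler_pdivrMr// intrD mulrDl mul1r.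
  apply/andP; split; first by move: qi; rewrite /shift; lra.
  by move: iq; rewrite /shift; lra.
by apply: (addIr 1); rewrite -(ceilE _ jx) -(ceilE _ kx).
Qed.

Lemma periodic_component_integral_lty :
  (\int[leb R]_(x in C) (sigma x)%:E < +oo)%E.
Proof.
have [K K0 HK] := weightK.
have [delta [q [B [d0 Iq mB BW [B0 BG]]]]] := good_times.
have Bfin : mu B \is a fin_num.
  rewrite ge0_fin_numE//; apply: (@le_lt_trans _ _ (mu `]q, q + T]%classic)).
    by apply: le_measure; rewrite ?inE.
  by rewrite lebesgue_measure_itv/=; case: ifP; rewrite ?ltry// -EFinB ltry.
have m0 : 0 < fine (mu B).
  by rewrite lt_neqAle fine_ge0// andbT eq_sym fine_eq0//; apply/eqP.
(* The quotient of the upper bound [K * v * T] for a window and the lower bound for its image, which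
   has [v / K], the p-th power of [delta] and the measure of [B] as factors; [v] at [q + shift k]
   cancels. *)
pose A := K ^+ 2 * T / (delta `^ p * fine (mu B)).
have dp0 : 0 < delta `^ p by rewrite powR_gt0.
have A0 : 0 <= A.
  by rewrite divr_ge0 ?mulr_ge0 ?exprn_ge0 ?(ltW K0) ?(ltW T_gt0) ?(ltW m0) ?(ltW dp0).
have [e [eS eI]] := countable_enumeration int.
pose Q n := if e n is Some k then
  (if pselect (I (q + shift k)) then image q B k else set0) else set0.
pose D n := if e n is Some k then window q k else set0.
have QC n : Q n `<=` C.
  rewrite /Q; case: (e n) => [k|//]; case: pselect => [Ik|nI] //=.
  by move=> x [].
have mQ n : measurable (Q n).
  rewrite /Q; case: (e n) => [k|//]; case: pselect => [Ik|nI] //=.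
  exact: (measurable_time_preimage oC dtau).
have mD n : measurable (D n) by rewrite /D; case: (e n) => [k|//].
have DC n : D n `<=` C.
  by rewrite /D; case: (e n) => [k|//] x [].
have piece n : (\int[leb R]_(x in D n) (sigma x)%:E <=
    A%:E * \int[leb R]_(x in Q n) (cabs (f x) `^ p * rho x)%:E)%E.
  have rhs0 : (0 <= A%:E * \int[leb R]_(x in Q n) (cabs (f x) `^ p * rho x)%:E)%E.
    by apply: mule_ge0; [rewrite lee_fin|apply: integral_ge0 => x Qx; apply: f_ge0; exact: QC Qx].
  move: rhs0; rewrite /D /Q; case: (e n) => [k|]; last by rewrite !integral_set0.
  (* If [q + shift k] is not in the range, no point of the component has an earlier time, so the
     window is empty. *)
  case: pselect => [Ik|nI] /=; last first.
    rewrite (_ : window q k = set0) ?integral_set0//.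
    apply/seteqP; split => // x [Cx /andP[_ xq]]; apply: nI.
    rewrite -(subrK (tau x) (q + _)) addrC; apply: I_add; first by exists x.
    by rewrite subr_ge0.
  move=> _; apply: (le_trans (window_integral_le K0 HK Ik)).
  have := image_integral_ge K0 HK d0 mB BW (fun r Br => BG k r Ik Br) Iq Ik.
  rewrite -(fineK Bfin) -EFinM => H.
  have A0E : (0 <= A%:E)%E by rewrite lee_fin.
  apply: le_trans (lee_wpmul2l A0E H).
  rewrite -EFinM lee_fin /A le_eqVlt; apply/orP; left; apply/eqP.
  by field; rewrite !gt_eqF.
apply: (@le_lt_trans _ _ (\sum_(n <oo) \int[leb R]_(x in D n) (sigma x)%:E)%E).
  have ms : measurable_fun (C : set L) (EFin \o sigma) by exact/measurable_EFinP.
  have s0 x : C x -> (0 <= (EFin \o sigma) x)%E.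
    by move=> Cx; rewrite lee_fin ltW// sigma_gt0.
  have CD : C `<=` \bigcup_n D n.
    move=> x Cx; have [k xk] := window_cover q Cx; have [n en] := eS k.
    by exists n => //; rewrite /D en.
  exact: (ge0_integral_cover_le (leb R) mC ms s0 (fun n => borel_leb (mD n)) DC CD).
apply: (@le_lt_trans _ _
    (\sum_(n <oo) (A%:E * \int[leb R]_(x in Q n) (cabs (f x) `^ p * rho x)%:E))%E).
  apply: lee_nneseries => [n _ _|n _]; last exact: piece.
  by apply: integral_ge0 => x Dx; rewrite lee_fin ltW// sigma_gt0//; exact: DC Dx.
rewrite nneseriesZl; last by move=> n _; apply: integral_ge0 => x /QC/f_ge0.
have UC : \bigcup_n Q n `<=` C by apply: bigcup_sub => n _; exact: QC.
(* The images are disjoint, so together they contribute at most the integral over [Omega], finite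
   because [f] is in the space. *)
rewrite -ge0_integral_bigcup; first last.
- move=> i j _ _ [x []]; rewrite /Q.
  case ei : (e i) => [k|//]; case ej : (e j) => [l|//].
  case: pselect => // Ik; case: pselect => // Il /= Qk Ql.
  by apply: eI ei _; rewrite ej (image_disjoint BW Qk Ql).
- by move=> x Qx; apply: f_ge0; exact: UC Qx.
- exact: (measurable_funS mC UC measurable_f).
- by move=> n; exact: borel_leb.
apply: lte_mul_pinfty => //.
have [_ _] := fL; rewrite /Lp_norm => /(poweR_root_lty p_gt0) H.
apply: le_lt_trans (H _); last first.
  by apply: integral_ge0 => x Ox; rewrite lee_fin mulr_ge0 ?powR_ge0// ltW// rho_gt0.
apply: rho_integral_subset => // x /UC; exact: CO.
Qed.

End periodic_component.

Section dense_periodic.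
Context {R : realType}.
Notation L := (lebesgue_type R).
Variables (p : R) (Omega : set R) (F : R -> R) (h : R -> R[i])
  (J : R -> set R) (phi : R -> R -> R) (rho : R -> R).
Hypotheses (p_gt0 : 0 < p) (Omega_open : open Omega) (F_C1 : is_C1_on Omega F)
  (h_cont : forall x, Omega x -> {for x, continuous (h : R -> R[i]^o)})
  (phi_flow : is_flow Omega F J phi) (Omega_fwd : forward_invariant Omega J)
  (rho_meas : lebesgue_measurable_fun Omega rho)
  (rho_gt0 : forall x, Omega x -> 0 < rho x)
  (rho_adm : p_admissible Omega p rho F h phi).

Lemma open_leb_neq0 (C : set R) (x : R) : open C -> C x -> leb R (C : set L) <> 0%E.
Proof.
move=> oC Cx; have [e /= e0 He] := (@nbhs_ballP _ _ _ _).1 (oC x Cx).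
have mB : measurable (ball x e : set R) by exact: measurable_ball.
rewrite leb_borel => C0.
have : (lebesgue_measure (ball x e) <= 0)%E.
  by rewrite -C0; apply: le_measure; rewrite ?inE//; exact: open_measurable.
by rewrite lebesgue_measure_ball ?(ltW e0)// lee_fin leNgt pmulrn_lgt0// e0.
Qed.

(** Approximate the indicator of a part [A] of [D] of finite mass with error below that mass; a
    function vanishing almost everywhere on [D] would leave an error of at least the whole mass. *)
Lemma in_Lp_dense_charge (P : set (R -> R[i])) (D : set L) :
  dense_in_Lp Omega p rho P -> measurable D -> D `<=` Omega -> leb R D <> 0%E ->
  exists2 f, P f & leb R (D `&` [set x | f x != 0]) <> 0%E.
Proof.
move=> dP mD DO D0.
have mO : measurable (Omega : set L) by apply: borel_leb; exact: open_measurable.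
have [A [mA AD A0 Agt0 Aoo]] := finite_mass_subset mD
  (measurable_funS mO DO rho_meas) (fun x Dx => rho_gt0 (DO _ Dx)) D0.
have AO : A `<=` Omega by move=> x /AD/DO.
have Afin : (\int[leb R]_(x in A) (rho x)%:E \is a fin_num)%E.
  by rewrite ge0_fin_numE// ltW.
have e0 : 0 < fine (\int[leb R]_(x in A) (rho x)%:E)%E by rewrite -lte_fin fineK.
have [f Pf Hf] := dense_rho_integral p_gt0 rho_gt0 dP
  (in_Lp_indic p_gt0 Omega_open rho_meas rho_gt0 1 mA AO Aoo) e0.
exists f => // S0; set S := D `&` _ in S0.
have mS : measurable S.
  have [B [mB B0] SB] := leb_null_borel_cover S0.
  exact: (leb_null_sub (borel_leb mB) B0 SB).1.
rewrite fineK// in Hf.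
have mr : measurable_fun (A `\` S) (fun x => (rho x)%:E).
  apply/measurable_EFinP; apply: (measurable_funS mO _ rho_meas).
  by move=> x [/AO].
have ASO x : ((A `\` S) `|` S) x -> (0 <= (rho x)%:E)%E.
  by move=> [[/AO Ox _]|[/DO Ox _]]; rewrite lee_fin ltW// rho_gt0.
have : (\int[leb R]_(x in A) (rho x)%:E < \int[leb R]_(x in A) (rho x)%:E)%E.
  apply: le_lt_trans Hf.
  apply: (@le_trans _ _ (\int[leb R]_(x in (A `\` S) `|` S) (rho x)%:E)%E).
    apply: ge0_subset_integral_any => // x Ax.
    by have [|] := pselect (S x); [right|left].
  rewrite (ge0_integralU_null mS S0 (measurableD mA mS) mr ASO).
  apply: ge0_le_integral_any.
  - by move=> x ASx; apply: ASO; left.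
  - by move=> x Ox; rewrite lee_fin mulr_ge0 ?powR_ge0// ltW// rho_gt0.
  - move=> x [Ax nS] _; rewrite lee_fin.
    have -> : f x = 0.
      by apply/eqP; apply: contrapT => /negP fx; apply: nS; split => //; exact: AD.
    by rewrite mul1r indicE mem_set// sub0r cabsN cabs1 powR1 mul1r.
  - by move=> x [/AO].
by rewrite ltxx.
Qed.

Lemma periodic_dense_component_integral (z x : R) :
  dense_in_Lp Omega p rho (periodic_points Omega p rho (semigroup_op phi h)) ->
  connected_component (Omega `\` zeros Omega F) z x ->
  (component_integral p rho F h
     (connected_component (Omega `\` zeros Omega F) z) x < +oo)%E.
Proof.
move=> dP Cx; set C := connected_component _ z in Cx *.
have oC : open C by exact: (component_open Omega_open F_C1).
have mC : measurable (C : set L) by apply: borel_leb; exact: open_measurable.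
have CO : C `<=` Omega by move=> y /connected_component_sub[].
have [f [fL [T T0 fT]] f0] := in_Lp_dense_charge dP mC CO (open_leb_neq0 oC Cx).
have [sg sg1 sgF] := field_sign F_C1 Cx.
exact: (periodic_component_integral_lty p_gt0 Omega_open F_C1 h_cont phi_flow
  Omega_fwd rho_meas rho_gt0 rho_adm Cx fL T0 fT f0 sg1 sgF).
Qed.

End dense_periodic.

Theorem theorem1 (R : realType) (p : R) (Omega : set R) (F : R -> R)
  (h : R -> R[i]) (J : R -> set R) (phi : R -> R -> R)
  (p_ge1 : 1 <= p)
  (Omega_open : open Omega) (Omega_itv : is_interval Omega)
  (Omega_nonempty : Omega !=set0)
  (F_C1 : is_C1_on Omega F)
  (h_cont : forall x, Omega x -> {for x, continuous (h : R -> R[i]^o)})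
  (phi_flow : is_flow Omega F J phi)
  (Omega_fwd : forward_invariant Omega J)
  (dF_bounded : [bounded derive1 F x | x in Omega])
  (Reh_bounded : [bounded complex.Re (h x) | x in Omega])
  (h_zeros : exists gamma : R, forall x, zeros Omega F x -> h x = gamma%:C)
  (* at zeros of [F] the quotient is 0, since [0^-1 = 0] *)
  (Imh_L1 :
     let alpha := ereal_inf [set x%:E | x in Omega] in
     let omega := ereal_sup [set x%:E | x in Omega] in
     let q := fun y : R => (complex.Im (h y) / F y)%:E in
     (forall beta, Omega beta ->
        lebesgue_measure.-integrable
          [set y : R | (alpha < y%:E < beta%:E)%E] q) \/
     (forall beta, Omega beta ->
        lebesgue_measure.-integrable
          [set y : R | (beta%:E < y%:E < omega)%E] q))
  (rho : R -> R)
  (rho_meas : lebesgue_measurable_fun Omega rho)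
  (rho_gt0 : forall x, Omega x -> 0 < rho x)
  (rho_adm : p_admissible Omega p rho F h phi) :
  let U := Omega `\` zeros Omega F in
  (chaotic Omega p rho (semigroup_op phi h) <->
     lebesgue_measure (zeros Omega F) = 0%E /\
     forall z, U z ->
       exists2 x, connected_component U z x &
         (component_integral p rho F h (connected_component U z) x < +oo)%E)
  /\
  (chaotic Omega p rho (semigroup_op phi h) <->
     lebesgue_measure (zeros Omega F) = 0%E /\
     forall z, U z ->
       forall x, connected_component U z x ->
         (component_integral p rho F h (connected_component U z) x < +oo)%E).
Proof.
have p_gt0 : 0 < p by exact: lt_le_trans p_ge1.
have [gamma hz] := h_zeros; move=> U.
have sufficiency : lebesgue_measure (zeros Omega F) = 0%E ->
    (forall z, U z -> exists2 x, connected_component U z x &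
       (component_integral p rho F h (connected_component U z) x < +oo)%E) ->
    chaotic Omega p rho (semigroup_op phi h).
  move=> Z0 Hz; exact: (component_integrals_chaotic p_gt0 Omega_open F_C1 h_cont
    phi_flow Omega_fwd rho_meas rho_gt0 Z0 Hz).
have zeros_null : chaotic Omega p rho (semigroup_op phi h) ->
    lebesgue_measure (zeros Omega F) = 0%E.
  by move=> [hc _]; exact: (hypercyclic_zeros_null p_gt0 Omega_open F_C1 phi_flow
    rho_meas rho_gt0 hz hc).
have integrals_lty : chaotic Omega p rho (semigroup_op phi h) ->
    forall z x, connected_component U z x ->
    (component_integral p rho F h (connected_component U z) x < +oo)%E.
  move=> [_ dP] z x Cx.
  exact: (periodic_dense_component_integral p_gt0 Omega_open F_C1 h_cont phi_flow
    Omega_fwd rho_meas rho_gt0 rho_adm dP Cx).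
have base z : U z -> connected_component U z z.
  by move=> Uz; exact: connected_component_refl.
(* Each component contains its label [z], which serves as the base point wherever one has to be
   exhibited. *)
split; split.
- move=> ch; split; first exact: zeros_null.
  by move=> z Uz; exists z; [exact: base|apply: integrals_lty => //; exact: base].
- by move=> [Z0 Hz]; exact: sufficiency.
- move=> ch; split; first exact: zeros_null.
  by move=> z _ x; exact: integrals_lty.
- move=> [Z0 Hz]; apply: sufficiency => // z Uz; exists z; first exact: base.
  by apply: Hz => //; exact: base.
Qed.
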